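(* (1) Let $\tau\in\mathbb{C}$ with $\operatorname{Im}\tau>0$, $\Gamma=\mathbb{Z}+\mathbb{Z}\tau$, $\Sigma=\mathbb{C}/\Gamma$, and let $X$ be the total space of a line bundle $L(H,\alpha)$ over $\Sigma$. Then $X$ admits a complete K\''ahler metric $\omega$ with $BI\ge0$ if and only if $H=0$. Moreover, assume that such an $\omega$ is non-flat, and write $\alpha(1)=e^{2\pi i\theta_1}$, $\alpha(\tau)=e^{2\pi i\theta_2}$ with $\theta_1,\theta_2\in[0,1)$. Then: (i) If either of $\theta_1,\theta_2$ is irrational, there exist a constant $C>0$ and a smooth positive function $\widetilde u$ on $\mathbb{C}$ such that $\ln\widetilde u$ is superharmonic, $\widetilde u$ is rotationally symmetric (i.e. $\widetilde u(\xi)=\widetilde u(|\xi|)$ for all $\xi\in\mathbb{C}$), and $$\omega=\sqrt{-1}\big[C\,dz\wedge d\bar z+\widetilde u(|\xi|)\,d\xi\wedge d\bar\xi\big].$$ (ii) If both $\theta_1,\theta_2$ are rational, let $k$ be the minimal positive integer such that $k\theta_1$ and $k\theta_2$ are integers. Then there exist a constant $C>0$, a holomorphic function $h(\xi)=\widehat h(\xi^k)$ with $\widehat h$ entire on $\mathbb{C}$, and a smooth positive function $\widetilde u$ on $\mathbb{C}$ such that $\ln\widetilde u$ is superharmonic, $\widetilde u(\xi)=\widetilde u(e^{2\pi i/k}\xi)$ for all $\xi\in\mathbb{C}$, and $$\omega=\sqrt{-1}\big[C\,d(z+h(\xi))\wedge d(\bar z+\overline{h(\xi)})+\widetilde u(\xi)\,d\xi\wedge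 d\bar\xi\big].$$ (2) Let $n\ge3$ be an integer and let $L(H,\alpha)$ be a line bundle over a compact complex torus $M$ of complex dimension $n-1$, with total space $X$. Assume that $X$ admits a complete K\''ahler metric $g$ with $BI\ge0$ such that the lifted metric $\widetilde g$ on the universal covering $\widetilde X$ satisfies $\widetilde g=g_e+g_0$ (that is, $(\widetilde X,\widetilde g)$ is holomorphically isometric to the product $(\mathbb{C}^{n-1},g_e)\times(\mathbb{C},g_0)$), where $g_e$ is the standard Euclidean metric on $\mathbb{C}^{n-1}$ and $g_0$ is a complete K\''ahler metric with nonnegative Gauss curvature on $\mathbb{C}$. Then $H=0$.
   Context: $BI\ge0$ means nonnegative (holomorphic) bisectional curvature. Let $M=V/\Gamma$ be a compact complex torus ($V$ a finite-dimensional complex vector space, $\Gamma\subset V$ a lattice of full rank). Let $H$ be a Hermitian form on $V$ (complex linear in the first argument) such that $\operatorname{Im}H$ is $\mathbb{Z}$-valued on $\Gamma\times\Gamma$, and let $\alpha:\Gamma\to S^1$ satisfy $\alpha(\gamma_1+\gamma_2)=e^{i\pi\operatorname{Im}H(\gamma_1,\gamma_2)}\alpha(\gamma_1)\alpha(\gamma_2)$. The line bundle $L(H,\alpha)$ over $M$ is the quotient of $V\times\mathbb{C}$ by the action of $\gamma\in\Gamma$: $$(z,\xi)\mapsto\big(z+\gamma,\ \alpha(\gamma)e^{\pi H(z,\gamma)+\frac{\pi}{2}H(\gamma,\gamma)}\xi\big).$$ When $M$ is an elliptic curve, $H$ is identified with a real number via $H(z,w)=Hz\bar w$. In (1), $(z,\xi)$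 denote the (local) coordinates on $X$ induced from those on $\mathbb{C}^2=V\times\mathbb{C}$, and a metric is identified with its K\''ahler form. *)

(* Defs.v *)
From HB Require Import structures.
From mathcomp Require Import all_boot all_order all_algebra.
From mathcomp Require Import all_classical all_reals all_analysis.
From mathcomp Require Import complex.

Set Implicit Arguments.
Unset Strict Implicit.
Unset Printing Implicit Defensive.

Import Order.TTheory GRing.Theory Num.Theory.
Import numFieldNormedType.Exports.

Local Open Scope classical_set_scope.
Local Open Scope ring_scope.

(* [R[i]] packed as a [numClosedFieldType]: this is what lets canonical        *)
(* inference find its topology and its normed-module structure over itself.   *)
Definition Cplx (R : realType) : numClosedFieldType := R[i].

Definition ofR (R : realType) (x : R) : Cplx R := (x%:C)%C.

Definition expi (R : realType) (t : R) : Cplx R := (cos t +i* sin t)%C.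

Definition cexp (R : realType) (z : Cplx R) : Cplx R :=
  ofR (expR (complex.Re z)) * expi (complex.Im z).

Definition adjmx (R : realType) (m n : nat) (A : 'M[Cplx R]_(m, n)) :
  'M[Cplx R]_(n, m) := (map_mx Num.conj A)^T.

Section Calculus.
Context {R : realType}.
Local Notation C := (Cplx R).

Section Functions.
Context {V : normedModType C}.
Implicit Types (v : V) (p : V).

Definition dline v (f : V -> R) p : R := derive1 (fun t : R => f (p + ofR t *: v)) 0.

(* [foldr dline f s] is the iterated directional derivative of [f] along the  *)
(* vectors of [s].                                                            *)
Definition smooth (f : V -> R) : Prop := forall s : seq V,
  continuous (foldr dline f s) /\
  (forall v p, derivable (fun t : R => foldr dline f s (p + ofR t *: v)) 0 1).

Definition csmooth (f : V -> C) : Prop :=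
  smooth (fun p => complex.Re (f p)) /\ smooth (fun p => complex.Im (f p)).

Definition cdline v (f : V -> C) p : C :=
  (dline v (fun q => complex.Re (f q)) p +i*
   dline v (fun q => complex.Im (f q)) p)%C.

(* For [v] the k-th vector of the standard basis of C^n, [wirt v] and         *)
(* [wirtbar v] are d/dz_k and d/d(conj z_k).                                  *)
Definition wirt v (f : V -> C) p : C :=
  (cdline v f p - 'i * cdline ('i *: v) f p) / 2.

Definition wirtbar v (f : V -> C) p : C :=
  (cdline v f p + 'i * cdline ('i *: v) f p) / 2.

End Functions.

Definition laplacian (f : C -> R) (x : C) : R :=
  dline (1 : C) (dline (1 : C) f) x + dline ('i : C) (dline ('i : C) f) x.

(* The definition for functions of class C^2; it is only applied to smooth    *)
(* functions.                                                                 *)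
Definition superharmonic (f : C -> R) : Prop := forall x, laplacian f x <= 0.

Definition entire (f : C -> C) : Prop := forall x, derivable f x 1.

End Calculus.

(* A Hermitian metric is given by the matrix g p of its coefficients          *)
(* g_{i jbar}(p); the associated form is                                      *)
(*   omega = sqrt(-1) sum_{i,j} g_{i jbar} dz_i /\ d(conj z_j)                *)
(* and the Riemannian norm is |v|^2 = sum_{i,j} g_{i jbar} v_i conj(v_j).     *)

Section Metrics.
Context {R : realType}.
Local Notation C := (Cplx R).

Section Fixed_dimension.
Context {n : nat}.
Local Notation pt := 'rV[C]_n.
Implicit Types (g : pt -> 'M[C]_n) (p : pt).

Local Notation e_ i := (delta_mx 0 i : 'rV[C]_n).

Record kaehler_metric g : Prop := KaehlerMetric {
  kaehler_smooth : forall i j, csmooth (fun p => g p i j);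
  kaehler_hermitian : forall p, adjmx (g p) = g p;
  kaehler_posdef : forall p (v : pt), v != 0 -> 0 < (v *m g p *m adjmx v) 0 0;
  (* d omega = 0; the (1,2)-part of d omega is conjugate to its (2,1)-part *)
  kaehler_closed : forall p i j k,
    wirt (e_ k) (fun q => g q i j) p = wirt (e_ i) (fun q => g q k j) p
}.

(* R_{i jbar k lbar} = - d_k d_lbar g_{i jbar}                                *)
(*               + sum_{q,s} g^{s qbar} d_k g_{i qbar} d_lbar g_{s jbar}      *)
Definition curvature g (i j k l : 'I_n) p : C :=
  - wirt (e_ k) (wirtbar (e_ l) (fun x => g x i j)) p
  + \sum_(q < n) \sum_(s < n) invmx (g p) q s *
      wirt (e_ k) (fun x => g x i q) p * wirtbar (e_ l) (fun x => g x s j) p.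

Definition flat g : Prop := forall i j k l p, curvature g i j k l p = 0.

(* R(u, ubar, v, vbar) for the (1,0)-vectors u and v. *)
Definition bisectional g p (u v : pt) : C :=
  \sum_(i < n) \sum_(j < n) \sum_(k < n) \sum_(l < n)
    curvature g i j k l p * u 0 i * (u 0 j)^* * v 0 k * (v 0 l)^*.

Definition BI_ge0 g : Prop := forall p u v, 0 <= bisectional g p u v.

(* For holomorphic f, the coefficient matrix of df /\ d(conj f). *)
Definition dwedge (f : pt -> C) p : 'M[C]_n :=
  \matrix_(i < n, j < n) ('D_(e_ i) f p * ('D_(e_ j) f p)^*).

Definition C1_real (f : R -> R) : Prop :=
  (forall t, derivable f t 1) /\ continuous (derive1 f).

(* A C^1 curve on [0, 1] is the restriction of a C^1 curve on R. Zero         *)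
(* velocity is allowed, so that piecewise C^1 curves are C^1 up to            *)
(* reparametrization.                                                         *)
Definition C1_curve (c : R -> pt) : Prop := forall j,
  C1_real (fun t => complex.Re (c t 0 j)) /\
  C1_real (fun t => complex.Im (c t 0 j)).

Definition velocity (c : R -> pt) (t : R) : pt :=
  \row_(j < n) (derive1 (fun s : R => complex.Re (c s 0 j)) t +i*
                 derive1 (fun s : R => complex.Im (c s 0 j)) t)%C.

Definition speed g (c : R -> pt) (t : R) : R :=
  Num.sqrt (complex.Re ((velocity c t *m g (c t) *m adjmx (velocity c t)) 0 0)).

Definition curve_length g (c : R -> pt) : \bar R :=
  (\int[lebesgue_measure]_(t in `[0%R, 1%R]) (speed g c t)%:E)%E.

(* When A and B are orbits of a group acting freely and properly              *)
(* discontinuously by isometries of g, the curves from A to B are the lifts   *)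
(* of the curves joining the points A and B of the quotient, and this is the  *)
(* Riemannian distance of the quotient.                                       *)
Definition riem_dist g (A B : set pt) : \bar R :=
  ereal_inf [set L | exists c : R -> pt,
    [/\ C1_curve c, A (c 0), B (c 1) & L = curve_length g c]].

(* Completeness of the quotient of C^n whose points are the orbits in Q. *)
Definition complete_metric g (Q : set (set pt)) : Prop :=
  forall x : nat -> set pt, (forall k, Q (x k)) ->
    (forall e : R, 0 < e -> exists N, forall k l, (N <= k)%N -> (N <= l)%N ->
       (riem_dist g (x k) (x l) < e%:E)%E) ->
    exists2 y, Q y & forall e : R, 0 < e -> exists N, forall k, (N <= k)%N ->
       (riem_dist g (x k) y < e%:E)%E.

Definition points : set (set pt) := [set [set p] | p in [set: pt]].

(* The rows of the library's ['J f p] are the derivatives of f along the      *)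
(* basis vectors, so that df_p(v) = v *m 'J f p.                              *)
Definition pullback (f : pt -> pt) g p : 'M[C]_n :=
  jacobian f p *m g (f p) *m adjmx (jacobian f p).

Definition biholomorphic (f : pt -> pt) : Prop :=
  (forall p, differentiable f p) /\
  exists f' : pt -> pt,
    [/\ cancel f f', cancel f' f & forall p, differentiable f' p].

End Fixed_dimension.

Definition conformal_factor (g : 'rV[C]_1 -> 'M[C]_1) (x : C) : R :=
  complex.Re (g (const_mx x) 0 0).

(* The Gauss curvature of the Riemannian metric u |dx|^2 on C. *)
Definition gauss_curvature (g : 'rV[C]_1 -> 'M[C]_1) (x : C) : R :=
  let u := conformal_factor g in - laplacian (fun y => ln (u y)) x / (2 * u x).

Definition euclidean_product (m : nat) (g0 : 'rV[C]_1 -> 'M[C]_1)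
    (p : 'rV[C]_(m + 1)) : 'M[C]_(m + 1) :=
  block_mx 1%:M 0 0 (g0 (rsubmx p)).

End Metrics.

(* A point (z, xi) of C^m x C is the row vector [row_mx z xi] of C^(m + 1).   *)
(* The tensors on the total space X are identified with the tensors on        *)
(* C^(m + 1) that are invariant under the deck transformations, i.e. with     *)
(* their lifts to the universal covering.                                     *)

Section Line_bundles.
Context {R : realType}.
Local Notation C := (Cplx R).

Section Torus.
Context {m : nat}.
Local Notation V := 'rV[C]_m.
Implicit Types (Gam : set V) (H : V -> V -> C) (alpha : V -> C).

Definition lattice Gam : Prop := exists b : 'I_(m + m) -> V,
  (forall x : 'I_(m + m) -> R,
     \sum_(i < m + m) ofR (x i) *: b i = 0 -> forall i, x i = 0) /\
  Gam = [set gam | exists k : 'I_(m + m) -> int,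
                     gam = \sum_(i < m + m) (k i)%:~R *: b i].

Record line_bundle_data Gam H alpha : Prop := LineBundleData {
  lb_linear : forall w, scalar (H ^~ w);
  lb_hermitian : forall z w, H z w = (H w z)^*;
  lb_integral : forall x y, Gam x -> Gam y ->
    complex.Im (H x y) \is a Num.int;
  lb_unitary : forall x, Gam x -> `|alpha x| = 1;
  lb_semicharacter : forall x y, Gam x -> Gam y ->
    alpha (x + y) = expi (pi * complex.Im (H x y)) * alpha x * alpha y
}.

Definition deck H alpha (gam : V) (p : 'rV[C]_(m + 1)) : 'rV[C]_(m + 1) :=
  let z := lsubmx p in
  row_mx (z + gam)
    ((alpha gam * cexp (ofR pi * H z gam + ofR (pi / 2) * H gam gam))
       *: rsubmx p).

Definition total_space Gam H alpha : set (set 'rV[C]_(m + 1)) :=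
  [set [set deck H alpha gam p | gam in Gam] | p in [set: 'rV[C]_(m + 1)]].

Definition kaehler_on_total_space Gam H alpha
    (g : 'rV[C]_(m + 1) -> 'M[C]_(m + 1)) : Prop :=
  kaehler_metric g /\
  forall gam, Gam gam -> forall p, pullback (deck H alpha gam) g p = g p.

Definition complete_kaehler_BI_ge0 Gam H alpha
    (g : 'rV[C]_(m + 1) -> 'M[C]_(m + 1)) : Prop :=
  [/\ kaehler_on_total_space Gam H alpha g,
      complete_metric g (total_space Gam H alpha) & BI_ge0 g].

Definition fiber_coord (p : 'rV[C]_(m + 1)) : C := rsubmx p 0 0.

End Torus.

Definition elliptic_lattice (tau : C) : set 'rV[C]_1 :=
  [set gam | exists a b : int, gam = const_mx (a%:~R + b%:~R * tau)].

Definition elliptic_form (H : R) (z w : 'rV[C]_1) : C :=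
  ofR H * z 0 0 * (w 0 0)^*.

Definition base_coord (p : 'rV[C]_(1 + 1)) : C := lsubmx p 0 0.

End Line_bundles.

(* Main.v *)
(* Let h be the inverse of the lifted metric. By Bochner's formula and BI >= 0, *)
(* the squared h-norm of a constant covector is plurisubharmonic, with Levi form *)
(* zero only if the covector annihilates dbar h. Compactness of the torus bounds *)
(* these functions along suitable entire curves, so that Liouville's theorem     *)
(* applies. On the zero section, |d xi|^2 forces H >= 0. If H(v,v) > 0, curves    *)
(* t -> (z + t v, xi e^(bt)) show that the rows h_j. of the base covectors are    *)
(* holomorphic; the derivative of h_(j xi) along the zero section then differs   *)
(* from the conjugate-linear function pi sum_i h_ji H(e_i, .) by a periodic       *)
(* function, and Liouville's theorem gives H = 0.                                *)
(* If H = 0, the lines xi = const show that the metric depends on xi only. For   *)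
(* m = 1 the Kaehler condition makes it C |dz + phi(xi) dxi|^2 + u(xi) |dxi|^2    *)
(* with phi holomorphic, and BI >= 0 makes ln u superharmonic. The angles t such *)
(* that phi(e^(it) xi) e^(it) = phi(xi) and u(e^(it) xi) = u(xi) form a closed    *)
(* group: it is everything in case (i), which forces phi = 0, and it contains    *)
(* 2 pi / k in case (ii), where h is a primitive of phi and is a function of     *)
(* xi^k. Conversely the Euclidean metric descends to X when H = 0.               *)

Require Import Defs.
From HB Require Import structures.
From mathcomp Require Import all_boot all_order all_algebra.
From mathcomp Require Import all_classical all_reals all_analysis.
From mathcomp Require Import complex.
From mathcomp Require Import ring lra.

Set Implicit Arguments.
Unset Strict Implicit.
Unset Printing Implicit Defensive.

Import Order.TTheory GRing.Theory Num.Theory.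
Import numFieldNormedType.Exports.

Local Open Scope classical_set_scope.
Local Open Scope ring_scope.

(** * Complex numbers and their topology *)

Section Complex_topology.
Context {R : realType}.
Local Notation C := (Cplx R).
Local Notation Re := complex.Re.
Local Notation Im := complex.Im.
Implicit Types (x y : C) (a b : R).

Lemma cplxP x y : Re x = Re y -> Im x = Im y -> x = y.
Proof. by case: x y => [? ?] [? ?] /= -> ->. Qed.

Lemma ReD x y : Re (x + y) = Re x + Re y. Proof. by case: x y => [? ?] []. Qed.
Lemma ImD x y : Im (x + y) = Im x + Im y. Proof. by case: x y => [? ?] []. Qed.
Lemma ReN x : Re (- x) = - Re x. Proof. by case: x. Qed.
Lemma ImN x : Im (- x) = - Im x. Proof. by case: x. Qed.
Lemma ReB x y : Re (x - y) = Re x - Re y. Proof. by rewrite ReD ReN. Qed.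
Lemma ImB x y : Im (x - y) = Im x - Im y. Proof. by rewrite ImD ImN. Qed.
Lemma ReM x y : Re (x * y) = Re x * Re y - Im x * Im y.
Proof. by case: x y => [? ?] []. Qed.
Lemma ImM x y : Im (x * y) = Re x * Im y + Im x * Re y.
Proof. by case: x y => [? ?] []. Qed.
Lemma imagE : 'i = (0 +i* 1)%C :> C. Proof. by rewrite -complexiE. Qed.
Lemma conjE x : x^* = (Re x -i* Im x)%C. Proof. by case: x. Qed.
Lemma Re_conj x : Re x^* = Re x. Proof. by rewrite conjE. Qed.
Lemma Im_conj x : Im x^* = - Im x. Proof. by rewrite conjE. Qed.
Lemma cplxE x : x = ofR (Re x) + 'i * ofR (Im x).
Proof. by apply: cplxP; rewrite !(ReD, ImD, ReM, ImM) imagE /=; lra. Qed.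

Lemma ofRD a b : ofR (a + b) = ofR a + ofR b.
Proof. by apply: cplxP; rewrite ?(ReD, ImD) //= addr0. Qed.
Lemma ofRN a : ofR (- a) = - ofR a.
Proof. by apply: cplxP; rewrite ?(ReN, ImN) //= oppr0. Qed.
Lemma ofRM a b : ofR (a * b) = ofR a * ofR b.
Proof. by apply: cplxP; rewrite !(ReM, ImM) /=; lra. Qed.
Lemma ofR1 : ofR 1 = 1 :> C. Proof. by []. Qed.
Lemma ofR0 : ofR 0 = 0 :> C. Proof. by []. Qed.

HB.instance Definition _ := GRing.isZmodMorphism.Build R C (@ofR R)
  (fun a b => etrans (ofRD a (- b)) (congr1 (+%R (ofR a)) (ofRN b))).
HB.instance Definition _ := GRing.isMonoidMorphism.Build R C (@ofR R)
  (ofR1, ofRM).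

Lemma ofRX a n : ofR (a ^+ n) = ofR a ^+ n.
Proof. exact: (rmorphXn (@ofR R)). Qed.

Lemma conj_ofR a : (ofR a)^* = ofR a :> C.
Proof. by apply: cplxP; rewrite ?Re_conj ?Im_conj //= oppr0. Qed.

Lemma conj_real x : x^* = x -> x = ofR (Re x).
Proof.
move=> xx; apply: cplxP => //=; have := congr1 (fun x : C => Im x) xx.
by rewrite Im_conj; move: (Im x) => a; lra.
Qed.

Lemma norm_real x : `|x| = ofR (Re `|x|).
Proof. by apply: cplxP => //=; rewrite normc_def. Qed.

Lemma normc_ofR a : `|ofR a| = ofR `|a| :> C.
Proof. by rewrite normc_def /= expr0n addr0 sqrtr_sqr. Qed.

Lemma normc_le x : `|x| <= ofR (`|Re x| + `|Im x|) :> C.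
Proof.
rewrite {1}(cplxE x) (le_trans (ler_normD _ _)) // normrM normCi mul1r.
by rewrite !normc_ofR ofRD.
Qed.

Lemma normcReP x e : `|x| < ofR e -> `|Re x| < e.
Proof. by move=> xe; have /(le_lt_trans (normc_ge_Re x)) := xe; rewrite ltcR. Qed.

Lemma normcImP x e : `|x| < ofR e -> `|Im x| < e.
Proof.
move=> xe; have : `|x * 'i| < ofR e by rewrite normrM normCi mulr1.
by move/normcReP; rewrite ReM imagE /= mulr0 mulr1 sub0r normrN.
Qed.

Lemma posC (e : C) : 0 < e -> exists2 a, 0 < a & e = ofR a.
Proof.
case: e => a b; rewrite ltcE /= => /andP[/eqP -> a0]; exists a => //.
Qed.

Lemma lt_ofR a b : (ofR a < ofR b) = (a < b). Proof. exact: ltcR. Qed.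
Lemma le_ofR a b : (ofR a <= ofR b) = (a <= b). Proof. exact: lecR. Qed.

Section Filters.
Context {T : Type} (F : set_system T) {FF : Filter F}.

Lemma cvg_Re (f : T -> C) (l : C) : f @ F --> l -> (fun t => Re (f t)) @ F --> Re l.
Proof.
move=> /cvgrPdist_lt fl; apply/cvgrPdist_lt => e e0.
have /fl : 0 < ofR e by rewrite -ofR0 lt_ofR.
by apply: filterS => t /normcReP; rewrite ReB.
Qed.

Lemma cvg_Im (f : T -> C) (l : C) : f @ F --> l -> (fun t => Im (f t)) @ F --> Im l.
Proof.
move=> /cvgrPdist_lt fl; apply/cvgrPdist_lt => e e0.
have /fl : 0 < ofR e by rewrite -ofR0 lt_ofR.
by apply: filterS => t /normcImP; rewrite ImB.
Qed.

Lemma cvg_cplx (f : T -> C) (l : C) : (fun t => Re (f t)) @ F --> Re l ->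
  (fun t => Im (f t)) @ F --> Im l -> f @ F --> l.
Proof.
move=> /cvgrPdist_lt fr /cvgrPdist_lt fi; apply/cvgrPdist_lt => _ /posC[e e0 ->].
have e2 : 0 < e / 2 by rewrite divr_gt0.
apply: filterS2 (fr _ e2) (fi _ e2) => t tr ti.
rewrite (le_lt_trans (normc_le _)) // lt_ofR ReB ImB.
by rewrite [ltRHS]splitr ltrD.
Qed.

Lemma cvg_ofR (f : T -> R) l : f @ F --> l -> (fun t => ofR (f t)) @ F --> ofR l.
Proof. by move=> fl; apply: cvg_cplx => //=; exact: cvg_cst. Qed.

End Filters.

Lemma continuous_Re : continuous (fun x : C => Re x).
Proof. by move=> x; apply: (@cvg_Re _ (nbhs x) _ id). Qed.

Lemma continuous_Im : continuous (fun x : C => Im x).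
Proof. by move=> x; apply: (@cvg_Im _ (nbhs x) _ id). Qed.

Lemma continuous_ofR : continuous (@ofR R).
Proof. by move=> x; apply: (@cvg_ofR _ (nbhs x) _ id). Qed.

Lemma continuous_conj : continuous (Num.conj : C -> C).
Proof.
move=> x; apply: (@cvg_cplx _ (nbhs x)).
  rewrite Re_conj (_ : (fun y : C => Re y^*) = (fun y => Re y)).
    exact: continuous_Re.
  by apply/funext => y; rewrite Re_conj.
rewrite Im_conj (_ : (fun y : C => Im y^*) = (fun y => - Im y)).
  by apply: cvgN; exact: continuous_Im.
by apply/funext => y; rewrite Im_conj.
Qed.

End Complex_topology.

(** * Derivatives along real lines *)

Section Directional_derivatives.
Context {R : realType}.
Local Notation C := (Cplx R).

Lemma is_derive_ext (f g : R -> R) (x a b : R) :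
  is_derive x 1 f a -> f =1 g -> a = b -> is_derive x 1 g b.
Proof. by move=> + /funext <- <-. Qed.

Lemma MVT0 (f df : R -> R) (s : R) : (forall t : R, is_derive t 1 f (df t)) ->
  exists2 t, `|t| <= `|s| & f s - f 0 = s * df t.
Proof.
move=> dfP.
have cf a b : {within `[a, b], continuous f}.
  apply: derivable_within_continuous => x _.
  by have [] := dfP x.
have [s0|s0|<-] := ltgtP 0 s; last by exists 0; rewrite ?subrr ?mul0r.
  have [t /[!in_itv]/= /andP[t0 ts] ->] := MVT s0 (fun x _ => dfP x) (cf _ _).
  by exists t; rewrite ?subr0 1?mulrC // !ger0_norm // ltW.
have [t /[!in_itv]/= /andP[t0 ts] e] := MVT s0 (fun x _ => dfP x) (cf _ _).
exists t; first by rewrite !ler0_norm ?lerN2 // ltW.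
by rewrite -opprB e sub0r mulrN opprK mulrC.
Qed.

Section Normed_space.
Context {V : normedModType C}.
Implicit Types (f g : V -> R) (u v p : V).

Definition is_dline f p v (d : R) := is_derive (0 : R) 1 (fun t : R => f (p + ofR t *: v)) d.
Definition line_derivable f :=
  forall v p, derivable (fun t : R => f (p + ofR t *: v)) 0 1.

Lemma is_dlineP f p v d : is_dline f p v d -> dline v f p = d.
Proof. by move=> [_ <-]; rewrite /dline derive1E. Qed.

Lemma line_derivableP f v p : line_derivable f -> is_dline f p v (dline v f p).
Proof. by move=> fD; split => //; rewrite /dline derive1E. Qed.

Lemma is_derive_line f v p (t : R) : line_derivable f ->
  is_derive t 1 (fun s : R => f (p + ofR s *: v)) (dline v f (p + ofR t *: v)).
Proof.
move=> fD; have h := line_derivableP v (p + ofR t *: v) fD.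
have k : is_derive t 1 (fun s : R => s - t) 1.
  by apply: (is_derive_shift t 1 (- t)).
rewrite -[dline _ _ _]mulr1.
move: h; rewrite /is_dline -(subrr t) => h.
refine (is_derive_ext (@is_derive1_comp _ _ (fun s => s - t) _ _ _ h k) _ _) => // s /=.
by rewrite -addrA -scalerDl -ofRD [t + _]addrC subrK.
Qed.

Lemma dline_MVT f v p s : line_derivable f ->
  exists2 t, `|t| <= `|s| &
    f (p + ofR s *: v) - f p = s * dline v f (p + ofR t *: v).
Proof.
move=> fD; have [t ts e] := MVT0 s (fun t => is_derive_line v p t fD).
by exists t => //; rewrite -e ofR0 scale0r addr0.
Qed.

Lemma dline_cst (a : R) v p : dline v (fun=> a) p = 0.
Proof. by apply: is_dlineP; exact: is_derive_cst. Qed.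

Lemma dline_dirZ (a : R) v f p : line_derivable f ->
  dline (ofR a *: v) f p = a * dline v f p.
Proof.
move=> fD; apply: is_dlineP; rewrite /is_dline.
have h := is_derive_line v p (a * 0) fD.
have k : is_derive (0 : R) 1 (fun t : R => a * t) a.
  by rewrite -[X in is_derive _ _ _ X]mulr1; exact: is_deriveZ.
apply: (is_derive_ext (is_derive1_comp h k)) => [t /=|].
  by rewrite scalerA -ofRM mulrC.
by rewrite mulr0 ofR0 scale0r addr0 mulrC.
Qed.

Lemma dline_dir0 f p : dline 0 f p = 0.
Proof.
apply: is_dlineP; apply: (is_derive_ext (is_derive_cst (f p) (0 : R) (1 : R))) => // t.
by rewrite scaler0 addr0.
Qed.

Lemma ball_segment p v (U : set V) : nbhs p U ->
  \forall s \near (0 : R)^', forall t, `|t| <= `|s| -> U (p + ofR t *: v).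
Proof.
move=> pU.
have : {for 0, continuous (fun t : R => p + ofR t *: v)}.
  apply: cvgD; first exact: cvg_cst.
  apply: cvgZr_tmp; exact: continuous_ofR.
move=> /(_ U); rewrite /= ofR0 scale0r addr0 => /(_ pU) /nbhs_ballP[e /= e0 eU].
exists e => //= s; rewrite /ball_ /= sub0r normrN => se _ t ts.
by apply: eU; rewrite /ball /= sub0r normrN (le_lt_trans ts).
Qed.

Lemma cvg_is_derive (F : R -> R) d : (fun s => s^-1 * (F s - F 0)) @ 0^' --> d ->
  is_derive (0 : R) 1 F d.
Proof.
move=> h; have e : (fun h : R => h^-1 *: ((F \o shift 0) (h *: 1) - F 0)) =
    (fun s => s^-1 * (F s - F 0)).
  by apply/funext => s /=; rewrite addr0 [_ *: 1]mulr1.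
split; first by apply/cvg_ex; exists d; rewrite /= e.
by rewrite /derive e; apply/cvg_lim.
Qed.

Lemma is_derive_cvg (F : R -> R) d : is_derive (0 : R) 1 F d ->
  (fun s => s^-1 * (F s - F 0)) @ 0^' --> d.
Proof.
have e : (fun h : R => h^-1 *: ((F \o shift 0) (h *: 1) - F 0)) =
    (fun s => s^-1 * (F s - F 0)).
  by apply/funext => s /=; rewrite addr0 [_ *: 1]mulr1.
by move=> [c <-]; move: c; rewrite /derivable /derive e.
Qed.

Lemma near0_neq0 : \forall s \near (0 : R)^', s != 0.
Proof. by exists 1 => //= s _. Qed.

Lemma dline_dirD u v f p : line_derivable f ->
  continuous (dline v f) -> dline (u + v) f p = dline u f p + dline v f p.
Proof.
move=> fD vc; apply: is_dlineP; apply: cvg_is_derive.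
rewrite ofR0 scale0r addr0.
have hu := is_derive_cvg (line_derivableP u p fD).
rewrite /= ofR0 scale0r addr0 in hu.
have -> : (fun s : R => s^-1 * (f (p + ofR s *: (u + v)) - f p)) =
  (fun s : R => s^-1 * (f (p + ofR s *: u + ofR s *: v) - f (p + ofR s *: u))) +
  (fun s : R => s^-1 * (f (p + ofR s *: u) - f p)).
  apply/funext => s.
  rewrite [RHS](_ : _ = s^-1 * (f (p + ofR s *: u + ofR s *: v) - f (p + ofR s *: u)) + s^-1 * (f (p + ofR s *: u) - f p)) //.
  by rewrite -mulrDr scalerDr !addrA subrK.
rewrite [dline u f p + _]addrC; apply: cvgD => //; apply/cvgrPdist_lt => e e0.
have /cvgrPdist_lt/(_ _ e0) := vc p.
move=> /nbhs_ballP[d /= d0 dU].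
have d20 : 0 < d / 2 by rewrite divr_gt0.
have [bu bv] := (ball_segment u (nbhsx_ballx p _ d20), ball_segment v (nbhsx_ballx (0 : V) _ d20)).
near=> s.
have s0 : s != 0 by near: s; exact: near0_neq0.
have [t ts ->] := dline_MVT v (p + ofR s *: u) s fD.
rewrite mulKf //; apply: dU.
have : ball p (d / 2) (p + ofR s *: u) by near: s; apply: filterS bu => s; apply.
have : ball (0 : V) (d / 2) (ofR t *: v).
  by move: t ts; near: s; apply: filterS bv => s h t /h; rewrite add0r.
rewrite -!ball_normE /= => h1 h2.
rewrite opprD addrA (le_lt_trans (ler_normB _ _)) //.
by rewrite [ltRHS]splitr ltrD //; move: h1; rewrite sub0r normrN.
Unshelve. all: by end_near. Qed.

Lemma is_dlineD f g p v a b :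
  is_dline f p v a -> is_dline g p v b -> is_dline (fun x => f x + g x) p v (a + b).
Proof. by move=> fa ga; exact: is_deriveD. Qed.

Lemma is_dlineN f p v a : is_dline f p v a -> is_dline (fun x => - f x) p v (- a).
Proof. by move=> fa; exact: is_deriveN. Qed.

Lemma is_dlineM f g p v a b :
  is_dline f p v a -> is_dline g p v b ->
  is_dline (fun x => f x * g x) p v (f p * b + g p * a).
Proof.
move=> fa ga; have := is_deriveM fa ga.
by rewrite /= ofR0 scale0r addr0.
Qed.

Lemma is_dlineV f p v a : f p != 0 ->
  is_dline f p v a -> is_dline (fun x => (f x)^-1) p v (- (f p) ^- 2 * a).
Proof.
move=> f0 [fD fa].
have e : f (p + ofR 0 *: v) = f p by rewrite ofR0 scale0r addr0.
rewrite -e in f0 *.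
by split; [exact: derivableV|rewrite deriveV // fa].
Qed.

Lemma is_dline_comp (F : R -> R) f p v a b : is_dline f p v a ->
  is_derive (f p) 1 F b -> is_dline (fun x => F (f x)) p v (b * a).
Proof.
move=> fa Fb; apply: (@is_derive1_comp _ F (fun t : R => f (p + ofR t *: v))) => //.
by rewrite ofR0 scale0r addr0.
Qed.

Lemma line_derivable_cst (a : R) : line_derivable (fun=> a).
Proof. by move=> v p; exact: derivable_cst. Qed.

End Normed_space.
End Directional_derivatives.

Section Smooth_functions.
Context {R : realType}.
Local Notation C := (Cplx R).

Section Normed_space.
Context {V : normedModType C}.
Implicit Types (f g : V -> R) (u v p : V) (s : seq V).

Lemma smooth_dline f v : smooth f -> smooth (dline v f).
Proof.
by move=> fS s; have := fS (rcons s v); rewrite foldr_rcons.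
Qed.

Lemma smooth_continuous f : smooth f -> continuous f.
Proof. by move=> /(_ [::])[]. Qed.

Lemma smooth_line_derivable f : smooth f -> line_derivable f.
Proof. by move=> /(_ [::])[_] fD v p; exact: fD. Qed.

Lemma smooth_is_dline f p v : smooth f -> is_dline f p v (dline v f p).
Proof. by move=> /smooth_line_derivable; exact: line_derivableP. Qed.

Lemma smooth_coind (S : (V -> R) -> Prop) :
  (forall f, S f -> [/\ continuous f, line_derivable f & forall v, S (dline v f)]) ->
  forall f, S f -> smooth f.
Proof.
move=> SP f Sf s.
have : S (foldr dline f s) by elim: s => //= v s /SP[_ _]; apply.
by move=> /SP[fc fD _]; split=> // v p; exact: fD.
Qed.

(* Closed under [dline] by construction; [smooth_coind] then yields the        *)
(* closure properties of smooth functions.                                     *)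
Inductive smooth_gen : (V -> R) -> Prop :=
| sg_smooth f : smooth f -> smooth_gen f
| sg_cst (a : R) : smooth_gen (fun=> a)
| sg_D f g : smooth_gen f -> smooth_gen g -> smooth_gen (fun x => f x + g x)
| sg_M f g : smooth_gen f -> smooth_gen g -> smooth_gen (fun x => f x * g x)
| sg_V f : smooth_gen f -> (forall x, f x != 0) -> smooth_gen (fun x => (f x)^-1).

Lemma smooth_genP f : smooth_gen f -> smooth f.
Proof.
apply: smooth_coind => {}f; elim=> {f}.
- move=> f fS; split; [exact: smooth_continuous|exact: smooth_line_derivable|].
  by move=> v; apply: sg_smooth; exact: smooth_dline.
- move=> a; split; [exact: cst_continuous|exact: line_derivable_cst|move=> v].
  rewrite (_ : dline v (fun=> a) = fun=> 0); first exact: sg_cst.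
  by apply/funext => p; exact: dline_cst.
- move=> f g Sf [fc fD fS] Sg [gc gD gS].
  have h v p := is_dlineD (line_derivableP v p fD) (line_derivableP v p gD).
  split=> [p|v p|v]; [by apply: cvgD; [exact: fc|exact: gc]|by have [] := h v p|].
  rewrite (_ : dline v _ = fun p => dline v f p + dline v g p); first exact: sg_D.
  by apply/funext => p; exact: is_dlineP.
- move=> f g Sf [fc fD fS] Sg [gc gD gS].
  have h v p := is_dlineM (line_derivableP v p fD) (line_derivableP v p gD).
  split=> [p|v p|v]; [by apply: cvgM; [exact: fc|exact: gc]|by have [] := h v p|].
  rewrite (_ : dline v _ = fun p => f p * dline v g p + g p * dline v f p).
    by apply: sg_D; apply: sg_M.
  by apply/funext => p; exact: is_dlineP.
- move=> f Sf [fc fD fS] f0.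
  have h v p := is_dlineV (f0 p) (line_derivableP v p fD).
  split=> [p|v p|v]; [by apply: cvgV => //; exact: fc|by have [] := h v p|].
  rewrite (_ : dline v _ = fun p => -1 * ((f p)^-1 * (f p)^-1) * dline v f p).
    apply: sg_M => //; apply: sg_M; first exact: sg_cst.
    by apply: sg_M; exact: sg_V.
  apply/funext => p; rewrite (is_dlineP (h v p)) -exprVn expr2; ring.
Qed.

Lemma smooth_cst (a : R) : smooth (fun _ : V => a).
Proof. by apply: smooth_genP; exact: sg_cst. Qed.

Lemma smoothD f g : smooth f -> smooth g -> smooth (fun x => f x + g x).
Proof. by move=> fS gS; apply: smooth_genP; apply: sg_D; exact: sg_smooth. Qed.

Lemma smoothM f g : smooth f -> smooth g -> smooth (fun x => f x * g x).
Proof. by move=> fS gS; apply: smooth_genP; apply: sg_M; exact: sg_smooth. Qed.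

Lemma smoothV f : smooth f -> (forall x, f x != 0) -> smooth (fun x => (f x)^-1).
Proof. by move=> fS f0; apply: smooth_genP; apply: sg_V => //; exact: sg_smooth. Qed.

Lemma smoothN f : smooth f -> smooth (fun x => - f x).
Proof.
move=> fS; rewrite (_ : (fun x => - f x) = (fun x => -1 * f x)).
  exact: smoothM (smooth_cst _) fS.
by apply/funext => x; rewrite mulN1r.
Qed.

Lemma dline_addv u v f p : smooth f ->
  dline (u + v) f p = dline u f p + dline v f p.
Proof.
move=> fS; apply: dline_dirD; first exact: smooth_line_derivable.
by apply: smooth_continuous; exact: smooth_dline.
Qed.

Lemma dline_scalev a v f p : smooth f -> dline (ofR a *: v) f p = a * dline v f p.
Proof. by move=> fS; apply: dline_dirZ; exact: smooth_line_derivable. Qed.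

Lemma is_dline_shift f x w v a : is_dline f (x + w) v a -> is_dline (fun y => f (y + w)) x v a.
Proof. by rewrite /is_dline; under eq_fun do rewrite addrAC. Qed.

(* The second difference of f on the parallelogram spanned by s u and s v is   *)
(* s^2 times a mixed derivative at a nearby point, in either order.            *)
Lemma second_difference f u v p (s : R) : smooth f -> s != 0 -> exists a b,
  [/\ `|a| <= `|s|, `|b| <= `|s| &
  f (p + ofR s *: u + ofR s *: v) - f (p + ofR s *: u) - (f (p + ofR s *: v) - f p) =
  s ^+ 2 * dline v (dline u f) (p + ofR a *: u + ofR b *: v)].
Proof.
move=> fS s0.
pose g x := f (x + ofR s *: v) + - f x.
have hD w x : is_dline g x w (dline w f (x + ofR s *: v) + - dline w f x).
  apply: is_dlineD; last exact/is_dlineN/smooth_is_dline.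
  by apply: is_dline_shift; exact: smooth_is_dline.
have gD : line_derivable g by move=> w x; have [] := hD w x.
have [a sa e1] := dline_MVT u p s gD.
have [b sb e2] := dline_MVT v (p + ofR a *: u) s
  (smooth_line_derivable (smooth_dline u fS)).
exists a, b; split => //.
by rewrite -/(g (p + ofR s *: u)) -/(g p) e1 (is_dlineP (hD _ _)) e2 expr2 mulrA.
Qed.

Lemma near_parallelogram u v p (U : set V) : nbhs p U ->
  \forall s \near (0 : R)^', forall a b, `|a| <= `|s| -> `|b| <= `|s| ->
    U (p + ofR a *: u + ofR b *: v).
Proof.
move=> /nbhs_ballP[e /= e0 eU].
have e2 : 0 < e / 2 by rewrite divr_gt0.
have := ball_segment u (nbhsx_ballx p _ e2).
have := ball_segment v (nbhsx_ballx (0 : V) _ e2).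
apply: filterS2 => s hv hu a b sa sb; apply: eU.
have := hu _ sa; have := hv _ sb.
rewrite -!ball_normE /ball_ /= !add0r normrN => h1 h2.
by rewrite opprD addrA (le_lt_trans (ler_normB _ _)) // [ltRHS]splitr ltrD.
Qed.

Lemma eq_close (A B : R) : (forall e : R, 0 < e -> exists D, `|A - D| < e /\ `|B - D| < e) ->
  A = B.
Proof.
move=> h; apply/eqP; rewrite -subr_eq0 -normr_le0; apply/ler_addgt0Pr => e e0.
have [|D [h1 h2]] := h (e / 2); first by rewrite divr_gt0.
rewrite add0r (le_trans (ler_distD D _ _)) // [e in _ <= e]splitr ltW //.
by rewrite ltrD // distrC.
Qed.

Lemma dlineC f u v p : smooth f -> dline u (dline v f) p = dline v (dline u f) p.
Proof.
move=> fS; apply: eq_close => e e0.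
have c1 := smooth_continuous (smooth_dline u (smooth_dline v fS)).
have c2 := smooth_continuous (smooth_dline v (smooth_dline u fS)).
have /cvgrPdist_lt/(_ _ e0) n1 := c1 p.
have /cvgrPdist_lt/(_ _ e0) n2 := c2 p.
have [s [s0 [h1 h2]]] := @filter_ex _ (0 : R)^' _ _ (filterI near0_neq0
  (filterI (near_parallelogram v u n1) (near_parallelogram u v n2))).
have [a [b [sa sb eab]]] := second_difference u v p fS s0.
have [a' [b' [sa' sb' eab']]] := second_difference v u p fS s0.
have e12 : dline v (dline u f) (p + ofR a *: u + ofR b *: v) =
    dline u (dline v f) (p + ofR a' *: v + ofR b' *: u).
  have /mulfI inj := expf_neq0 2 s0.
  apply: inj; apply: (etrans (esym eab)); apply: (etrans _ eab').
  rewrite (addrAC p (ofR s *: v)).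
  have aux (A B D E : R) : A - B - (D - E) = A - D - (B - E) by ring.
  exact: aux.
exists (dline v (dline u f) (p + ofR a *: u + ofR b *: v)).
split; last exact: h2.
by rewrite e12; exact: h1.
Qed.

(* Chain rule for curves given in real coordinates e_j, which need not be      *)
(* independent.                                                                *)
Lemma chain_rule (I : finType) (e : I -> V) (c : I -> R -> R) (dc : I -> R) f :
  smooth f -> (forall j, is_derive (0 : R) 1 (c j) (dc j)) ->
  is_derive (0 : R) 1 (fun s : R => f (\sum_j ofR (c j s) *: e j))
    (\sum_j dc j * dline (e j) f (\sum_j ofR (c j 0) *: e j)).
Proof.
move=> fS cD; pose p := \sum_j ofR (c j 0) *: e j.
pose q (s : R) j := s^-1 * (c j s - c j 0) : R.
have qc j : (q^~ j) @ 0^' --> dc j by apply: is_derive_cvg.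
pose w (s : R) := \sum_j ofR (q s j) *: e j.
have /choice[t /all_and2[ts te]] (s : R) : exists t : R, `|t| <= `|s| /\
    f (p + ofR s *: w s) - f p = s * dline (w s) f (p + ofR t *: w s).
  have [t ? ?] := dline_MVT (w s) p s (smooth_line_derivable fS).
  by exists t.
have tc : t s @[s --> 0^'] --> (0 : R).
  apply/cvgrPdist_lt => d d0; exists d => //= s; rewrite /ball_ /= !sub0r !normrN.
  by move=> sd _; exact: le_lt_trans sd.
have wc : w s @[s --> 0^'] --> \sum_j ofR (dc j) *: e j.
  by apply: (cvg_big add_continuous) => j _; apply: cvgZr_tmp; apply: cvg_ofR.
have pc : p + ofR (t s) *: w s @[s --> 0^'] --> p.
  rewrite -[X in _ --> X]addr0 -(scale0r (\sum_j ofR (dc j) *: e j)) -ofR0.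
  by apply: cvgD; [exact: cvg_cst|apply: cvgZ => //; exact: cvg_ofR].
apply: cvg_is_derive; rewrite -/p.
have : (fun s : R => \sum_j q s j * dline (e j) f (p + ofR (t s) *: w s)) @ 0^' -->
    \sum_j dc j * dline (e j) f p.
  apply: (cvg_big add_continuous) => j _; apply: cvgM => //.
  apply: continuous_cvg pc; apply: smooth_continuous; exact: smooth_dline.
apply: cvg_trans; apply: near_eq_cvg; near=> s.
have s0 : s != 0 by near: s; exact: near0_neq0.
have -> : \sum_j ofR (c j s) *: e j = p + ofR s *: w s.
  rewrite /p /w scaler_sumr -big_split; apply: eq_bigr => j _ /=.
  by rewrite scalerA -ofRM mulrA mulfV // mul1r -scalerDl -ofRD subrKC.
rewrite te mulKf //; move: (p + _ *: w s) => x.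
rewrite /w; elim/big_rec2: _ => [|j a b _ ->]; first by rewrite dline_dir0.
by rewrite dline_addv // dline_scalev.
Unshelve. all: by end_near. Qed.

End Normed_space.

Section Composition.
Context {W V : normedModType C} {I : finType} (e : I -> V) (psi : I -> W -> R).
Hypothesis psiS : forall j, smooth (psi j).
Let c x := \sum_j ofR (psi j x) *: e j.

Lemma is_dline_compose f v x : smooth f ->
  is_dline (fun x => f (c x)) x v (\sum_j dline v (psi j) x * dline (e j) f (c x)).
Proof.
move=> fS.
have := @chain_rule _ _ e (fun j t => psi j (x + ofR t *: v))
  (fun j => dline v (psi j) x) f fS (fun j => smooth_is_dline x v (psiS j)).
by under eq_bigr do under eq_bigr do rewrite ofR0 scale0r addr0.
Qed.

Lemma dline_compose f v x : smooth f ->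
  dline v (fun x => f (c x)) x = \sum_j dline v (psi j) x * dline (e j) f (c x).
Proof. by move=> fS; exact/is_dlineP/is_dline_compose. Qed.

Lemma continuous_compose : continuous c.
Proof.
move=> x; apply: (cvg_big add_continuous) => j _; apply: cvgZr_tmp; apply: cvg_ofR.
exact: smooth_continuous.
Qed.

Inductive comp_gen : (W -> R) -> Prop :=
| cg_smooth f : smooth f -> comp_gen f
| cg_comp f : smooth f -> comp_gen (fun x => f (c x))
| cg_D f g : comp_gen f -> comp_gen g -> comp_gen (fun x => f x + g x)
| cg_M f g : comp_gen f -> comp_gen g -> comp_gen (fun x => f x * g x).

Lemma smooth_compose f : smooth f -> smooth (fun x => f (c x)).
Proof.
move=> fS; apply: (smooth_coind _ (cg_comp fS)) => {fS}f; elim=> {f}.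
- move=> f fS; split; [exact: smooth_continuous|exact: smooth_line_derivable|].
  by move=> v; apply: cg_smooth; exact: smooth_dline.
- move=> f fS; split=> [x|v p|v].
  + apply: (@continuous_comp _ _ _ c f); first exact: continuous_compose.
    exact: smooth_continuous.
  + by have [] := is_dline_compose v p fS.
  + rewrite (_ : dline v _ = fun x => \sum_j dline v (psi j) x * dline (e j) f (c x)).
      elim: (index_enum I) => [|j s IH].
        under eq_fun do rewrite big_nil; exact/cg_smooth/smooth_cst.
      under eq_fun do rewrite big_cons; apply: cg_D => //; apply: cg_M.
        exact/cg_smooth/smooth_dline.
      exact/cg_comp/smooth_dline.
    by apply/funext => p; exact: dline_compose.
- move=> f g Sf [fc fD fS] Sg [gc gD gS].
  have h v p := is_dlineD (line_derivableP v p fD) (line_derivableP v p gD).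
  split=> [p|v p|v]; [by apply: cvgD; [exact: fc|exact: gc]|by have [] := h v p|].
  rewrite (_ : dline v _ = fun p => dline v f p + dline v g p); first exact: cg_D.
  by apply/funext => p; exact: is_dlineP.
- move=> f g Sf [fc fD fS] Sg [gc gD gS].
  have h v p := is_dlineM (line_derivableP v p fD) (line_derivableP v p gD).
  split=> [p|v p|v]; [by apply: cvgM; [exact: fc|exact: gc]|by have [] := h v p|].
  rewrite (_ : dline v _ = fun p => f p * dline v g p + g p * dline v f p).
    by apply: cg_D; apply: cg_M.
  by apply/funext => p; exact: is_dlineP.
Qed.

End Composition.
End Smooth_functions.

(** * Wirtinger calculus *)

(* Conversion checks that fail on [smooth] or on derivatives are very slow:    *)
(* csm is a sealed form of [csmooth], and cder, wder, wbar are sealed forms of  *)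
(* [cdline], [wirt], [wirtbar].                                                 *)
Inductive csm (R : realType) (V : normedModType (Cplx R)) (f : V -> Cplx R) : Prop :=
  Csm of smooth (fun x => complex.Re (f x)) & smooth (fun x => complex.Im (f x)).

Fact derivative_key : unit. Proof. exact: tt. Qed.

Section Sealed.
Context {R : realType} {V : normedModType (Cplx R)}.
Definition cder : V -> (V -> Cplx R) -> V -> Cplx R :=
  locked_with derivative_key cdline.
Definition wder : V -> (V -> Cplx R) -> V -> Cplx R :=
  locked_with derivative_key wirt.
Definition wbar : V -> (V -> Cplx R) -> V -> Cplx R :=
  locked_with derivative_key wirtbar.
Lemma cderE v f p : cder v f p = cdline v f p.
Proof. by rewrite /cder unlock. Qed.
Lemma wirtE : wirt = wder. Proof. by rewrite /wder unlock. Qed.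
Lemma wirtbarE : wirtbar = wbar. Proof. by rewrite /wbar unlock. Qed.
Lemma csmP (f : V -> Cplx R) : csmooth f <-> csm f.
Proof. by split=> [[]|[]]. Qed.
End Sealed.

Section Wirtinger.
Context {R : realType}.
Local Notation C := (Cplx R).
Local Notation Re := complex.Re.
Local Notation Im := complex.Im.

Lemma imag_neq0 : 'i != 0 :> C. Proof. by rewrite neq0Ci. Qed.
Lemma mul_imag : 'i * 'i = -1 :> C. Proof. by rewrite -expr2 sqrCi. Qed.
Lemma conj_imag : 'i^* = - 'i :> C. Proof. exact: conjCi. Qed.
Lemma conjV2 : (2^-1)^* = 2^-1 :> C. Proof.
have -> : 2^-1 = ofR 2^-1 :> C by rewrite fmorphV rmorph_nat.
by apply: cplxP; rewrite ?Re_conj // Im_conj /= oppr0.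
Qed.
Lemma Re_imul (x : C) : Re ('i * x) = - Im x.
Proof. by rewrite ReM imagE /= mul0r mul1r sub0r. Qed.
Lemma Im_imul (x : C) : Im ('i * x) = Re x.
Proof. by rewrite ImM imagE /= mul0r mul1r add0r. Qed.

Section Normed_space.
Context {V : normedModType C}.
Implicit Types (f g : V -> C) (u v p : V) (a : C).

Lemma wderE v f p : wder v f p = (cder v f p - 'i * cder ('i *: v) f p) / 2.
Proof. by rewrite -wirtE !cderE. Qed.
Lemma wbarE v f p : wbar v f p = (cder v f p + 'i * cder ('i *: v) f p) / 2.
Proof. by rewrite -wirtbarE !cderE. Qed.

Lemma csm_ext f g : csm f -> f =1 g -> csm g.
Proof. by move=> fS /funext <-. Qed.

Lemma csm_cst a : csm (fun _ : V => a).
Proof. split; exact: smooth_cst. Qed.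

Lemma csm_ofR (f : V -> R) : smooth f -> csm (fun x => ofR (f x)).
Proof. by move=> fS; split; [exact: fS|exact: (smooth_cst 0)]. Qed.

Lemma csm_Re f : csm f -> smooth (fun x => Re (f x)). Proof. by case. Qed.
Lemma csm_Im f : csm f -> smooth (fun x => Im (f x)). Proof. by case. Qed.

Lemma csmD f g : csm f -> csm g -> csm (fun x => f x + g x).
Proof.
move=> [fr fi] [gr gi]; split.
  by under eq_fun do rewrite ReD; exact: (smoothD fr gr).
by under eq_fun do rewrite ImD; exact: (smoothD fi gi).
Qed.

Lemma csmM f g : csm f -> csm g -> csm (fun x => f x * g x).
Proof.
move=> [fr fi] [gr gi]; split.
  under eq_fun do rewrite ReM.
  exact: (smoothD (smoothM fr gr) (smoothN (smoothM fi gi))).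
by under eq_fun do rewrite ImM; exact: (smoothD (smoothM fr gi) (smoothM fi gr)).
Qed.

Lemma csmZ a f : csm f -> csm (fun x => a * f x).
Proof. exact: (csmM (csm_cst a)). Qed.

Lemma csmN f : csm f -> csm (fun x => - f x).
Proof. by move/(csmZ (-1)) => h; apply: (csm_ext h) => x; rewrite mulN1r. Qed.

Lemma csmB f g : csm f -> csm g -> csm (fun x => f x - g x).
Proof. by move=> fS gS; exact: (csmD fS (csmN gS)). Qed.

Lemma csm_conj f : csm f -> csm (fun x => (f x)^*).
Proof.
move=> [fr fi]; split.
  by under eq_fun do rewrite Re_conj; exact: fr.
by under eq_fun do rewrite Im_conj; exact: (smoothN fi).
Qed.

Lemma csmV f : csm f -> (forall x, f x != 0) -> csm (fun x => (f x)^-1).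
Proof.
move=> fS f0.
pose q x : R := Re (f x) * Re (f x) + Im (f x) * Im (f x).
have qE x : f x * (f x)^* = ofR (q x).
  by apply: cplxP; rewrite !(ReM, ImM) !(Re_conj, Im_conj) /= /q; ring.
have q0 x : q x != 0.
  apply: contraTneq (f0 x) => q0; rewrite negbK.
  have : f x * (f x)^* == 0 by rewrite qE q0.
  by rewrite -normCK expf_eq0 normr_eq0.
have qS : smooth q.
  exact: (smoothD (smoothM (csm_Re fS) (csm_Re fS)) (smoothM (csm_Im fS) (csm_Im fS))).
apply: (csm_ext (csmM (csm_conj fS) (csm_ofR (smoothV qS q0)))) => x.
by apply: (mulfI (f0 x)); rewrite mulfV ?f0 // mulrA qE -ofRM mulfV.
Qed.

Lemma csm_sum (I : Type) (r : seq I) (P : pred I) (F : I -> V -> C) :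
  (forall i, P i -> csm (F i)) -> csm (fun x => \sum_(i <- r | P i) F i x).
Proof.
move=> FS; elim: r => [|i r IH].
  by under eq_fun do rewrite big_nil; exact: csm_cst.
under eq_fun do rewrite big_cons.
by case: (boolP (P i)) => Pi; [exact: (csmD (FS _ Pi) IH)|exact: IH].
Qed.

Lemma csm_prod (I : Type) (r : seq I) (P : pred I) (F : I -> V -> C) :
  (forall i, P i -> csm (F i)) -> csm (fun x => \prod_(i <- r | P i) F i x).
Proof.
move=> FS; elim: r => [|i r IH].
  by under eq_fun do rewrite big_nil; exact: csm_cst.
under eq_fun do rewrite big_cons.
by case: (boolP (P i)) => Pi; [exact: (csmM (FS _ Pi) IH)|exact: IH].
Qed.

Lemma csm_continuous f : csm f -> continuous f.
Proof.
move=> [fr fi] x; apply: (@cvg_cplx _ _ (nbhs x)).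
  exact: (smooth_continuous fr).
exact: (smooth_continuous fi).
Qed.

Definition is_cder f p v (d : C) :=
  is_dline (fun x => Re (f x)) p v (Re d) /\ is_dline (fun x => Im (f x)) p v (Im d).

Lemma is_cderP f p v d : is_cder f p v d -> cder v f p = d.
Proof.
move=> [/is_dlineP h1 /is_dlineP h2]; rewrite cderE.
by apply: cplxP; [exact: h1|exact: h2].
Qed.

Lemma csm_is_cder f p v : csm f -> is_cder f p v (cder v f p).
Proof. by move=> [fr fi]; rewrite cderE; split; exact: smooth_is_dline. Qed.

Lemma is_cder_ext f g p v d e : is_cder f p v d -> f =1 g -> d = e -> is_cder g p v e.
Proof. by move=> h /funext <- <-. Qed.

Lemma is_cder_cst a p v : is_cder (fun=> a) p v 0.
Proof. by split; exact: is_derive_cst. Qed.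

Lemma is_cderD f g p v a b :
  is_cder f p v a -> is_cder g p v b -> is_cder (fun x => f x + g x) p v (a + b).
Proof.
move=> [fr fi] [gr gi]; split.
  by under eq_fun do rewrite ReD; rewrite ReD; exact: (is_dlineD fr gr).
by under eq_fun do rewrite ImD; rewrite ImD; exact: (is_dlineD fi gi).
Qed.

Lemma is_cderM f g p v a b :
  is_cder f p v a -> is_cder g p v b ->
  is_cder (fun x => f x * g x) p v (f p * b + a * g p).
Proof.
move=> [fr fi] [gr gi]; split.
  under eq_fun do rewrite ReM.
  have := is_dlineD (is_dlineM fr gr) (is_dlineN (is_dlineM fi gi)).
  by move/is_derive_ext; apply => //; rewrite ReD !ReM; ring.
under eq_fun do rewrite ImM.
have := is_dlineD (is_dlineM fr gi) (is_dlineM fi gr).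
by move/is_derive_ext; apply => //; rewrite ImD !ImM; ring.
Qed.

Lemma is_cder_conj f p v a : is_cder f p v a -> is_cder (fun x => (f x)^*) p v a^*.
Proof.
move=> [fr fi]; split.
  by under eq_fun do rewrite Re_conj; rewrite Re_conj; exact: fr.
by under eq_fun do rewrite Im_conj; rewrite Im_conj; exact: (is_dlineN fi).
Qed.

Lemma csm_cder v f : csm f -> csm (cder v f).
Proof.
move=> [fr fi]; rewrite /cder unlock.
by split; [exact: (smooth_dline v fr)|exact: (smooth_dline v fi)].
Qed.

Lemma csm_wder v f : csm f -> csm (wder v f).
Proof.
move=> fS; apply: csm_ext (fun x => esym (wderE v f x)).
exact: (csmM (csmB (csm_cder v fS) (csmZ 'i (csm_cder ('i *: v) fS))) (csm_cst 2^-1)).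
Qed.

Lemma csm_wbar v f : csm f -> csm (wbar v f).
Proof.
move=> fS; apply: csm_ext (fun x => esym (wbarE v f x)).
exact: (csmM (csmD (csm_cder v fS) (csmZ 'i (csm_cder ('i *: v) fS))) (csm_cst 2^-1)).
Qed.

Lemma cder_cst a v p : cder v (fun=> a) p = 0.
Proof. exact: (is_cderP (is_cder_cst a p v)). Qed.

Lemma cder_ofR (f : V -> R) v p : cder v (fun x => ofR (f x)) p = ofR (dline v f p).
Proof.
by rewrite cderE; apply: cplxP => //; exact: dline_cst.
Qed.

Lemma cderD f g v p : csm f -> csm g ->
  cder v (fun x => f x + g x) p = cder v f p + cder v g p.
Proof. by move=> fS gS; apply/is_cderP/is_cderD; exact: csm_is_cder. Qed.

Lemma cderM f g v p : csm f -> csm g ->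
  cder v (fun x => f x * g x) p = f p * cder v g p + cder v f p * g p.
Proof. by move=> fS gS; apply/is_cderP/is_cderM; exact: csm_is_cder. Qed.

Lemma cder_conj f v p : csm f -> cder v (fun x => (f x)^*) p = (cder v f p)^*.
Proof. by move=> fS; apply/is_cderP/is_cder_conj; exact: csm_is_cder. Qed.

Lemma cderZ a f v p : csm f -> cder v (fun x => a * f x) p = a * cder v f p.
Proof. by move=> fS; rewrite (cderM v p (csm_cst a) fS) cder_cst mul0r addr0. Qed.

Lemma cder_addv u v f p : csm f -> cder (u + v) f p = cder u f p + cder v f p.
Proof.
move=> [fr fi]; rewrite !cderE; apply: cplxP; rewrite ?ReD ?ImD.
  exact: (dline_addv u v p fr).
exact: (dline_addv u v p fi).
Qed.

Lemma cder_scalev (a : R) v f p : csm f -> cder (ofR a *: v) f p = ofR a * cder v f p.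
Proof.
move=> [fr fi]; rewrite !cderE; apply: cplxP; rewrite ?ReM ?ImM /= mul0r.
  by rewrite subr0; exact: (dline_scalev a v p fr).
by rewrite addr0; exact: (dline_scalev a v p fi).
Qed.

Lemma cderC u v f p : csm f -> cder u (cder v f) p = cder v (cder u f) p.
Proof.
move=> [fr fi]; rewrite !cderE /cder unlock; apply: cplxP.
  exact: (dlineC u v p fr).
exact: (dlineC u v p fi).
Qed.

Lemma cder_wder v f p : cder v f p = wder v f p + wbar v f p.
Proof. by rewrite wderE wbarE; field. Qed.

Lemma cder_iwder v f p : cder ('i *: v) f p = 'i * (wder v f p - wbar v f p).
Proof.
rewrite wderE wbarE; apply: (mulfI imag_neq0); rewrite [RHS]mulrA mul_imag.
by field.
Qed.

Lemma wder_cst a v p : wder v (fun=> a) p = 0.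
Proof. by rewrite wderE !cder_cst mulr0 subrr mul0r. Qed.

Lemma wbar_cst a v p : wbar v (fun=> a) p = 0.
Proof. by rewrite wbarE !cder_cst mulr0 addr0 mul0r. Qed.

Lemma wderD f g v p : csm f -> csm g ->
  wder v (fun x => f x + g x) p = wder v f p + wder v g p.
Proof. by move=> fS gS; rewrite !wderE !(cderD _ _ fS gS); field. Qed.

Lemma wbarD f g v p : csm f -> csm g ->
  wbar v (fun x => f x + g x) p = wbar v f p + wbar v g p.
Proof. by move=> fS gS; rewrite !wbarE !(cderD _ _ fS gS); field. Qed.

Lemma wderM f g v p : csm f -> csm g ->
  wder v (fun x => f x * g x) p = f p * wder v g p + wder v f p * g p.
Proof. by move=> fS gS; rewrite !wderE !(cderM _ _ fS gS); field. Qed.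

Lemma wbarM f g v p : csm f -> csm g ->
  wbar v (fun x => f x * g x) p = f p * wbar v g p + wbar v f p * g p.
Proof. by move=> fS gS; rewrite !wbarE !(cderM _ _ fS gS); field. Qed.

Lemma wderZ a f v p : csm f -> wder v (fun x => a * f x) p = a * wder v f p.
Proof. by move=> fS; rewrite (wderM v p (csm_cst a) fS) wder_cst mul0r addr0. Qed.

Lemma wbarZ a f v p : csm f -> wbar v (fun x => a * f x) p = a * wbar v f p.
Proof. by move=> fS; rewrite (wbarM v p (csm_cst a) fS) wbar_cst mul0r addr0. Qed.

Lemma wder_conj f v p : csm f -> wder v (fun x => (f x)^*) p = (wbar v f p)^*.
Proof.
move=> fS; rewrite wderE wbarE !(cder_conj _ _ fS) rmorphM rmorphD rmorphM /=.
by rewrite conj_imag conjV2 mulNr.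
Qed.

Lemma wbar_conj f v p : csm f -> wbar v (fun x => (f x)^*) p = (wder v f p)^*.
Proof.
move=> fS; rewrite wderE wbarE !(cder_conj _ _ fS) rmorphM rmorphB rmorphM /=.
by rewrite conj_imag conjV2 mulNr opprK.
Qed.

Lemma wder_sum (I : Type) (r : seq I) (P : pred I) (F : I -> V -> C) v p :
  (forall i, P i -> csm (F i)) ->
  wder v (fun x => \sum_(i <- r | P i) F i x) p = \sum_(i <- r | P i) wder v (F i) p.
Proof.
move=> FS; elim: r => [|i r IH].
  by rewrite big_nil; under eq_fun do rewrite big_nil; rewrite wder_cst.
rewrite big_cons; under eq_fun do rewrite big_cons.
case: (boolP (P i)) => Pi; last exact: IH.
by rewrite (wderD v p (FS _ Pi) (csm_sum r FS)) IH.
Qed.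

Lemma wbar_sum (I : Type) (r : seq I) (P : pred I) (F : I -> V -> C) v p :
  (forall i, P i -> csm (F i)) ->
  wbar v (fun x => \sum_(i <- r | P i) F i x) p = \sum_(i <- r | P i) wbar v (F i) p.
Proof.
move=> FS; elim: r => [|i r IH].
  by rewrite big_nil; under eq_fun do rewrite big_nil; rewrite wbar_cst.
rewrite big_cons; under eq_fun do rewrite big_cons.
case: (boolP (P i)) => Pi; last exact: IH.
by rewrite (wbarD v p (FS _ Pi) (csm_sum r FS)) IH.
Qed.

Lemma cder_cscalev a v f p : csm f ->
  cder (a *: v) f p = ofR (Re a) * cder v f p + ofR (Im a) * cder ('i *: v) f p.
Proof.
move=> fS; rewrite {1}(cplxE a) scalerDl mulrC -scalerA.
by rewrite (cder_addv _ _ _ fS) !(cder_scalev _ _ _ fS).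
Qed.

Lemma wder_addv u v f p : csm f -> wder (u + v) f p = wder u f p + wder v f p.
Proof. by move=> fS; rewrite !wderE scalerDr !(cder_addv _ _ _ fS); field. Qed.

Lemma wbar_addv u v f p : csm f -> wbar (u + v) f p = wbar u f p + wbar v f p.
Proof. by move=> fS; rewrite !wbarE scalerDr !(cder_addv _ _ _ fS); field. Qed.

Lemma wder_scalev a v f p : csm f -> wder (a *: v) f p = a * wder v f p.
Proof.
move=> fS; rewrite [LHS]wderE scalerA (cder_cscalev a _ _ fS) (cder_cscalev ('i * a) _ _ fS) Re_imul Im_imul ofRN.
rewrite cder_iwder !cder_wder.
rewrite [in RHS](cplxE a).
set A := wder v f p; set B := wbar v f p; set r := ofR _; set i := ofR _.
have -> : r * (A + B) + i * ('i * (A - B)) - 'i * (- i * (A + B) + r * ('i * (A - B)))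
  = (r + 'i * i) * (A + B) + (i * 'i - r * ('i * 'i)) * (A - B) by ring.
by rewrite mul_imag; field.
Qed.

Lemma wbar_scalev a v f p : csm f -> wbar (a *: v) f p = a^* * wbar v f p.
Proof.
move=> fS; have cS := csm_conj fS.
have e w : wbar w f p = (wder w (fun x => (f x)^*) p)^*.
  by rewrite (wder_conj _ _ fS) conjCK.
by rewrite !e (wder_scalev _ _ _ cS) rmorphM.
Qed.

Lemma wder_sumv n (c : 'I_n -> C) (e : 'I_n -> V) f p : csm f ->
  wder (\sum_i c i *: e i) f p = \sum_i c i * wder (e i) f p.
Proof.
move=> fS; elim/big_rec2: _ => [|i a w _ <-].
  by rewrite -(scale0r 0) (wder_scalev _ _ _ fS) mul0r.
by rewrite (wder_addv _ _ _ fS) (wder_scalev _ _ _ fS).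
Qed.

Lemma wbar_sumv n (c : 'I_n -> C) (e : 'I_n -> V) f p : csm f ->
  wbar (\sum_i c i *: e i) f p = \sum_i (c i)^* * wbar (e i) f p.
Proof.
move=> fS; elim/big_rec2: _ => [|i a w _ <-].
  by rewrite -(scale0r 0) (wbar_scalev _ _ _ fS) conjC0 mul0r.
by rewrite (wbar_addv _ _ _ fS) (wbar_scalev _ _ _ fS).
Qed.

Lemma cder_wbarC u v f p : csm f -> cder u (wbar v f) p = wbar v (cder u f) p.
Proof.
move=> fS; have h w := csm_cder w fS.
rewrite [RHS]wbarE (_ : wbar v f = (fun x => 2^-1 * (cder v f x + 'i * cder ('i *: v) f x))).
  rewrite (cderZ _ _ _ (csmD (h v) (csmZ 'i (h ('i *: v))))).
  rewrite (cderD _ _ (h v) (csmZ 'i (h ('i *: v)))) (cderZ _ _ _ (h ('i *: v))).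
  by rewrite (cderC u v _ fS) (cderC u ('i *: v) _ fS) mulrC.
by apply/funext => x; rewrite wbarE mulrC.
Qed.

Lemma wder_wbarC u v f p : csm f -> wder u (wbar v f) p = wbar v (wder u f) p.
Proof.
move=> fS; have h w := csm_cder w fS.
rewrite [LHS]wderE !(cder_wbarC _ _ _ fS).
rewrite (_ : wder u f = (fun x => 2^-1 * (cder u f x + -'i * cder ('i *: u) f x))).
  rewrite (wbarZ _ _ _ (csmD (h u) (csmZ (-'i) (h ('i *: u))))).
  rewrite (wbarD _ _ (h u) (csmZ (-'i) (h ('i *: u)))) (wbarZ _ _ _ (h ('i *: u))).
  by rewrite mulrC mulNr.
by apply/funext => x; rewrite wderE mulrC mulNr.
Qed.

Lemma levi_real (f : V -> R) v p : smooth f ->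
  wder v (wbar v (fun x => ofR (f x))) p =
  ofR ((dline v (dline v f) p + dline ('i *: v) (dline ('i *: v) f) p) / 4).
Proof.
move=> fS; have F := csm_ofR fS.
rewrite wderE !(cder_wbarC _ _ _ F) !wbarE.
have e w w' : cder w (cder w' (fun x => ofR (f x))) p = ofR (dline w (dline w' f) p).
  rewrite -cder_ofR; congr (cder w _ p); apply/funext => x; exact: cder_ofR.
have e4 : ofR 4^-1 = 4^-1 :> C by rewrite fmorphV rmorph_nat.
rewrite !e (dlineC ('i *: v) v p fS) ofRM ofRD e4.
have alg (A B D : C) :
    ((A + 'i * B) / 2 - 'i * ((B + 'i * D) / 2)) / 2 = (A + D) / 4.
  have -> : (A + 'i * B) / 2 - 'i * ((B + 'i * D) / 2) = (A - 'i * 'i * D) / 2 by field.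
  by rewrite mul_imag; field.
exact: alg.
Qed.

End Normed_space.

Section Composition.
Context {W V : normedModType C} {I : finType} (e : I -> V) (psi : I -> W -> R).
Hypothesis psiS : forall j, smooth (psi j).
Let c x := \sum_j ofR (psi j x) *: e j.

Lemma csm_compose (f : V -> C) : csm f -> csm (fun x => f (c x)).
Proof.
move=> [fr fi]; split; [exact: (smooth_compose e psiS fr)|exact: (smooth_compose e psiS fi)].
Qed.

Lemma cder_compose (f : V -> C) v x : csm f ->
  cder v (fun x => f (c x)) x = \sum_j ofR (dline v (psi j) x) * cder (e j) f (c x).
Proof.
move=> [fr fi]; apply: is_cderP.
have eR : Re (\sum_j ofR (dline v (psi j) x) * cder (e j) f (c x)) =
    \sum_j dline v (psi j) x * dline (e j) (fun x => Re (f x)) (c x).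
  elim/big_rec2: _ => // j a b _ <-; rewrite ReD ReM cderE /=; ring.
have eI : Im (\sum_j ofR (dline v (psi j) x) * cder (e j) f (c x)) =
    \sum_j dline v (psi j) x * dline (e j) (fun x => Im (f x)) (c x).
  elim/big_rec2: _ => // j a b _ <-; rewrite ImD ImM cderE /=; ring.
split; rewrite ?eR ?eI.
  exact: (is_dline_compose e psiS v x fr).
exact: (is_dline_compose e psiS v x fi).
Qed.

End Composition.
End Wirtinger.

(** * The Bochner formula for conorms of constant covectors *)

Section Matrix_functions.
Context {R : realType}.
Local Notation C := (Cplx R).
Local Notation Re := complex.Re.
Local Notation Im := complex.Im.

Section Adjoint.
Context {m n p : nat}.
Lemma adjmxM (A : 'M[C]_(m, n)) (B : 'M[C]_(n, p)) : adjmx (A *m B) = adjmx B *m adjmx A.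
Proof. by rewrite /adjmx map_mxM trmx_mul. Qed.
Lemma adjmxK (A : 'M[C]_(m, n)) : adjmx (adjmx A) = A.
Proof. by apply/matrixP => i j; rewrite !mxE conjCK. Qed.
Lemma adjmxN (A : 'M[C]_(m, n)) : adjmx (- A) = - adjmx A.
Proof. by apply/matrixP => i j; rewrite !mxE rmorphN. Qed.
Lemma adjmxE (A : 'M[C]_(m, n)) i j : adjmx A i j = (A j i)^*.
Proof. by rewrite !mxE. Qed.
End Adjoint.

Lemma adjmx1 n : adjmx (1%:M : 'M[C]_n) = 1%:M.
Proof. by rewrite /adjmx map_mx1 trmx1. Qed.

Section Normed_space.
Context {V : normedModType C}.

Definition mcsm m n (A : V -> 'M[C]_(m, n)) := forall i j, csm (fun p => A p i j).
Definition mwder m n v (A : V -> 'M[C]_(m, n)) p : 'M[C]_(m, n) :=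
  \matrix_(i, j) wder v (fun q => A q i j) p.
Definition mwbar m n v (A : V -> 'M[C]_(m, n)) p : 'M[C]_(m, n) :=
  \matrix_(i, j) wbar v (fun q => A q i j) p.

Lemma mcsm_cst m n (A : 'M[C]_(m, n)) : mcsm (fun _ : V => A).
Proof. by move=> i j; exact: csm_cst. Qed.

Lemma mcsmM m n k (A : V -> 'M[C]_(m, n)) (B : V -> 'M[C]_(n, k)) :
  mcsm A -> mcsm B -> mcsm (fun p => A p *m B p).
Proof.
move=> AS BS i j; under eq_fun do rewrite mxE.
by apply: csm_sum => l _; exact: (csmM (AS i l) (BS l j)).
Qed.

Lemma mcsm_mwbar m n v (A : V -> 'M[C]_(m, n)) : mcsm A -> mcsm (mwbar v A).
Proof. by move=> AS i j; under eq_fun do rewrite mxE; exact: (csm_wbar v (AS i j)). Qed.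

Lemma mwder_cst m n v (A : 'M[C]_(m, n)) p : mwder v (fun=> A) p = 0.
Proof. by apply/matrixP => i j; rewrite !mxE wder_cst. Qed.

Lemma mwbar_cst m n v (A : 'M[C]_(m, n)) p : mwbar v (fun=> A) p = 0.
Proof. by apply/matrixP => i j; rewrite !mxE wbar_cst. Qed.

Lemma mwderM m n k v (A : V -> 'M[C]_(m, n)) (B : V -> 'M[C]_(n, k)) p :
  mcsm A -> mcsm B ->
  mwder v (fun q => A q *m B q) p = A p *m mwder v B p + mwder v A p *m B p.
Proof.
move=> AS BS; apply/matrixP => i j; rewrite !mxE.
under [X in wder v X p]eq_fun do rewrite mxE.
rewrite (wder_sum _ v p (fun l _ => csmM (AS i l) (BS l j))) -big_split /=.
apply: eq_bigr => l _; rewrite !mxE; exact: (wderM v p (AS i l) (BS l j)).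
Qed.

Lemma mwbarM m n k v (A : V -> 'M[C]_(m, n)) (B : V -> 'M[C]_(n, k)) p :
  mcsm A -> mcsm B ->
  mwbar v (fun q => A q *m B q) p = A p *m mwbar v B p + mwbar v A p *m B p.
Proof.
move=> AS BS; apply/matrixP => i j; rewrite !mxE.
under [X in wbar v X p]eq_fun do rewrite mxE.
rewrite (wbar_sum _ v p (fun l _ => csmM (AS i l) (BS l j))) -big_split /=.
apply: eq_bigr => l _; rewrite !mxE; exact: (wbarM v p (AS i l) (BS l j)).
Qed.

Lemma mwderN m n v (A : V -> 'M[C]_(m, n)) p : mcsm A ->
  mwder v (fun q => - A q) p = - mwder v A p.
Proof.
move=> AS; apply/matrixP => i j; rewrite !mxE -mulN1r -(wderZ _ v p (AS i j)).
by congr (wder v _ p); apply/funext => q; rewrite mxE mulN1r.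
Qed.

Lemma adjmx_mwbar m n v (A : V -> 'M[C]_(m, n)) p : mcsm A ->
  adjmx (mwbar v A p) = mwder v (fun q => adjmx (A q)) p.
Proof.
move=> AS; apply/matrixP => i j; rewrite adjmxE !mxE -(wder_conj v p (AS j i)).
by congr (wder v _ p); apply/funext => q; rewrite adjmxE.
Qed.

Lemma csm_det n (A : V -> 'M[C]_n) : mcsm A -> csm (fun p => \det (A p)).
Proof.
move=> AS; rewrite /determinant; apply: csm_sum => s _; apply: csmZ.
by apply: csm_prod => i _; exact: AS.
Qed.

Lemma mcsm_invmx n (A : V -> 'M[C]_n) : mcsm A -> (forall p, A p \in unitmx) ->
  mcsm (fun p => invmx (A p)).
Proof.
move=> AS AU i j.
rewrite (_ : (fun p => _) = (fun p => (\det (A p))^-1 * cofactor (A p) j i)).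
  apply: csmM.
    apply: csmV; first exact: csm_det.
    by move=> p; rewrite -unitfE -unitmxE.
  rewrite /cofactor; apply: csmZ; apply: csm_det => k l.
  by under eq_fun do rewrite !mxE; exact: AS.
by apply/funext => p; rewrite /invmx AU !mxE.
Qed.

Lemma mwder_inv n v (A : V -> 'M[C]_n) p : mcsm A -> (forall p, A p \in unitmx) ->
  mwder v (fun q => invmx (A q)) p = - (invmx (A p) *m mwder v A p *m invmx (A p)).
Proof.
move=> AS AU; have hS := mcsm_invmx AS AU.
have e : (fun q => A q *m invmx (A q)) = (fun=> 1%:M).
  by apply/funext => q; rewrite mulmxV.
have := mwderM v p AS hS; rewrite e mwder_cst => /esym/eqP; rewrite addr_eq0 => /eqP e1.
by rewrite -mulmxA -mulmxN -[LHS]mul1mx -(mulVmx (AU p)) -mulmxA e1.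
Qed.

Lemma mwbar_inv n v (A : V -> 'M[C]_n) p : mcsm A -> (forall p, A p \in unitmx) ->
  mwbar v (fun q => invmx (A q)) p = - (invmx (A p) *m mwbar v A p *m invmx (A p)).
Proof.
move=> AS AU; have hS := mcsm_invmx AS AU.
have e : (fun q => A q *m invmx (A q)) = (fun=> 1%:M).
  by apply/funext => q; rewrite mulmxV.
have := mwbarM v p AS hS; rewrite e mwbar_cst => /esym/eqP; rewrite addr_eq0 => /eqP e1.
by rewrite -mulmxA -mulmxN -[LHS]mul1mx -(mulVmx (AU p)) -mulmxA e1.
Qed.

End Normed_space.
End Matrix_functions.

Lemma bochner_algebra (K : comNzRingType) n (h G D A B : 'M[K]_n) : h *m G = 1%:M ->
  - (h *m B *m (- (h *m A *m h)) + (h *m D + - (h *m A *m h) *m B) *m h) =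
  h *m (- D + A *m h *m B) *m h + - (h *m B *m h) *m G *m (- (h *m A *m h)).
Proof.
move=> hG; rewrite !mulNmx !mulmxN !opprK !mulmxDr !mulmxDl !mulmxN !mulNmx !mulmxA.
rewrite -(mulmxA (h *m B) h G) hG mulmx1 !opprD !opprK.
by rewrite addrC.
Qed.

Section Bochner.
Context {R : realType} {n : nat}.
Local Notation C := (Cplx R).
Local Notation pt := 'rV[C]_n.
Context (g : pt -> 'M[C]_n) (gK : kaehler_metric g).
Local Notation h := (fun p => invmx (g p)).

Lemma metric_csm : mcsm g.
Proof. by move=> i j; apply/csmP; exact: (kaehler_smooth gK). Qed.

Lemma metric_unit p : g p \in unitmx.
Proof.
rewrite -row_free_unit -kermx_eq0; apply/eqP/row_matrixP => i; rewrite row0.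
apply/eqP/negPn/negP => v0; have := kaehler_posdef gK p v0.
by rewrite -row_mul mulmx_ker row0 mul0mx mxE ltxx.
Qed.

Lemma inv_metric_csm : mcsm h.
Proof. exact: (mcsm_invmx metric_csm metric_unit). Qed.

Lemma inv_metric_herm p : adjmx (h p) = h p.
Proof.
have := congr1 (@adjmx R n n) (mulmxV (metric_unit p)); rewrite adjmxM adjmx1.
rewrite (kaehler_hermitian gK) => /(congr1 (mulmx^~ (h p))).
by rewrite -mulmxA (mulmxV (metric_unit p)) mulmx1 mul1mx.
Qed.

Lemma inv_metric_posdef p (v : pt) : v != 0 -> 0 < (v *m h p *m adjmx v) 0 0.
Proof.
move=> v0; have w0 : v *m h p != 0.
  apply: contra v0 => /eqP/(congr1 (mulmx^~ (g p))).
  by rewrite -mulmxA (mulVmx (metric_unit p)) mulmx1 mul0mx => ->.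
have := kaehler_posdef gK p w0; rewrite adjmxM inv_metric_herm.
by rewrite mulmxA -(mulmxA v) (mulVmx (metric_unit p)) mulmx1.
Qed.

Definition curv v p : 'M[C]_n :=
  - mwder v (mwbar v g) p + mwder v g p *m h p *m mwbar v g p.

Lemma rV_sum_delta (v : pt) : v = \sum_k v 0 k *: delta_mx 0 k.
Proof. exact: row_sum_delta. Qed.

Lemma bisectionalE p (u v : pt) : bisectional g p u v = (u *m curv v p *m adjmx u) 0 0.
Proof.
have gS := metric_csm.
have curvE i j : curv v p i j = \sum_k \sum_l curvature g i j k l p * v 0 k * (v 0 l)^*.
  have wb q a b : wbar v (fun x => g x a b) q = \sum_l (v 0 l)^* * wbar (delta_mx 0 l) (fun x => g x a b) q.
    by rewrite {1}(rV_sum_delta v) (wbar_sumv _ _ _ (gS a b)).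
  have wd q a b : wder v (fun x => g x a b) q = \sum_k v 0 k * wder (delta_mx 0 k) (fun x => g x a b) q.
    by rewrite {1}(rV_sum_delta v) (wder_sumv _ _ _ (gS a b)).
  have second : wder v (fun q => mwbar v g q i j) p =
      \sum_k \sum_l wder (delta_mx 0 k) (wbar (delta_mx 0 l) (fun x => g x i j)) p * v 0 k * (v 0 l)^*.
    have S : csm (wbar v (fun x => g x i j)) := csm_wbar v (gS i j).
    rewrite (_ : (fun q => mwbar v g q i j) = wbar v (fun x => g x i j)); last first.
      by apply/funext => q; rewrite mxE.
    rewrite {1}(rV_sum_delta v) (wder_sumv _ _ _ S); apply: eq_bigr => k _.
    rewrite (_ : wbar v (fun x => g x i j) =
      (fun q => \sum_l (v 0 l)^* * wbar (delta_mx 0 l) (fun x => g x i j) q)); last first.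
      by apply/funext => q; exact: wb.
    rewrite (wder_sum _ _ _ (fun l _ => csmZ _ (csm_wbar _ (gS i j)))) mulr_sumr.
    apply: eq_bigr => l _; rewrite (wderZ _ _ _ (csm_wbar _ (gS i j))); ring.
  rewrite /curv 2!mxE mxE second.
  rewrite (_ : (mwder v g p *m h p *m mwbar v g p) i j = \sum_k \sum_l
     (\sum_q \sum_s h p q s * wder (delta_mx 0 k) (fun x => g x i q) p *
        wbar (delta_mx 0 l) (fun x => g x s j) p) * v 0 k * (v 0 l)^*).
    rewrite -sumrN -big_split; apply: eq_bigr => k _ /=.
    rewrite -sumrN -big_split; apply: eq_bigr => l _ /=.
    by rewrite /curvature wirtE wirtbarE; ring.
  transitivity (\sum_q \sum_s \sum_k \sum_l h p q s * wder (delta_mx 0 k) (fun x => g x i q) p *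
        wbar (delta_mx 0 l) (fun x => g x s j) p * v 0 k * (v 0 l)^*).
    rewrite mxE (eq_bigr (fun s => \sum_q wder v (fun x => g x i q) p * h p q s *
      wbar v (fun x => g x s j) p)); last first.
      by move=> s _; rewrite !mxE mulr_suml; apply: eq_bigr => q _; rewrite mxE.
    rewrite exchange_big; apply: eq_bigr => q _; apply: eq_bigr => s _.
    rewrite wd wb 2!mulr_suml; apply: eq_bigr => k _.
    by rewrite mulr_sumr; apply: eq_bigr => l _; ring.
  transitivity (\sum_k \sum_l \sum_q \sum_s h p q s * wder (delta_mx 0 k) (fun x => g x i q) p *
        wbar (delta_mx 0 l) (fun x => g x s j) p * v 0 k * (v 0 l)^*).
    under eq_bigr do rewrite exchange_big.
    rewrite exchange_big; apply: eq_bigr => k _.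
    under eq_bigr do rewrite exchange_big.
    by rewrite exchange_big.
  apply: eq_bigr => k _; apply: eq_bigr => l _; rewrite -mulrA mulr_suml.
  by apply: eq_bigr => q _; rewrite mulr_suml; apply: eq_bigr => s _; ring.
rewrite mxE /bisectional.
under [RHS]eq_bigr do rewrite mxE mulr_suml.
rewrite exchange_big; apply: eq_bigr => i _; apply: eq_bigr => j _.
rewrite curvE adjmxE mulr_sumr mulr_suml; apply: eq_bigr => k _.
by rewrite mulr_sumr mulr_suml; apply: eq_bigr => l _; ring.
Qed.

Definition conorm (x : pt) (p : pt) : C := (x *m h p *m adjmx x) 0 0.

Lemma csm_conorm x : csm (conorm x).
Proof.
exact: (mcsmM (mcsmM (mcsm_cst x) inv_metric_csm) (mcsm_cst (adjmx x)) 0 0).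
Qed.

Lemma conorm_real x p : conorm x p = ofR (complex.Re (conorm x p)).
Proof.
have e : (conorm x p)^* = conorm x p.
  by rewrite /conorm -adjmxE !adjmxM adjmxK inv_metric_herm mulmxA.
apply: cplxP => //=; have := congr1 (@complex.Im R) e; rewrite Im_conj => /eqP.
by rewrite eq_sym -subr_eq0 opprK -mulr2n mulrn_eq0 /= => /eqP.
Qed.

(* Both terms are nonnegative, so the conorm of a constant covector is          *)
(* plurisubharmonic, and where its Levi form vanishes so does z.               *)
Lemma bochner x v p : let z := x *m mwbar v h p in
  wder v (wbar v (conorm x)) p =
  bisectional g p (x *m h p) v + (z *m g p *m adjmx z) 0 0.
Proof.
move=> z; have [gS hS] := (metric_csm, inv_metric_csm).
have gU := metric_unit.
have c1 : wder v (wbar v (conorm x)) p = (x *m mwder v (mwbar v h) p *m adjmx x) 0 0.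
  have cx : mcsm (fun _ : pt => x) := mcsm_cst x.
  have cy : mcsm (fun _ : pt => adjmx x) := mcsm_cst (adjmx x).
  have b q : wbar v (conorm x) q = (x *m mwbar v h q *m adjmx x) 0 0.
    have := mwbarM v q (mcsmM cx hS) cy.
    rewrite mwbar_cst mulmx0 add0r (mwbarM v q cx hS) mwbar_cst mul0mx addr0.
    by move/matrixP/(_ 0 0); rewrite mxE.
  have := mwderM v p (mcsmM cx (mcsm_mwbar v hS)) cy.
  rewrite mwder_cst mulmx0 add0r (mwderM v p cx (mcsm_mwbar v hS)) mwder_cst mul0mx addr0.
  move/matrixP/(_ 0 0); rewrite mxE => <-.
  by congr (wder v _ p); apply/funext => q; rewrite b.
have hb : mwbar v h = (fun q => - (h q *m mwbar v g q *m h q)).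
  by apply/funext => q; exact: (mwbar_inv v q gS gU).
have c2 : mwder v (mwbar v h) p = h p *m curv v p *m h p +
    (mwbar v h p) *m g p *m (adjmx (mwbar v h p)).
  have gbS := mcsm_mwbar v gS.
  have gb : adjmx (mwbar v g p) = mwder v g p.
    rewrite (adjmx_mwbar v p gS); congr (mwder v _ p); apply/funext => q.
    exact: (kaehler_hermitian gK).
  rewrite hb (mwderN v p (mcsmM (mcsmM hS gbS) hS)) (mwderM v p (mcsmM hS gbS) hS).
  rewrite (mwderM v p hS gbS) (mwder_inv v p gS gU) /curv.
  rewrite adjmxN !adjmxM gb inv_metric_herm mulmxA.
  exact: (bochner_algebra _ _ _ (mulVmx (gU p))).
rewrite c1 bisectionalE adjmxM inv_metric_herm /z adjmxM c2.
by rewrite mulmxDr mulmxDl mxE !mulmxA.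
Qed.

Hypothesis BI : BI_ge0 g.

Lemma conorm_levi_ge0 x v p : 0 <= wder v (wbar v (conorm x)) p.
Proof.
rewrite bochner addr_ge0 //.
have [->|z0] := eqVneq (x *m mwbar v h p) 0; first by rewrite mul0mx mul0mx mxE.
exact/ltW/(kaehler_posdef gK p z0).
Qed.

Lemma conorm_levi_eq0 x v p : wder v (wbar v (conorm x)) p = 0 -> x *m mwbar v h p = 0.
Proof.
rewrite bochner => e; apply/eqP/negPn/negP => z0.
have := ltr_wpDl (BI p (x *m h p) v) (kaehler_posdef gK p z0).
by rewrite e ltxx.
Qed.

End Bochner.

(** * A Liouville theorem for subharmonic functions on the plane *)

Section Liouville.
Context {R : realType}.
Local Notation C := (Cplx R).
Local Notation Re := complex.Re.
Local Notation Im := complex.Im.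

Lemma is_dline_cst (V : normedModType C) (a : R) (p v : V) : is_dline (fun=> a) p v 0.
Proof. exact: is_derive_cst. Qed.

Lemma is_dline_linear (V : normedModType C) (L : V -> R) v p :
  (forall x (t : R) w, L (x + ofR t *: w) = L x + t * L w) -> is_dline L p v (L v).
Proof.
move=> Ll; rewrite /is_dline; under eq_fun do rewrite Ll.
have := is_deriveD (is_derive_cst (L p) (0 : R) 1)
  (is_deriveM (is_derive_id (0 : R) 1) (is_derive_cst (L v) (0 : R) 1)).
by move/is_derive_ext; apply => //=; rewrite add0r scaler0 add0r /GRing.scale /= mulr1.
Qed.

Lemma smooth_linear (V : normedModType C) (L : V -> R) : continuous L ->
  (forall x (t : R) w, L (x + ofR t *: w) = L x + t * L w) -> smooth L.
Proof.
move=> Lc Ll; have h v p := @is_dline_linear V L v p Ll.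
apply: (@smooth_coind _ _ (fun f => f = L \/ exists a, f = fun=> a)); last by left.
move=> _ [->|[a ->]].
  split=> // [v p|v]; first by have [] := h v p.
  by right; exists (L v); apply/funext => p; exact: is_dlineP.
split; [exact: cst_continuous|exact: line_derivable_cst|move=> v].
by right; exists 0; apply/funext => p; exact: dline_cst.
Qed.

Lemma Re_affine (x w : C) (t : R) : Re (x + ofR t *: w) = Re x + t * Re w.
Proof. by rewrite ReD [_ *: w](_ : _ = ofR t * w) // ReM /= mul0r subr0. Qed.

Lemma Im_affine (x w : C) (t : R) : Im (x + ofR t *: w) = Im x + t * Im w.
Proof. by rewrite ImD [_ *: w](_ : _ = ofR t * w) // ImM /= mul0r addr0. Qed.

Lemma smooth_Re : smooth (fun x : C => Re x).
Proof. by apply: (smooth_linear continuous_Re) => x t w; exact: Re_affine. Qed.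

Lemma smooth_Im : smooth (fun x : C => Im x).
Proof. by apply: (smooth_linear continuous_Im) => x t w; exact: Im_affine. Qed.

Lemma is_dline_Re (p v : C) : is_dline (fun x : C => Re x) p v (Re v).
Proof. by apply: (is_dline_linear (L := fun x : C => Re x)) => x t w; exact: Re_affine. Qed.

Lemma is_dline_Im (p v : C) : is_dline (fun x : C => Im x) p v (Im v).
Proof. by apply: (is_dline_linear (L := fun x : C => Im x)) => x t w; exact: Im_affine. Qed.

Lemma max_second_derivative (V : normedModType C) (G : V -> R) (c v : V) (d : R) :
  line_derivable G -> line_derivable (dline v G) -> 0 < d ->
  (forall t : R, `|t| < d -> G (c + ofR t *: v) <= G c) ->
  dline v (dline v G) c <= 0.
Proof.
move=> GD GDD d0 Gmax; rewrite leNgt; apply/negP => pos.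
have dG t := is_derive_line v c t GD.
have z0 : dline v G c = 0.
  have := dG 0; rewrite ofR0 scale0r addr0 => h.
  suff h0 : is_derive (0 : R) 1 (fun s : R => G (c + ofR s *: v)) 0.
    by case: h => _ <-; case: h0.
  apply: (@derive1_at_max _ _ (- d) d).
  - by rewrite lerNl (le_trans _ (ltW d0)) // oppr_le0 ltW.
  - by move=> t _; have [] := dG t.
  - by rewrite in_itv /= d0 oppr_lt0 d0.
  - move=> t; rewrite in_itv /= => td; rewrite ofR0 scale0r addr0; apply: Gmax.
    by rewrite ltr_norml.
have := is_derive_cvg (line_derivableP v c GDD).
rewrite ofR0 scale0r addr0 z0 => /cvgrPdist_lt/(_ _ pos)[e /= e0 eP].
pose t := Num.min d e / 2.
have t0 : 0 < t by rewrite divr_gt0 // lt_min d0.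
have [td te] : t < d /\ t < e.
  have h : t < Num.min d e by rewrite /t ltr_pdivrMr // ltr_pMr ?ltr1n // lt_min d0.
  by move: h; rewrite lt_min => /andP.
have [s] := @MVT _ _ _ 0 t t0 (fun x _ => dG x) (derivable_within_continuous (fun x _ => @ex_derive _ _ _ _ _ _ _ (dG x))).
rewrite in_itv /= => /andP[s0 st]; rewrite ofR0 scale0r addr0 subr0.
have := eP s; rewrite /ball_ /= sub0r normrN (gtr0_norm s0) => /(_ (lt_trans st te)).
rewrite gt_eqF // => /(_ isT); rewrite subr0 => ds.
have {}ds : 0 < dline v G (c + ofR s *: v).
  rewrite -(pmulr_rgt0 _ (_ : 0 < s^-1)) ?invr_gt0 //.
  by move: ds; rewrite ltr_distlC subrr => /andP[].
move=> e1; have := Gmax t; rewrite gtr0_norm // => /(_ td).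
by rewrite -subr_le0 e1 leNgt mulr_gt0.
Qed.

Lemma compact_box (k : R) : compact [set x : C | `|Re x| <= k /\ `|Im x| <= k].
Proof.
have -> : [set x : C | `|Re x| <= k /\ `|Im x| <= k] =
    (fun ab : R * R => (ab.1 +i* ab.2)%C : C) @` (`[- k, k] `*` `[- k, k]).
  apply/seteqP; split=> [x [xr xi]|_ [[a b] [/= ak bk] <-]] /=.
    by exists (Re x, Im x); [rewrite /= !in_itv /= -!ler_norml|case: x {xr xi}].
  by move: ak bk; rewrite !in_itv /= -!ler_norml.
apply: continuous_compact; last by apply: compact_setX; exact: segment_compact.
apply: continuous_subspaceT => x; apply: (@cvg_cplx _ _ (nbhs x)) => /=.
  exact: cvg_fst.
exact: cvg_snd.
Qed.

Section Comparison.
Variable p : C.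
Let q (x : C) : R := (Re x - Re p) * (Re x - Re p) + (Im x - Im p) * (Im x - Im p).

Lemma sq_dist_ge0 x : 0 <= q x. Proof. by rewrite addr_ge0 // -expr2 sqr_ge0. Qed.

Lemma is_dline_sq_dist x v :
  is_dline q x v (2 * ((Re x - Re p) * Re v + (Im x - Im p) * Im v)).
Proof.
have r := is_dlineD (is_dline_Re x v) (is_dline_cst (- Re p) _ _).
have i := is_dlineD (is_dline_Im x v) (is_dline_cst (- Im p) _ _).
have := is_dlineD (is_dlineM r r) (is_dlineM i i).
by move/is_derive_ext; apply => //; ring.
Qed.

Lemma smooth_sq_dist : smooth q.
Proof.
have r := smoothD smooth_Re (smooth_cst (- Re p)).
have i := smoothD smooth_Im (smooth_cst (- Im p)).
exact: (smoothD (smoothM r r) (smoothM i i)).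
Qed.

Lemma compact_annulus (s S : R) : compact [set x | s <= q x <= S].
Proof.
have qc := smooth_continuous smooth_sq_dist.
pose A : set C := [set x | s <= q x <= S].
have cl : closed A.
  rewrite (_ : A = q @^-1` [set y | s <= y] `&` q @^-1` [set y | y <= S]).
    apply: closedI; apply: preimage_closed => [x _|].
    - exact: qc.
    - exact: closed_ge.
    - exact: qc.
    - exact: closed_le.
  by apply/seteqP; split=> [x /= /andP|x /= /andP].
pose k : R := `|Re p| + `|Im p| + `|S| + 1.
refine (subclosed_compact cl (@compact_box k) _) => x /= /andP[_ qS].
have aux (a b c : R) : a * a <= `|S| -> `|b| <= c -> `|a + b| <= c + `|S| + 1.
  move=> aS bc; rewrite (le_trans (ler_normD _ _)) //.
  rewrite -addrA [leRHS]addrC lerD //.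
  have [a1|a1] := lerP `|a| 1; first by rewrite (le_trans a1) // lerDr.
  rewrite (le_trans _ (_ : `|S| <= _)) ?lerDl // (le_trans _ aS) //.
  by rewrite -expr2 -real_normK ?num_real // expr2 ler_peMl // ltW.
have qS' := le_trans qS (ler_norm S).
split; rewrite /k.
  rewrite -(subrK (Re p) (Re x)); apply: aux; last by rewrite lerDl.
  by apply: le_trans qS'; rewrite /q lerDl -expr2 sqr_ge0.
rewrite -(subrK (Im p) (Im x)); apply: aux; last by rewrite lerDr.
by apply: le_trans qS'; rewrite /q lerDr -expr2 sqr_ge0.
Qed.

(* The comparison function eta(q), with eta(q) = ln (q + a) - 2a / (q + a),    *)
(* is smooth, tends to infinity and is strictly superharmonic where q > 3a:    *)
(* its laplacian is 4 (q eta')' = 4 a (3a - q) / (q + a)^3.                    *)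
Variable a : R.
Hypothesis a0 : 0 < a.
Let eta (x : C) : R := ln (q x + a) - 2 * a * (q x + a)^-1.
Let eta' (x : C) : R := (q x + 3 * a) * ((q x + a)^-1 * (q x + a)^-1).

Lemma sq_dist_pos x : 0 < q x + a. Proof. by rewrite ltr_wpDl // sq_dist_ge0. Qed.
Let qa0 x : q x + a != 0. Proof. by rewrite gt_eqF // sq_dist_pos. Qed.

Let is_dline_qa x v : is_dline (fun x => q x + a) x v (dline v q x).
Proof.
have := is_dlineD (smooth_is_dline x v smooth_sq_dist) (is_dline_cst a _ _).
by move/is_derive_ext; apply => //; rewrite addr0.
Qed.

Lemma is_dline_eta x v : is_dline eta x v (eta' x * dline v q x).
Proof.
have qD := is_dline_qa x v.
have l := is_dline_comp qD (is_derive1_ln (sq_dist_pos x)).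
have i := is_dlineM (is_dline_cst (- (2 * a)) _ _) (is_dlineV (qa0 x) qD).
have := is_dlineD l i.
move/is_derive_ext; apply => [t|]; first by rewrite /= /eta mulNr.
by rewrite /eta' /=; have := qa0 x => ?; field.
Qed.

Lemma laplacian_eta x : laplacian eta x = 4 * a * (3 * a - q x) / (q x + a) ^+ 3.
Proof.
have e v : dline v eta = (fun x => eta' x * dline v q x).
  by apply/funext => y; exact: (is_dlineP (is_dline_eta y v)).
have q1 v : dline v q = fun x => 2 * ((Re x - Re p) * Re v + (Im x - Im p) * Im v).
  by apply/funext => y; exact: (is_dlineP (is_dline_sq_dist y v)).
have e2 v : dline v (dline v eta) x =
    (q x + 3 * a) * ((q x + a)^-1 * (q x + a)^-1) * (2 * (Re v * Re v + Im v * Im v)) +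
    dline v q x * dline v q x * ((q x + a)^-1 * (q x + a)^-1 -
      2 * (q x + 3 * a) * ((q x + a)^-1 * (q x + a)^-1 * (q x + a)^-1)).
  rewrite e; apply: is_dlineP.
  have qD := is_dline_qa x v; have qV := is_dlineV (qa0 x) qD.
  have q3 := is_dlineD (smooth_is_dline x v smooth_sq_dist) (is_dline_cst (3 * a) _ _).
  have q2 : is_dline (dline v q) x v (2 * (Re v * Re v + Im v * Im v)).
    rewrite q1.
    have r := is_dlineD (is_dline_Re x v) (is_dline_cst (- Re p) _ _).
    have i := is_dlineD (is_dline_Im x v) (is_dline_cst (- Im p) _ _).
    have cst b := is_dline_cst b x v.
    have := is_dlineM (cst 2) (is_dlineD (is_dlineM r (cst (Re v))) (is_dlineM i (cst (Im v)))).
    by move/is_derive_ext; apply => //=; ring.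
  have := is_dlineM (is_dlineM q3 (is_dlineM qV qV)) q2.
  move/is_derive_ext; apply => //=.
  by rewrite -exprVn; ring.
rewrite /laplacian !e2 !q1 imagE /=; have := qa0 x.
have -> : q x = (Re x - Re p) ^+ 2 + (Im x - Im p) ^+ 2 by rewrite /q; ring.
by move=> ?; field.
Qed.

Lemma line_derivable_eta : line_derivable eta /\ forall v, line_derivable (dline v eta).
Proof.
split=> [v x|v]; first by have [] := is_dline_eta x v.
have -> : dline v eta = (fun x => eta' x * dline v q x).
  by apply/funext => y; exact: (is_dlineP (is_dline_eta y v)).
have cst b := @smooth_cst R C b; have s := smooth_sq_dist.
have sV : smooth (fun x => (q x + a)^-1) by exact: (smoothV (smoothD s (cst a)) qa0).
exact: (smooth_line_derivable (smoothM (smoothM (smoothD s (cst (3 * a))) (smoothM sV sV))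
  (smooth_dline v s))).
Qed.

Lemma eta_continuous : continuous eta.
Proof.
move=> x; have qc := smooth_continuous (smoothD smooth_sq_dist (@smooth_cst R C a)).
apply: (@cvgB _ _ _ (nbhs x)).
  apply: (@continuous_comp _ _ _ (fun x => q x + a) (@ln R)); first exact: qc.
  exact: (continuous_ln (sq_dist_pos x)).
apply: (@cvgM _ _ (nbhs x)); first exact: cvg_cst.
by apply: (@cvgV _ _ (nbhs x)) => //; exact: qc.
Qed.

Lemma eta_large (M : R) : exists S, forall x, S <= q x -> M <= eta x.
Proof.
exists (expR (M + 2)) => x qx.
have l : M + 2 <= ln (q x + a).
  rewrite -(expRK (M + 2)) ler_ln ?posrE ?expR_gt0 ?sq_dist_pos //.
  by rewrite (le_trans qx) // lerDl ltW.
have : 2 * a * (q x + a)^-1 <= 2.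
  rewrite -mulrA ger_pMr // ler_pdivrMr ?sq_dist_pos // mul1r lerDr; exact: sq_dist_ge0.
rewrite /eta; move: l; move: (ln _) (2 * a * _) => A B; lra.
Qed.

End Comparison.

Lemma subharmonic_le_disc (F : C -> R) (M : R) (p z : C) (a : R) :
  smooth F -> (forall t, F t <= M) -> (forall t, 0 <= laplacian F t) -> 0 < a ->
  exists w, (Re w - Re p) * (Re w - Re p) + (Im w - Im p) * (Im w - Im p) <= 3 * a /\
    F z <= F w.
Proof.
move=> FS FM FL a0.
pose q (x : C) := (Re x - Re p) * (Re x - Re p) + (Im x - Im p) * (Im x - Im p).
have qc : continuous q := smooth_continuous (smooth_sq_dist p).
have Fc := smooth_continuous FS.
have a3 : 0 <= 3 * a by rewrite mulr_ge0 // ltW.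
have [w wK wmax] : exists2 w : C, 0 <= q w <= 3 * a &
    forall x, 0 <= q x <= 3 * a -> F x <= F w.
  have [||w /set_mem wK wm] := @compact_EVT_max _ _ F _ _ (@compact_annulus p 0 (3 * a)).
  - by exists p; rewrite /= !subrr !mul0r addr0 lexx.
  - exact: continuous_subspaceT.
  - by exists w => // x xK; apply: wm; exact: mem_set.
exists w; split; first by case/andP: wK.
have [zK|zK] := lerP (q z) (3 * a).
  by apply: wmax; rewrite zK (sq_dist_ge0 p).
rewrite leNgt; apply/negP => wz.
pose E (y : R) := ln (y + a) - 2 * a * (y + a)^-1.
pose eta (x : C) : R := ln (q x + a) - 2 * a * (q x + a)^-1.
have [etaD etaDD] : line_derivable eta /\ forall v, line_derivable (dline v eta).
  exact: (line_derivable_eta p a0).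
have etac : continuous eta := eta_continuous (p := p) a0.
pose e := (F z - F w) / (1 + `|eta z - E (3 * a)|).
have den0 : 0 < 1 + `|eta z - E (3 * a)| by rewrite ltr_wpDr.
have e0 : 0 < e by rewrite divr_gt0 // subr_gt0.
have [S SP] := @eta_large p a a0 ((M - F w) / e + E (3 * a) + 1).
pose S' := Num.max S (q z).
pose G (x : C) := F x + - e * eta x.
have Gz : F w - e * E (3 * a) < G z.
  have : e * (eta z - E (3 * a)) < F z - F w.
    rewrite (le_lt_trans (ler_wpM2l (ltW e0) (ler_norm _))) //.
    by rewrite /e mulrAC ltr_pdivrMr // ltr_pM2l ?subr_gt0 // ltrDr.
  rewrite mulrBr /G mulNr; move: (e * E _) (e * eta z) => A B h; lra.
have [||c /set_mem /= /andP[c1 c2] cm] :=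
    @compact_EVT_max _ _ G _ _ (@compact_annulus p (3 * a) S').
- by exists z; rewrite /= -/(q z) (ltW zK) le_max lexx orbT.
- apply: continuous_subspaceT => x; apply: (@cvgD _ _ _ (nbhs x)); first exact: Fc.
  by apply: (@cvgM _ _ (nbhs x)); [exact: cvg_cst|exact: etac].
rewrite -/(q c) in c1 c2.
have Gc : F w - e * E (3 * a) < G c.
  by apply: (lt_le_trans Gz); apply: cm; apply: mem_set; rewrite /= -/(q z) (ltW zK) le_max lexx orbT.
have {}c1 : 3 * a < q c.
  rewrite lt_neqAle c1 andbT; apply/eqP => qe.
  have Fw : F c <= F w by apply: wmax; rewrite (sq_dist_ge0 p) qe lexx.
  by move: Gc; rewrite /G /eta -qe mulNr ltNge lerD2r Fw.
have {}c2 : q c < S'.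
  rewrite lt_neqAle c2 andbT; apply/eqP => qe.
  have : S <= q c by rewrite qe le_max lexx.
  move=> /SP; rewrite -/(q c) -/(eta c) => h; move: Gc; rewrite ltNge => /negP; apply.
  have : e * ((M - F w) / e + E (3 * a) + 1) <= e * eta c by rewrite ler_pM2l.
  rewrite 2!mulrDr mulr1 (mulrC e (_ / e)) divfK ?gt_eqF // /G mulNr.
  have := FM c; move: (e * E _) (e * eta c) => A B; lra.
have nb : nbhs c [set x | 3 * a < q x < S'].
  apply: (filterS (P := [set x | 3 * a < q x] `&` [set x | q x < S'])).
    by move=> x /= [-> ->].
  apply: filterI.
    exact: (cvgr_gt (q c) (qc c) _ c1).
  exact: (cvgr_lt (q c) (qc c) _ c2).
have GD v x : is_dline G x v (dline v F x + - e * dline v eta x).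
  have := is_dlineM (is_dline_cst (- e) x v) (line_derivableP v x etaD).
  move=> h; have := is_dlineD (smooth_is_dline x v FS) h.
  by move/is_derive_ext; apply => //; rewrite mulr0 addr0.
have Gv v : dline v G = fun x => dline v F x + - e * dline v eta x.
  by apply/funext => x; exact: (is_dlineP (GD v x)).
have GDD v w' x : is_dline (dline v G) x w'
    (dline w' (dline v F) x + - e * dline w' (dline v eta) x).
  rewrite Gv.
  have := is_dlineM (is_dline_cst (- e) x w') (line_derivableP w' x (etaDD v)).
  move=> h; have := is_dlineD (smooth_is_dline x w' (smooth_dline v FS)) h.
  by move/is_derive_ext; apply => //; rewrite mulr0 addr0.
have le0 v : dline v (dline v F) c + - e * dline v (dline v eta) c <= 0.
  rewrite -(is_dlineP (GDD v v c)).
  have [s [s0 sP]] := @filter_ex _ (0 : R)^' _ _ (filterI near0_neq0 (ball_segment v nb)).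
  apply: (@max_second_derivative _ _ _ _ `|s|).
  - by move=> w' x; have [] := GD w' x.
  - by move=> w' x; have [] := GDD v w' x.
  - by rewrite normr_gt0.
  - move=> t /ltW/sP /= /andP[h1 h2]; apply: cm; apply: mem_set => /=.
    by rewrite -/(q _) !ltW.
have := laplacian_eta p a0 c; rewrite -/(q c) -/eta => lap.
have : laplacian eta c < 0.
  rewrite lap pmulr_llt0 ?invr_gt0 ?exprn_gt0 ?(sq_dist_pos p) //.
  by rewrite pmulr_rlt0 ?subr_lt0 // mulr_gt0.
have := FL c; have := le0 1; have := le0 'i; rewrite /laplacian.
have alg (A B A' B' : R) : B + - e * B' <= 0 -> A + - e * A' <= 0 -> 0 <= A + B ->
    A' + B' < 0 -> False.
  move=> h1 h2 h3 h4.
  have : 0 < - e * (A' + B') by rewrite nmulr_rgt0 // oppr_lt0.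
  rewrite mulrDr; lra.
exact: alg.
Qed.

Theorem liouville (F : C -> R) (M : R) :
  smooth F -> (forall t, F t <= M) -> (forall t, 0 <= laplacian F t) ->
  forall x y, F x = F y.
Proof.
move=> FS FM FL; suff le z p : F z <= F p by move=> x y; apply/le_anti; rewrite !le.
apply/ler_addgt0Pr => e e0.
have /cvgrPdist_lt/(_ _ e0)/nbhs_ballP[d /= d0 dF] := (smooth_continuous FS : continuous F) p.
have [r r0 dr] := posC d0.
have [|w [wp zw]] := @subharmonic_le_disc F M p z ((r / 2) ^+ 2 / 3) FS FM FL.
  by rewrite divr_gt0 // exprn_gt0 // divr_gt0.
apply: (le_trans zw).
have /dF : ball p d w.
  rewrite -ball_normE /ball_ /= dr normc_def lt_ofR ReB ImB.
  apply: (@le_lt_trans _ _ (r / 2)); last by rewrite ltr_pdivrMr // ltr_pMr // ltr1n.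
  have e2 : Num.sqrt ((r / 2) ^+ 2) = r / 2 by rewrite sqrtr_sqr ger0_norm ?divr_ge0 ?ltW.
  rewrite -[in leRHS]e2; apply: ler_wsqrtr.
  apply: le_trans (_ : 3 * ((r / 2) ^+ 2 / 3) <= _); last by rewrite mulrC divfK.
  by apply: le_trans wp; rewrite !expr2; lra.
by rewrite ltr_distlC => /andP[_ /ltW].
Qed.

End Liouville.

Section Holomorphic_curves.
Context {R : realType}.
Local Notation C := (Cplx R).
Local Notation Re := complex.Re.
Local Notation Im := complex.Im.

Lemma expiD (a b : R) : expi (a + b) = expi a * expi b.
Proof. by apply: cplxP; rewrite ?ReM ?ImM /= ?cosD ?sinD //; ring. Qed.

Lemma expi0 : expi 0 = 1 :> C.
Proof. by apply: cplxP; rewrite /= ?cos0 ?sin0. Qed.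

Lemma norm_expi (a : R) : `|expi a| = 1 :> C.
Proof. by rewrite normc_def /= cos2Dsin2 sqrtr1. Qed.

Lemma cexpD (x y : C) : cexp (x + y) = cexp x * cexp y.
Proof. by rewrite /cexp ReD ImD expRD expiD ofRM; ring. Qed.

Lemma cexp0 : cexp 0 = 1 :> C.
Proof. by rewrite /cexp /= expR0 expi0 mulr1. Qed.

Lemma norm_cexp (x : C) : `|cexp x| = ofR (expR (Re x)).
Proof. by rewrite normrM norm_expi mulr1 normc_ofR ger0_norm ?expR_ge0. Qed.

Lemma is_cder_cexp (V : normedModType C) (f : V -> C) p v a : is_cder f p v a ->
  is_cder (fun x => cexp (f x)) p v (a * cexp (f p)).
Proof.
move=> [fr fi].
have e := is_dline_comp fr (is_derive_expR (Re (f p))).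
have c := is_dline_comp fi (is_derive_cos (Im (f p))).
have s := is_dline_comp fi (is_derive_sin (Im (f p))).
rewrite /cexp; split.
  have := is_dlineM e c; move/is_derive_ext; apply => [t|].
    by rewrite ReM /= mul0r subr0.
  by rewrite !(ReM, ImM) /=; ring.
have := is_dlineM e s; move/is_derive_ext; apply => [t|].
  by rewrite ImM /= mul0r addr0.
by rewrite !(ReM, ImM) /=; ring.
Qed.

Lemma csm_id : csm (fun x : C => x).
Proof. by split; [exact: smooth_Re|exact: smooth_Im]. Qed.

Lemma is_cder_id (p v : C) : is_cder id p v v.
Proof. by split; [exact: is_dline_Re|exact: is_dline_Im]. Qed.

Lemma cder_id (p v : C) : cder v id p = v.
Proof. exact: (is_cderP (is_cder_id p v)). Qed.

Lemma is_cder_cexpl (b p v : C) :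
  is_cder (fun t => cexp (b * t)) p v (b * v * cexp (b * p)).
Proof.
apply: is_cder_cexp; have := is_cderM (is_cder_cst b p v) (is_cder_id p v).
by move/is_cder_ext; apply => //; rewrite mul0r addr0.
Qed.

Lemma csm_cexpl (b : C) : csm (fun t => cexp (b * t)).
Proof.
pose S (f : C -> R) := exists a, f = fun t => Re (a * cexp (b * t)).
have D a v p : is_dline (fun t => Re (a * cexp (b * t))) p v (Re (a * b * v * cexp (b * p))).
  have [h _] := is_cderM (is_cder_cst a p v) (is_cder_cexpl b p v).
  by apply: (is_derive_ext h) => //; rewrite mul0r addr0 !mulrA.
have SS f : S f -> smooth f.
  apply: smooth_coind => {}f [a ->]; split.
  - move=> x; apply: (@cvg_Re _ _ (nbhs x)).
    apply: (@cvgM _ _ (nbhs x)); first exact: cvg_cst.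
    have c1 : continuous (fun t : C => expR (Re (b * t))).
      move=> y; apply: continuous_comp; last exact: continuous_expR.
      apply: (@cvg_Re _ _ (nbhs y)); apply: (@cvgM _ _ (nbhs y)); [exact: cvg_cst|exact: cvg_id].
    have c2 (g : R -> R) : continuous g -> continuous (fun t : C => g (Im (b * t))).
      move=> fc y; apply: continuous_comp; last exact: fc.
      apply: (@cvg_Im _ _ (nbhs y)); apply: (@cvgM _ _ (nbhs y)); [exact: cvg_cst|exact: cvg_id].
    apply: (@cvgM _ _ (nbhs x)); first exact: (@cvg_ofR _ _ (nbhs x) _ _ _ (c1 x)).
    apply: (@cvg_cplx _ _ (nbhs x)); first exact: (c2 _ (@continuous_cos R)).
    exact: (c2 _ (@continuous_sin R)).
  - by move=> v p; have [] := D a v p.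
  - move=> v; exists (a * b * v); apply/funext => p; exact: (is_dlineP (D a v p)).
split; apply: SS.
  by exists 1; apply/funext => t; rewrite mul1r.
by exists (- 'i); apply/funext => t; rewrite mulNr ReN Re_imul opprK.
Qed.

Lemma wbar_id v p : wbar v (fun x : C => x) p = 0.
Proof. by rewrite wbarE !cder_id [_ *: _](_ : _ = 'i * v) // mulrA mul_imag mulN1r subrr mul0r. Qed.

Lemma wder_id v p : wder v (fun x : C => x) p = v.
Proof.
rewrite wderE !cder_id [_ *: _](_ : _ = 'i * v) // mulrA mul_imag mulN1r opprK.
by field.
Qed.

Lemma cder_cexpl (b v p : C) : cder v (fun t : C => cexp (b * t)) p = b * v * cexp (b * p).
Proof. exact: (is_cderP (is_cder_cexpl b p v)). Qed.

Lemma wbar_cexpl (b v p : C) : wbar v (fun t : C => cexp (b * t)) p = 0.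
Proof.
rewrite wbarE !cder_cexpl [_ *: _](_ : _ = 'i * v) //.
rewrite (_ : b * ('i * v) * cexp (b * p) = 'i * (b * v * cexp (b * p))); last by ring.
by rewrite mulrA mul_imag mulN1r subrr mul0r.
Qed.

Lemma wder_cexpl (b v p : C) : wder v (fun t : C => cexp (b * t)) p = b * v * cexp (b * p).
Proof. by rewrite -[LHS]addr0 -(wbar_cexpl b v p) -cder_wder cder_cexpl. Qed.

Section Complex_composition.
Context {W V : normedModType C} {J : finType} (e : J -> V) (chi : J -> W -> C).
Hypothesis chiS : forall j, csm (chi j).
Let c x := \sum_j chi j x *: e j.

Let psi (jb : J * bool) x : R := if jb.2 then Re (chi jb.1 x) else Im (chi jb.1 x).
Let e' (jb : J * bool) : V := if jb.2 then e jb.1 else 'i *: e jb.1.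

Let psiS jb : smooth (psi jb).
Proof. by case: jb => j [] /=; [exact: (csm_Re (chiS j))|exact: (csm_Im (chiS j))]. Qed.

Let cE x : c x = \sum_jb ofR (psi jb x) *: e' jb.
Proof.
rewrite (eq_bigr (fun jb => ofR (psi (jb.1, jb.2) x) *: e' (jb.1, jb.2))); last by case.
rewrite -(pair_bigA _ (fun j b => ofR (psi (j, b) x) *: e' (j, b))) /=.
apply: eq_bigr => j _; rewrite big_bool /psi /e' /= scalerA -scalerDl.
by rewrite mulrC -cplxE.
Qed.

Lemma csm_ccompose (f : V -> C) : csm f -> csm (fun x => f (c x)).
Proof.
by move=> fS; apply: (csm_ext (csm_compose e' psiS fS)) => x; rewrite cE.
Qed.

Lemma cder_ccompose (f : V -> C) v x : csm f -> cder v (fun x => f (c x)) x =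
  \sum_j (cder v (chi j) x * wder (e j) f (c x) + (cder v (chi j) x)^* * wbar (e j) f (c x)).
Proof.
move=> fS; rewrite (_ : (fun x => f (c x)) = fun x => f (\sum_jb ofR (psi jb x) *: e' jb)).
  rewrite (cder_compose e' psiS v x fS) -cE.
  rewrite (eq_bigr (fun jb => ofR (dline v (psi (jb.1, jb.2)) x) * cder (e' (jb.1, jb.2)) f (c x))); last by case.
  rewrite -(pair_bigA _ (fun j b => ofR (dline v (psi (j, b)) x) * cder (e' (j, b)) f (c x))) /=.
  apply: eq_bigr => j _; rewrite big_bool /= cder_iwder cder_wder.
  rewrite (_ : dline v (psi (j, true)) x = Re (cder v (chi j) x)); last by rewrite cderE.
  rewrite (_ : dline v (psi (j, false)) x = Im (cder v (chi j) x)); last by rewrite cderE.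
  move: (cder v _ x) (wder _ _ _) (wbar _ _ _) => a A B.
  have -> : a^* = ofR (Re a) - 'i * ofR (Im a).
    by apply: cplxP; rewrite ?(Re_conj, Im_conj, ReB, ImB, Re_imul, Im_imul) /=; ring.
  have -> : a * A = (ofR (Re a) + 'i * ofR (Im a)) * A by rewrite -cplxE.
  by ring.
by apply/funext => y; rewrite cE.
Qed.

Lemma wder_ccompose (f : V -> C) v x : csm f -> wder v (fun x => f (c x)) x =
  \sum_j (wder v (chi j) x * wder (e j) f (c x) + (wbar v (chi j) x)^* * wbar (e j) f (c x)).
Proof.
move=> fS; rewrite wderE !(cder_ccompose _ _ fS) mulr_sumr -sumrB mulr_suml.
apply: eq_bigr => j _; rewrite [wbar v _ _]wbarE [wder v _ _]wderE.
rewrite rmorphM rmorphD rmorphM /= conj_imag conjV2.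
by ring.
Qed.

Lemma wbar_ccompose (f : V -> C) v x : csm f -> wbar v (fun x => f (c x)) x =
  \sum_j (wbar v (chi j) x * wder (e j) f (c x) + (wder v (chi j) x)^* * wbar (e j) f (c x)).
Proof.
move=> fS; rewrite wbarE !(cder_ccompose _ _ fS) mulr_sumr -big_split mulr_suml.
apply: eq_bigr => j _ /=; rewrite [wbar v _ _]wbarE [wder v _ _]wderE.
rewrite rmorphM rmorphB rmorphM /= conj_imag conjV2.
by ring.
Qed.

Hypothesis chiH : forall j v x, wbar v (chi j) x = 0.

Lemma wder_sumvJ (a : J -> C) (f : V -> C) p : csm f ->
  wder (\sum_j a j *: e j) f p = \sum_j a j * wder (e j) f p.
Proof.
move=> fS; elim/big_rec2: _ => [|i b w _ <-].
  by rewrite -(scale0r 0) (wder_scalev _ _ _ fS) mul0r.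
by rewrite (wder_addv _ _ _ fS) (wder_scalev _ _ _ fS).
Qed.

Lemma wbar_sumvJ (a : J -> C) (f : V -> C) p : csm f ->
  wbar (\sum_j a j *: e j) f p = \sum_j (a j)^* * wbar (e j) f p.
Proof.
move=> fS; elim/big_rec2: _ => [|i b w _ <-].
  by rewrite -(scale0r 0) (wbar_scalev _ _ _ fS) conjC0 mul0r.
by rewrite (wbar_addv _ _ _ fS) (wbar_scalev _ _ _ fS).
Qed.

Lemma wder_holo (f : V -> C) v x : csm f ->
  wder v (fun x => f (c x)) x = wder (\sum_j wder v (chi j) x *: e j) f (c x).
Proof.
move=> fS; rewrite (wder_ccompose _ _ fS) (wder_sumvJ _ _ fS).
by apply: eq_bigr => j _; rewrite chiH conjC0 mul0r addr0.
Qed.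

Lemma wbar_holo (f : V -> C) v x : csm f ->
  wbar v (fun x => f (c x)) x = wbar (\sum_j wder v (chi j) x *: e j) f (c x).
Proof.
move=> fS; rewrite (wbar_ccompose _ _ fS) (wbar_sumvJ _ _ fS).
by apply: eq_bigr => j _; rewrite chiH mul0r add0r.
Qed.

Lemma levi_holo (f : V -> C) v x : csm f -> let w := \sum_j wder v (chi j) x *: e j in
  wder v (wbar v (fun x => f (c x))) x = wder w (wbar w f) (c x).
Proof.
move=> fS w.
have wS j := csm_wder v (chiS j).
have bS j : csm (fun y => wbar (e j) f (c y)) := csm_ccompose (csm_wbar (e j) fS).
have e1 y : wbar v (fun x => f (c x)) y = \sum_j (wder v (chi j) y)^* * wbar (e j) f (c y).
  by rewrite (wbar_holo _ _ fS) (wbar_sumvJ _ _ fS).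
rewrite (_ : wbar v (fun x => f (c x)) =
    fun y => \sum_j (wder v (chi j) y)^* * wbar (e j) f (c y)); last exact/funext.
rewrite (wder_sum _ _ _ (fun j _ => csmM (csm_conj (wS j)) (bS j))).
have e2 : wbar w f = (fun y => \sum_j (wder v (chi j) x)^* * wbar (e j) f y).
  by apply/funext => y; rewrite (wbar_sumvJ _ _ fS).
rewrite e2 (wder_sum _ _ _ (fun j _ => csmZ _ (csm_wbar (e j) fS))).
apply: eq_bigr => j _; rewrite (wderM _ _ (csm_conj (wS j)) (bS j)).
rewrite (wder_conj _ _ (wS j)) -(wder_wbarC _ _ _ (chiS j)).
rewrite (_ : wbar v (chi j) = fun=> 0); last exact/funext.
rewrite wder_cst conjC0 mul0r addr0 (wderZ _ _ _ (csm_wbar (e j) fS)).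
by rewrite (wder_holo _ _ (csm_wbar (e j) fS)).
Qed.

End Complex_composition.

Lemma cder0_const (V : normedModType C) (f : V -> C) p q : csm f -> (forall x, cder (q - p) f x = 0) -> f p = f q.
Proof.
move=> fS f0; rewrite -(subrK p q) addrC.
have [fr fi'] := fS.
have dr x : dline (q - p) (fun y => Re (f y)) x = 0.
  by have := congr1 (fun x : C => Re x) (f0 x); rewrite cderE.
have di x : dline (q - p) (fun y => Im (f y)) x = 0.
  by have := congr1 (fun x : C => Im x) (f0 x); rewrite cderE.
have [t1 _ E1] := dline_MVT (q - p) p 1 (smooth_line_derivable fr).
have [t2 _ E2] := dline_MVT (q - p) p 1 (smooth_line_derivable fi').
move: E1 E2; rewrite dr di mulr0 ofR1 scale1r => /eqP; rewrite subr_eq0 => /eqP E1 /eqP.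
by rewrite subr_eq0 => /eqP E2; apply: cplxP.
Qed.

Lemma imag_scale1 : ('i : C) *: (1 : C) = 'i. Proof. exact: mulr1. Qed.

Lemma liouville_wirt (f : C -> C) (M : R) : csm f -> (forall t, f t = ofR (Re (f t))) ->
  (forall t, 0 <= wder (1 : C) (wbar (1 : C) f) t) -> (forall t, Re (f t) <= M) ->
  exists a, f = fun=> a.
Proof.
move=> fS fR fL fM; have rS := csm_Re fS.
have L t : wder (1 : C) (wbar (1 : C) f) t = ofR (laplacian (fun t => Re (f t)) t / 4).
  rewrite -(_ : (fun t => ofR (Re (f t))) = f); last by apply/funext => x; rewrite -fR.
  by rewrite (levi_real (1 : C) t rS) imag_scale1.
exists (f 0); apply/funext => t; rewrite fR [RHS]fR; congr ofR.
apply: (liouville rS fM) => x.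
by have := fL x; rewrite L -ofR0 le_ofR pmulr_lge0 ?invr_gt0.
Qed.

Section Psh.
Context {V : normedModType C} {J : finType} (e : J -> V) (chi : J -> C -> C).
Hypothesis chiS : forall j, csm (chi j).
Hypothesis chiH : forall j v x, wbar v (chi j) x = 0.
Let c x := \sum_j chi j x *: e j.
Variables (f : V -> C) (M : R).
Hypotheses (fS : csm f) (fR : forall p, f p = ofR (Re (f p))).
Hypothesis fL : forall v p, 0 <= wder v (wbar v f) p.
Hypothesis fM : forall t, Re (f (c t)) <= M.

Lemma psh_bounded_curve : exists a, (fun t => f (c t)) = fun=> a.
Proof.
apply: (@liouville_wirt _ M); first exact: (csm_ccompose e chiS fS).
- by move=> t; exact: fR.
- by move=> t; rewrite (levi_holo e chiS chiH (1 : C) t fS).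
- exact: fM.
Qed.

Lemma psh_bounded_curve_levi (t : C) : let w := \sum_j wder (1 : C) (chi j) t *: e j in
  wder w (wbar w f) (c t) = 0.
Proof.
move=> w; rewrite -(levi_holo e chiS chiH (1 : C) t fS).
have [a ->] := psh_bounded_curve.
rewrite (_ : wbar (1 : C) (fun=> a) = fun=> 0); first by rewrite wder_cst.
by apply/funext => x; rewrite wbar_cst.
Qed.

End Psh.
End Holomorphic_curves.

(** * Deck transformations *)

Section Holomorphic_derivative.
Context {R : realType}.
Local Notation C := (Cplx R).
Local Notation Re := complex.Re.
Local Notation Im := complex.Im.

Lemma wder1 (f : C -> C) (v p : C) : csm f -> wder v f p = v * wder (1 : C) f p.
Proof. by move=> fS; rewrite -(wder_scalev v (1 : C) p fS) [_ *: _]mulr1. Qed.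

Lemma wbar1 (f : C -> C) (v p : C) : csm f -> wbar v f p = v^* * wbar (1 : C) f p.
Proof. by move=> fS; rewrite -(wbar_scalev v (1 : C) p fS) [_ *: _]mulr1. Qed.

Lemma holo_cder (f : C -> C) (v p : C) : csm f -> (forall x, wbar (1 : C) f x = 0) ->
  cder v f p = v * wder (1 : C) f p.
Proof.
by move=> fS fH; rewrite cder_wder (wder1 _ _ fS) (wbar1 _ _ fS) fH mulr0 addr0.
Qed.

Lemma mean_value (f f' : C -> C) (x h : C) (M : R) : (forall x v, is_cder f x v (v * f' x)) ->
  (forall t : R, `|t| <= 1 -> `|f' (x + ofR t * h)| <= ofR M) ->
  `|f (x + h) - f x| <= ofR (2 * M) * `|h|.
Proof.
move=> fD fM.
have fr : line_derivable (fun x => Re (f x)) by move=> v p; have [[]] := fD p v.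
have fi : line_derivable (fun x => Im (f x)) by move=> v p; have [_ []] := fD p v.
have [t1 b1 E1] := dline_MVT h x 1 fr; have [t2 b2 E2] := dline_MVT h x 1 fi.
have dr p : dline h (fun x => Re (f x)) p = Re (h * f' p) by apply: is_dlineP; case: (fD p h).
have di p : dline h (fun x => Im (f x)) p = Im (h * f' p) by apply: is_dlineP; case: (fD p h).
rewrite ofR1 scale1r mul1r dr in E1; rewrite ofR1 scale1r mul1r di in E2.
rewrite normr1 in b1 b2.
apply: le_trans (normc_le _) _; rewrite ReB ImB E1 E2 ofRD.
have bRe (y : C) : ofR `|Re y| <= `|y| by exact: normc_ge_Re.
have bIm (y : C) : ofR `|Im y| <= `|y|.
  by have := bRe (- 'i * y); rewrite mulNr ReN Re_imul opprK -mulNr normrM normrN normCi mul1r.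
rewrite (le_trans (lerD (bRe _) (bIm _))) // mulr_natl mulr2n ofRD mulrDl !normrM.
by rewrite mulrC [X in _ + X]mulrC lerD // ler_wpM2r //; exact: fM.
Qed.

Lemma is_cder_linear (c x v : C) : is_cder (fun y : C => c * y) x v (v * c).
Proof.
have := is_cderM (is_cder_cst c x v) (is_cder_id x v).
by move/is_cder_ext; apply => //; rewrite mul0r addr0 mulrC.
Qed.

Definition expansion (f : C -> C) x d := forall e : R, 0 < e -> exists2 r : R, 0 < r &
  forall y, `|y - x| < ofR r -> `|f y - f x - d * (y - x)| <= ofR e * `|y - x|.

Lemma cder_expansion (f f' : C -> C) : (forall x v, is_cder f x v (v * f' x)) ->
  continuous f' -> forall x, expansion f x (f' x).
Proof.
move=> fD dc x e e0; set d := f' x.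
have e2 : 0 < ofR (e / 2) by rewrite -ofR0 lt_ofR divr_gt0.
have /cvgrPdist_lt/(_ _ e2)/nbhs_ballP[_ /= /posC[r r0 ->] rP] := dc x.
exists r => // y yr.
have FD z v : is_cder (fun z => f z + - d * z) z v (v * (f' z - d)).
  have := is_cderD (fD z v) (is_cder_linear (- d) z v).
  by move/is_cder_ext; apply => //; rewrite mulrBr mulrN.
have close (t : R) : `|t| <= 1 -> `|f' (x + ofR t * (y - x)) - d| <= ofR (e / 2).
  move=> t1; apply: ltW; rewrite distrC; apply: rP; rewrite /ball /=.
  rewrite opprD addNKr normrN normrM normc_ofR (le_lt_trans _ yr) // ler_piMl //.
  by rewrite -ofR1 le_ofR.
have := mean_value FD close; rewrite [2 * _]mulrC divfK ?pnatr_eq0 // subrKC.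
by have -> : f y + - d * y - (f x + - d * x) = f y - f x - d * (y - x) by ring.
Qed.

Lemma expansion_is_derive (f : C -> C) x d : expansion f x d -> is_derive x (1 : C) f d.
Proof.
move=> fd.
suff h : (fun h : C => h^-1 *: ((f \o shift x) (h *: (1 : C)) - f x)) @ 0^' --> d.
  by split; [apply/cvg_ex; exists d|apply/cvg_lim].
apply/cvgrPdist_lt => _ /posC[e e0 ->].
have e2 : 0 < e / 2 by rewrite divr_gt0.
have [r r0 rP] := fd _ e2.
exists (ofR r); first by rewrite /= -ofR0 lt_ofR.
move=> h; rewrite /ball_ /= sub0r normrN => hr h0.
have := rP (h + x); rewrite addrK => /(_ hr) bd.
have -> : h *: (1 : C) + x = h + x by rewrite [_ *: _]mulr1.
have alg (u a k : C) : k != 0 -> a - k^-1 * u = - (k^-1 * (u - a * k)).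
  by move=> k0; field.
rewrite [_ *: _]/(_ * _) (alg _ _ _ h0) normrN normrM normfV mulrC ltr_pdivrMr ?normr_gt0 //.
rewrite (le_lt_trans bd) // ltr_pM2r ?normr_gt0 // lt_ofR; lra.
Qed.

Lemma holo_is_derive (f : C -> C) : csm f -> (forall x, wbar (1 : C) f x = 0) ->
  forall x, is_derive x (1 : C) f (wder (1 : C) f x).
Proof.
move=> fS fH x; apply/expansion_is_derive/cder_expansion; last exact: (csm_continuous (csm_wder _ fS)).
by move=> y v; rewrite -(holo_cder _ _ fS fH); exact: csm_is_cder.
Qed.

End Holomorphic_derivative.

Section Deck.
Context {R : realType} {m : nat}.
Local Notation C := (Cplx R).
Local Notation Re := complex.Re.
Local Notation Im := complex.Im.
Local Notation V := 'rV[C]_m.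
Local Notation pt := 'rV[C]_(m + 1).
Context (Gam : set V) (H : V -> V -> C) (alpha : V -> C).
Hypothesis LB : line_bundle_data Gam H alpha.
Implicit Types (gam z w : V) (p v : pt) (xi : C).

Definition mult gam z : C := alpha gam * cexp (ofR pi * H z gam + ofR (pi / 2) * H gam gam).
Definition point z xi : pt := row_mx z (const_mx xi).

Lemma deckE gam p : deck H alpha gam p =
  row_mx (lsubmx p + gam) (mult gam (lsubmx p) *: rsubmx p).
Proof. by []. Qed.

Lemma pointE p : p = point (lsubmx p) (fiber_coord p).
Proof.
rewrite -[LHS]hsubmxK /point /fiber_coord; congr row_mx.
by apply/matrixP => i j; rewrite !mxE !ord1.
Qed.

Lemma deck_point gam z xi : deck H alpha gam (point z xi) = point (z + gam) (mult gam z * xi).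
Proof.
rewrite deckE /point !row_mxKl !row_mxKr; congr row_mx.
by apply/matrixP => i j; rewrite !mxE.
Qed.

Lemma form_linear w : linear (H ^~ w : V -> C^o).
Proof. exact: (lb_linear LB). Qed.

Lemma formD z1 z2 w : H (z1 + z2) w = H z1 w + H z2 w.
Proof. by have := form_linear w 1 z1 z2; rewrite !scale1r. Qed.

Lemma form0 w : H 0 w = 0.
Proof. by apply: (@addrI _ (H 0 w)); rewrite -formD !addr0. Qed.

Lemma formZ a z w : H (a *: z) w = a * H z w.
Proof. by have := form_linear w a z 0; rewrite !addr0 form0 addr0. Qed.

Lemma formDr z w1 w2 : H z (w1 + w2) = H z w1 + H z w2.
Proof. by rewrite !(lb_hermitian LB z) formD rmorphD. Qed.

Lemma formZr a z w : H z (a *: w) = a^* * H z w.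
Proof. by rewrite !(lb_hermitian LB z) formZ rmorphM. Qed.

Lemma form_sum z w : H z w = \sum_i z 0 i * H (delta_mx 0 i) w.
Proof.
rewrite {1}(row_sum_delta z); elim/big_rec2: _ => [|i a b _ <-]; first exact: form0.
by rewrite formD formZ.
Qed.

Lemma form_continuous gam : continuous (H ^~ gam).
Proof.
move=> z; rewrite (_ : H ^~ gam = fun z => \sum_i z 0 i * H (delta_mx 0 i) gam); last first.
  by apply/funext => y; exact: form_sum.
apply: (@cvg_big _ _ _ _ _ add_continuous _ (nbhs z)) => i _.
apply: (@cvgM _ _ (nbhs z)); last exact: cvg_cst.
exact: coord_continuous.
Qed.

Definition hnorm z : R := Re (H z z).

Lemma hnormE z : H z z = ofR (hnorm z).
Proof.
have e := lb_hermitian LB z z; apply: cplxP => //=.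
have /eqP := congr1 (@complex.Im R) e; rewrite Im_conj.
by rewrite eq_sym -subr_eq0 -opprD oppr_eq0 -mulr2n mulrn_eq0 /= => /eqP.
Qed.

Lemma hnormD z w : hnorm (z + w) = hnorm z + 2 * Re (H z w) + hnorm w.
Proof.
rewrite /hnorm formD !formDr !ReD (lb_hermitian LB w z) Re_conj; ring.
Qed.

Lemma norm_mult gam z : Gam gam ->
  `|mult gam z| = ofR (expR (pi / 2 * (hnorm (z + gam) - hnorm z))).
Proof.
move=> gG; rewrite normrM (lb_unitary LB gG) mul1r norm_cexp; congr (ofR (expR _)).
by rewrite ReD hnormD hnormE !ReM /= !mul0r !subr0; field.
Qed.

Lemma mult_neq0 gam z : Gam gam -> mult gam z != 0.
Proof. by move=> gG; rewrite -normr_eq0 (norm_mult z gG) fmorph_eq0 gt_eqF ?expR_gt0. Qed.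

Definition deck_jac gam p : 'M[C]_(m + 1) :=
  block_mx 1%:M (\col_i (mult gam (lsubmx p) * (ofR pi * H (delta_mx 0 i) gam) * fiber_coord p))
           0 (const_mx (mult gam (lsubmx p))).

Lemma derivable_cexp (x : C) : is_derive x (1 : C) (@cexp R) (cexp x).
Proof.
have e : (fun t : C => cexp (1 * t)) = @cexp R by apply/funext => t; rewrite mul1r.
have := @holo_is_derive R _ (csm_cexpl 1) (wbar_cexpl 1 1) x.
by rewrite wder_cexpl !mul1r e.
Qed.

Lemma is_derive_affine_line (W : normedModType C) (f : pt -> W) p v d :
  is_derive (0 : C) (1 : C) (fun t : C => f (t *: v + p)) d -> is_derive p v f d.
Proof.
have e : (fun h : C => h^-1 *: (((fun t : C => f (t *: v + p)) \o shift 0) (h *: (1 : C)) -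
    f (0 *: v + p))) = (fun h => h^-1 *: ((f \o shift p) (h *: v) - f p)).
  by apply/funext => h /=; rewrite addr0 [_ *: 1]mulr1 scale0r add0r.
move=> [c d0]; split; first by move: c; rewrite /derivable e.
by move: d0; rewrite /derive e.
Qed.

Lemma is_derive_coord p v j : is_derive p v (fun q : pt => q 0 j) (v 0 j).
Proof.
apply: is_derive_affine_line.
have -> : (fun t : C => (t *: v + p) 0 j) = (fun t => t * v 0 j + p 0 j).
  by apply/funext => t; rewrite !mxE.
have := is_deriveD (is_deriveM (is_derive_id (0 : C) 1) (is_derive_cst (v 0 j) (0 : C) 1))
  (is_derive_cst (p 0 j) (0 : C) 1).
by move/is_derive_eq; apply; rewrite scaler0 add0r addr0 [_ *: _]mulr1.
Qed.

Lemma is_derive_mult gam p v : is_derive p v (fun q => mult gam (lsubmx q))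
  (mult gam (lsubmx p) * (ofR pi * H (lsubmx v) gam)).
Proof.
apply: is_derive_affine_line; set a := ofR pi * _.
have -> : (fun t : C => mult gam (lsubmx (t *: v + p))) =
    (fun t => mult gam (lsubmx p) * cexp (a * t)).
  apply/funext => t; rewrite /mult linearD linearZ formD formZ -mulrA -cexpD.
  by congr (_ * cexp _); rewrite /a; ring.
have h := @holo_is_derive R _ (csm_cexpl a) (wbar_cexpl a 1) 0.
have := is_deriveM (is_derive_cst (mult gam (lsubmx p)) (0 : C) 1) h.
move/is_derive_eq; apply; rewrite scaler0 addr0 wder_cexpl mulr0 cexp0 !mulr1.
by [].
Qed.

Lemma differentiable_form gam p : differentiable (fun q : pt => H (lsubmx q) gam) p.
Proof.
rewrite (_ : (fun q : pt => _) = \sum_i (fun q : pt => q 0 (lshift 1 i) * H (delta_mx 0 i) gam)).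
  apply: differentiable_sum => i; apply: differentiableM; last exact: differentiable_cst.
  exact: differentiable_coord.
apply/funext => q; rewrite fct_sumE form_sum; apply: eq_bigr => i _.
by rewrite !mxE.
Qed.

Lemma differentiable_mult gam p : differentiable (fun q : pt => mult gam (lsubmx q)) p.
Proof.
rewrite /mult; apply: differentiableM; first exact: differentiable_cst.
apply: (@differentiable_comp _ _ _ _
  (fun q : pt => ofR pi * H (lsubmx q) gam + ofR (pi / 2) * H gam gam) (@cexp R)).
  apply: differentiableD; last exact: differentiable_cst.
  apply: differentiableM; [exact: differentiable_cst|exact: differentiable_form].
by apply/derivable1_diffP; case: (derivable_cexp
  (ofR pi * H (lsubmx p) gam + ofR (pi / 2) * H gam gam)).
Qed.

Lemma differentiable_deck gam p : differentiable (deck H alpha gam) p.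
Proof.
rewrite (_ : deck H alpha gam =
  (\sum_(i < m) (fun q : pt => q 0 (lshift 1 i) *: (delta_mx 0 (lshift 1 i) : pt))) +
  (fun=> row_mx gam 0) +
  (fun q : pt => (mult gam (lsubmx q) * q 0 (rshift m 0)) *: (delta_mx 0 (rshift m 0) : pt))).
  apply: differentiableD; first apply: differentiableD => //.
    apply: differentiable_sum => i; apply: differentiableZl; exact: differentiable_coord.
  apply: differentiableZl; apply: differentiableM; first exact: differentiable_mult.
  exact: differentiable_coord.
apply/funext => q; rewrite !fctE fct_sumE deckE; apply/rowP => j.
rewrite !mxE summxE; case: (split_ordP j) => k ->.
  rewrite !mxE (bigD1 k) //= big1 => [|i ik]; last first.
    by rewrite !mxE (inj_eq (@lshift_inj _ _)) eq_sym (negbTE ik) andbF mulr0.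
  rewrite !mxE !eqxx mulr1 addr0 eq_lrshift mulr0 addr0.
  by [].
rewrite big1 => [|i _]; last by rewrite !mxE eq_rlshift mulr0.
rewrite !mxE ord1 !eqxx mulr1 add0r.
by rewrite add0r.
Qed.

Lemma derive_coord (f : pt -> pt) p v j : derivable f p v ->
  'D_v (fun q => f q 0 j) p = ('D_v f p) 0 j.
Proof.
move=> df; apply/cvg_lim => //.
have e : (fun h : C => h^-1 *: (((fun q => f q 0 j) \o shift p) (h *: v) - f p 0 j)) =
  (fun M : pt => M 0 j) \o (fun h => h^-1 *: ((f \o shift p) (h *: v) - f p)).
  by apply/funext => h /=; rewrite !mxE.
rewrite e; apply: continuous_cvg; first exact: coord_continuous.
exact: df.
Qed.

Lemma deck_jacobian gam p : jacobian (deck H alpha gam) p = deck_jac gam p.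
Proof.
have dd := differentiable_deck gam p.
apply/row_matrixP => i; rewrite !rowE -(deriveEjacobian _ dd).
set v := delta_mx 0 i; have dv := @diff_derivable _ _ _ _ _ v dd.
rewrite /deck_jac -[v](hsubmxK) mul_row_block mulmx0 addr0 mulmx1 hsubmxK.
apply/rowP => j; rewrite -(derive_coord j dv) !mxE; case: splitP => k jk.
  have -> : j = lshift 1 k by apply: val_inj.
  apply: derive_val; rewrite (_ : (fun q : pt => _) = fun q : pt => q 0 (lshift 1 k) + gam 0 k).
    have := is_deriveD (is_derive_coord p v (lshift 1 k)) (is_derive_cst (gam 0 k) p v).
    by move/is_derive_eq; apply; rewrite addr0 !mxE.
  by apply/funext => q; rewrite deckE row_mxEl !mxE.
have -> : j = rshift m k by apply: val_inj.
apply: derive_val; rewrite (_ : (fun q : pt => _) = fun q : pt => mult gam (lsubmx q) * q 0 (rshift m k)).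
  have := is_deriveM (is_derive_mult gam p v) (is_derive_coord p v (rshift m k)).
  move/is_derive_eq; apply; rewrite !ord1 [_ *: _]mulrC [X in _ + X]mulrC addrC !mxE.
  rewrite big_ord1 !mxE; congr (_ + _).
  rewrite form_sum !mulr_sumr mulr_suml; apply: eq_bigr => l _.
  by rewrite !mxE /fiber_coord !mxE; ring.
by apply/funext => q; rewrite deckE row_mxEr !mxE.
Qed.

End Deck.

Section Fundamental_domain.
Context {R : realType} {m : nat}.
Local Notation C := (Cplx R).
Local Notation Re := complex.Re.
Local Notation Im := complex.Im.
Local Notation V := 'rV[C]_m.
Local Notation pt := 'rV[C]_(m + 1).

Definition cube : set 'rV[R]_(m + m) := [set x | forall i, 0 <= x 0 i <= 1].
Definition cell (b : 'I_(m + m) -> V) (x : 'rV[R]_(m + m)) : V := \sum_i ofR (x 0 i) *: b i.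

Lemma lattice_cell (Gam : set V) : lattice Gam ->
  exists b, forall z, exists x gam, [/\ cube x, Gam gam & z = cell b x + gam].
Proof.
move=> [b [bfree ->]]; exists b => z.
pose B : 'M[R]_(m + m) :=
  row_mx (\matrix_(i, j) Re (b i 0 j)) (\matrix_(i, j) Im (b i 0 j)).
have BE (x : 'rV[R]_(m + m)) (w : V) :
    x *m B = row_mx (\row_j Re (w 0 j)) (\row_j Im (w 0 j)) -> cell b x = w.
  rewrite mul_mx_row => /eq_row_mx[e1 e2]; apply/rowP => j; rewrite summxE.
  move/matrixP/(_ 0 j): e1; move/matrixP/(_ 0 j): e2; rewrite !mxE => e2 e1.
  apply: cplxP; [rewrite -e1|rewrite -e2].
    elim/big_rec2: _ => // i y s _ <-; rewrite ReD !mxE ReM /=; ring.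
  elim/big_rec2: _ => // i y s _ <-; rewrite ImD !mxE ImM /=; ring.
have BU : B \in unitmx.
  rewrite -row_free_unit -kermx_eq0; apply/eqP/row_matrixP => i; rewrite row0.
  set k := row i _; have kB : k *m B = row_mx (\row_j Re ((0 : V) 0 j)) (\row_j Im ((0 : V) 0 j)).
    rewrite /k -row_mul mulmx_ker row0 -[0 in LHS]row_mx0; congr row_mx;
      by apply/matrixP => a c; rewrite !mxE.
  have := bfree (fun j => k 0 j) (BE _ _ kB) => k0.
  by apply/rowP => j; rewrite k0 mxE.
pose y := row_mx (\row_j Re (z 0 j)) (\row_j Im (z 0 j)) *m invmx B.
have yz : cell b y = z by apply: BE; rewrite mulmxKV.
exists (\row_i (y 0 i - (Num.floor (y 0 i))%:~R)), (\sum_i (Num.floor (y 0 i))%:~R *: b i).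
split.
- move=> i; rewrite mxE; move: (y 0 i) => c; rewrite subr_ge0 floor_le /= lerBlDr addrC.
  by have := ltW (floorD1_gt c); rewrite intrD.
- by exists (fun i => Num.floor (y 0 i)).
rewrite -yz /cell -big_split; apply: eq_bigr => i _ /=.
by rewrite !mxE -scalerDl ofRD ofRN rmorph_int subrK.
Qed.

Lemma compact_cube : compact cube.
Proof.
have -> : cube = [set x : 'rV[R]_(m + m) | forall i, `[0, 1]%classic (x 0 i)].
  by apply/seteqP; split=> x xc i; have := xc i; rewrite /= in_itv.
apply: (@rV_compact R^o _ (fun=> `[0, 1]%classic)) => i; exact: segment_compact.
Qed.

Lemma point_sum (z : V) (xi : C) : point z xi = row_mx z 0 + xi *: point 0 1 :> pt.
Proof.
rewrite /point scale_row_mx scaler0 add_row_mx addr0 add0r; congr row_mx.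
by apply/matrixP => i j; rewrite !mxE mulr1.
Qed.

Definition cell_box (b : 'I_(m + m) -> V) (k : R) : set pt :=
  [set point (cell b u.1) u.2 | u in cube `*` [set x : C | `|Re x| <= k /\ `|Im x| <= k]].

Lemma compact_cell_box b k : compact (cell_box b k).
Proof.
apply: continuous_compact; last by apply: compact_setX; [exact: compact_cube|exact: compact_box].
apply: continuous_subspaceT => u.
rewrite (_ : (fun u => _) = (fun u : 'rV[R]_(m + m) * C =>
    (\sum_i ofR (u.1 0 i) *: (row_mx (b i) 0 : pt)) + u.2 *: (point 0 1 : pt))).
  apply: (@cvgD _ _ _ (nbhs u)).
    apply: (@cvg_big _ _ _ _ _ add_continuous _ (nbhs u)) => i _.
    apply: (@cvgZr_tmp _ _ _ (nbhs u)); apply: (@cvg_ofR _ _ (nbhs u)).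
    apply: (@continuous_comp _ _ _ fst (fun x : 'rV[R]_(m + m) => x 0 i)); first exact: cvg_fst.
    exact: coord_continuous.
  apply: (@cvgZr_tmp _ _ _ (nbhs u)); exact: cvg_snd.
apply/funext => v; rewrite point_sum /cell; congr (_ + _).
elim/big_rec2: _ => [|i y s _ <-]; first by rewrite row_mx0.
by rewrite scale_row_mx scaler0 add_row_mx addr0.
Qed.

Lemma bounded_cell (b : 'I_(m + m) -> V) (f : pt -> R) (k : R) : continuous f ->
  exists M, forall x xi, cube x -> `|Re xi| <= k -> `|Im xi| <= k ->
    f (point (cell b x) xi) <= M.
Proof.
move=> fc; have [D0|D0] := pselect (cell_box b k !=set0); last first.
  by exists 0 => x xi xc h1 h2; exfalso; apply: D0; exists (point (cell b x) xi), (x, xi).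
have [c _ cm] := compact_EVT_max D0 (@compact_cell_box b k) (continuous_subspaceT fc).
by exists (f c) => x xi xc h1 h2; apply: cm; rewrite inE; exists (x, xi).
Qed.

End Fundamental_domain.

Section Equivariance.
Context {R : realType} {m : nat}.
Local Notation C := (Cplx R).
Local Notation Re := complex.Re.
Local Notation Im := complex.Im.
Local Notation V := 'rV[C]_m.
Local Notation pt := 'rV[C]_(m + 1).
Context (Gam : set V) (H : V -> V -> C) (alpha : V -> C) (g : pt -> 'M[C]_(m + 1)).
Hypothesis LB : line_bundle_data Gam H alpha.
Hypothesis gX : kaehler_on_total_space Gam H alpha g.
Let gK : kaehler_metric g. Proof. by case: gX. Qed.
Local Notation h := (fun p => invmx (g p)).

Lemma inv_metric_deck gam p : Gam gam ->
  h (deck H alpha gam p) = adjmx (deck_jac H alpha gam p) *m h p *m deck_jac H alpha gam p.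
Proof.
move=> gG; have [_ /(_ gam gG p)] := gX.
rewrite /pullback (deck_jacobian LB); set J := deck_jac _ _ _ _.
set G' := g (deck _ _ _ _) => e.
have JU : J \in unitmx.
  have := metric_unit gK p; rewrite -e !unitmxE !det_mulmx !unitrM.
  by move/andP=> [/andP[]].
have e1 : J *m (G' *m (adjmx J *m h p *m J)) = J.
  by rewrite !mulmxA e (mulmxV (metric_unit gK p)) mul1mx.
have e2 : G' *m (adjmx J *m h p *m J) = 1%:M.
  by apply: (can_inj (mulKmx JU)); rewrite e1 mulmx1.
have GU : G' \in unitmx := metric_unit gK _.
by apply: (can_inj (mulKmx GU)); rewrite e2 (mulmxV GU).
Qed.

Lemma conorm_deck gam x p : Gam gam ->
  conorm g x (deck H alpha gam p) = conorm g (x *m adjmx (deck_jac H alpha gam p)) p.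
Proof.
move=> gG; rewrite /conorm (inv_metric_deck p gG) adjmxM adjmxK.
by move: (deck_jac _ _ _ _) (invmx _) => J k; rewrite !mulmxA.
Qed.

Lemma adj_deck_jac gam z xi : adjmx (deck_jac H alpha gam (point z xi)) =
  block_mx 1%:M 0
    (\row_i (mult H alpha gam z * (ofR pi * H (delta_mx 0 i) gam) * xi)^*)
    (const_mx (mult H alpha gam z)^*).
Proof.
rewrite /deck_jac /adjmx map_block_mx tr_block_mx map_mx1 trmx1 map_mx0 trmx0.
rewrite /point row_mxKl /fiber_coord row_mxKr; congr block_mx.
  by apply/matrixP => i j; rewrite !mxE.
by apply/matrixP => i j; rewrite !mxE.
Qed.

Lemma conorm_deck_base gam (x : V) p : Gam gam ->
  conorm g (row_mx x 0) (deck H alpha gam p) = conorm g (row_mx x 0) p.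
Proof.
move=> gG; rewrite conorm_deck // (pointE p) adj_deck_jac mul_row_block.
by rewrite mulmx1 !mul0mx mulmx0 !addr0.
Qed.

Lemma conormZ a x p : conorm g (a *: x) p = a * a^* * conorm g x p.
Proof.
rewrite /conorm -!scalemxAl mxE (_ : adjmx (a *: x) = a^* *: adjmx x); last first.
  by apply/matrixP => i j; rewrite !mxE rmorphM.
by rewrite -scalemxAr mxE mulrA.
Qed.

Lemma conorm_deck_fiber gam z xi : Gam gam -> (forall i, H (delta_mx 0 i) gam * xi = 0) ->
  conorm g (point 0 1) (point (z + gam) (mult H alpha gam z * xi)) =
  `|mult H alpha gam z| ^+ 2 * conorm g (point 0 1) (point z xi).
Proof.
move=> gG xi0; have := conorm_deck (point 0 1) (point z xi) gG.
rewrite deck_point => ->; rewrite normCK [X in X * _]mulrC.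
have -> : point 0 1 *m adjmx (deck_jac H alpha gam (point z xi)) =
    (mult H alpha gam z)^* *: point 0 1 :> pt.
  rewrite adj_deck_jac /point mul_row_block !mul0mx !add0r scale_row_mx scaler0.
  congr row_mx; apply/matrixP => i j; rewrite !mxE.
    by rewrite big_ord1 !mxE -!mulrA xi0 !mulr0 conjC0 mulr0.
  by rewrite big_ord1 !mxE mul1r mulr1.
by rewrite conormZ conjCK.
Qed.

End Equivariance.

(** * Vanishing of the Hermitian form *)

Section Positivity.
Context {R : realType} {m : nat}.
Local Notation C := (Cplx R).
Local Notation Re := complex.Re.
Local Notation Im := complex.Im.
Local Notation V := 'rV[C]_m.
Local Notation pt := 'rV[C]_(m + 1).
Context (Gam : set V) (H : V -> V -> C) (alpha : V -> C) (g : pt -> 'M[C]_(m + 1)).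
Hypothesis GamL : lattice Gam.
Hypothesis LB : line_bundle_data Gam H alpha.
Hypothesis gX : kaehler_on_total_space Gam H alpha g.
Hypothesis BI : BI_ge0 g.
Let gK : kaehler_metric g. Proof. by case: gX. Qed.
Local Notation h := (fun p => invmx (g p)).
Local Notation hnorm := (hnorm H).
Local Notation ex := (point 0 1 : pt).

Lemma hnormZ a z : hnorm (a *: z) = (Re a * Re a + Im a * Im a) * hnorm z.
Proof.
rewrite -[LHS]/(Re (H _ _)) (formZ LB) (formZr LB) (hnormE LB) !ReM !ImM !(Re_conj, Im_conj) /=.
by rewrite /hnorm; ring.
Qed.

Lemma hnorm_continuous : continuous (fun p : pt => hnorm (lsubmx p)).
Proof.
move=> p; apply: (@cvg_Re _ _ (nbhs p)).
have e (q : pt) : H (lsubmx q) (lsubmx q) =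
    \sum_i q 0 (lshift 1 i) * (\sum_k q 0 (lshift 1 k) * H (delta_mx 0 k) (delta_mx 0 i))^*.
  rewrite (form_sum LB); apply: eq_bigr => i _; rewrite mxE (lb_hermitian LB).
  by rewrite (form_sum LB); congr (_ * _^*); apply: eq_bigr => k _; rewrite mxE.
rewrite (_ : (fun q : pt => H (lsubmx q) (lsubmx q)) = (fun q => \sum_i q 0 (lshift 1 i) *
   (\sum_k q 0 (lshift 1 k) * H (delta_mx 0 k) (delta_mx 0 i))^*)); last exact/funext.
rewrite e; apply: (@cvg_big _ _ _ _ _ add_continuous _ (nbhs p)) => i _.
apply: (@cvgM _ _ (nbhs p)); first exact: coord_continuous.
apply: (@continuous_comp _ _ _ (fun q : pt => \sum_k q 0 (lshift 1 k) *
  H (delta_mx 0 k) (delta_mx 0 i)) Num.conj); last exact: continuous_conj.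
apply: (@cvg_big _ _ _ _ _ add_continuous _ (nbhs p)) => k _.
apply: (@cvgM _ _ (nbhs p)); [exact: coord_continuous|exact: cvg_cst].
Qed.

Lemma hnorm_cell_bound : exists b B, (forall z, exists x gam,
    [/\ cube x, Gam gam & z = cell b x + gam]) /\
  forall x, cube x -> `|hnorm (cell b x)| <= B.
Proof.
have [b bP] := lattice_cell GamL.
have hc := hnorm_continuous.
have hNc : continuous (fun p : pt => - hnorm (lsubmx p)).
  by move=> p; apply: (@cvgN _ _ _ (nbhs p)); exact: hc.
have [M1 M1P] := bounded_cell b 0 hc; have [M2 M2P] := bounded_cell b 0 hNc.
exists b, (Num.max M1 M2); split=> // x xc.
have h1 : hnorm (cell b x) <= M1.
  by have := M1P x 0 xc; rewrite /= normr0 /point row_mxKl; apply.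
have h2 : - hnorm (cell b x) <= M2.
  by have := M2P x 0 xc; rewrite /= normr0 /point row_mxKl; apply.
by rewrite ler_norml lerNl !le_max h1 h2 orbT.
Qed.

Lemma conorm_ge0 x p : 0 <= Re (conorm g x p).
Proof.
have [->|x0] := eqVneq x 0; first by rewrite /conorm !mul0mx mxE.
by have := inv_metric_posdef gK p x0; rewrite -/(conorm g x p) conorm_real // -ofR0 lt_ofR => /ltW.
Qed.

(* On the zero section, |d xi|^2 is e^(pi H(z,z)) times a Gamma-periodic       *)
(* function; on a line where H is negative it is bounded and subharmonic,      *)
(* hence constant, yet it tends to 0.                                          *)
Lemma hermitian_form_ge0 v : 0 <= hnorm v.
Proof.
rewrite leNgt; apply/negP => vneg.
have [b [B [bP bB]]] := hnorm_cell_bound.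
pose f := conorm g ex.
have fS : csm f := csm_conorm gK ex.
have fR p : f p = ofR (Re (f p)) := conorm_real gK ex p.
have [M1 M1P] := bounded_cell b 0 (smooth_continuous (csm_Re fS)).
have fM0 x : cube x -> Re (f (point (cell b x) 0)) <= M1.
  by move=> xc; apply: M1P; rewrite //= normr0.
have pi0 := @pi_gt0 R.
have key t : Re (f (point (t *: v) 0)) <=
    expR (pi * ((Re t * Re t + Im t * Im t) * hnorm v + B)) * M1.
  have [x [gam [xc gG e]]] := bP (t *: v).
  have eqv := conorm_deck_fiber LB gX (cell b x) gG (fun i => mulr0 (H (delta_mx 0 i) gam)).
  rewrite mulr0 in eqv; rewrite e /f eqv (norm_mult LB _ gG) -e -/f.
  rewrite fR expr2 -!ofRM /= -expRD -mulrDl -splitr hnormZ.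
  have f0 := fM0 _ xc; have fge0 := conorm_ge0 ex (point (cell b x) 0).
  apply: (ler_pM (expR_ge0 _) fge0 _ f0).
  rewrite ler_expR ler_wpM2l ?(ltW pi0) // lerD2l.
  by have := bB _ xc; rewrite ler_norml => /andP[h1 _]; rewrite lerNl.
have M10 : 0 <= M1.
  have [x [gam [xc gG e]]] := bP 0.
  by apply: le_trans (fM0 _ xc); exact: conorm_ge0.
have curveE (t : C) : \sum_(j < 1) t *: (row_mx v 0 : pt) = point (t *: v) 0.
  by rewrite big_ord1 /point scale_row_mx scaler0; congr row_mx; apply/matrixP => i j; rewrite !mxE.
have [a aP] : exists a, (fun t : C => f (\sum_(j < 1) t *: (row_mx v 0 : pt))) = fun=> a.
  apply: (@psh_bounded_curve R pt 'I_1 (fun=> row_mx v 0) (fun _ t => t) _ _ f (expR (pi * B) * M1)).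
  - by move=> _; exact: csm_id.
  - by move=> _ w x; exact: wbar_id.
  - exact: fS.
  - exact: fR.
  - by move=> w p; exact: (conorm_levi_ge0 gK BI).
  move=> t; rewrite curveE (le_trans (key t)) // ler_wpM2r // ler_expR ler_wpM2l ?(ltW pi0) //.
  by rewrite gerDr mulr_ge0_le0 ?(ltW vneg) // addr_ge0 // -expr2 sqr_ge0.
have {}aP t : f (point (t *: v) 0) = a by rewrite -curveE; exact: (congr1 (@^~ t) aP).
have a0 : 0 < Re a.
  rewrite -(aP 0) -lt_ofR -fR ofR0; apply: (inv_metric_posdef gK).
  apply/eqP => /matrixP/(_ 0 (rshift m 0)); rewrite !mxE.
  by case: splitP => [j /= /eqP|j _]; rewrite ?addn0 ?gtn_eqF // !mxE => /eqP; rewrite oner_eq0.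
pose K := expR (pi * B) * M1 / Re a.
pose s := Num.sqrt (K / (pi * - hnorm v)).
have K0 : 0 <= K by rewrite divr_ge0 ?mulr_ge0 ?expR_ge0 // ltW.
have q0 : 0 <= pi * - hnorm v by rewrite mulr_ge0 ?oppr_ge0 ?ltW.
have ss : s * s = K / (pi * - hnorm v).
  by rewrite -expr2 sqr_sqrtr // divr_ge0.
have := key (ofR s); rewrite aP /= mul0r addr0 ss.
rewrite mulrDr expRD -mulrA.
have alg (P L N : R) : P != 0 -> N != 0 -> P * (L / (P * - N) * N) = - L.
  by move=> P0 N0; rewrite mulrN invrN mulrN mulNr mulrN; congr (- _); field; rewrite P0 N0.
rewrite (alg _ _ _ (lt0r_neq0 pi0) (ltr0_neq0 vneg)).
rewrite expRN [X in _ <= X]mulrC ler_pdivlMr ?expR_gt0 // mulrC.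
rewrite -ler_pdivlMr // -/K => h1.
have := expR_ge1Dx K; rewrite leNgt => /negP; apply.
by rewrite (le_lt_trans h1) // ltrDr ltr01.
Qed.

Lemma quadratic_bound (A r s x y : R) : 0 < A ->
  x * r + y * s - A * (x * x + y * y) <= (r * r + s * s) / (4 * A).
Proof.
move=> A0; rewrite -subr_ge0.
have -> : (r * r + s * s) / (4 * A) - (x * r + y * s - A * (x * x + y * y)) =
    A * ((x - r / (2 * A)) ^+ 2 + (y - s / (2 * A)) ^+ 2) by field; rewrite gt_eqF.
by rewrite mulr_ge0 ?addr_ge0 ?sqr_ge0 ?ltW.
Qed.

Lemma Re_le_norm (x : C) (k : R) : `|x| <= ofR k -> `|Re x| <= k.
Proof. by move=> xk; have /le_trans/(_ xk) := normc_ge_Re x; rewrite lecR. Qed.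

Lemma Im_le_norm (x : C) (k : R) : `|x| <= ofR k -> `|Im x| <= k.
Proof.
move=> xk; rewrite -normrN -Re_imul; apply: Re_le_norm.
by rewrite normrM normCi mul1r.
Qed.

(* Through every point off the zero section and in every direction not tangent *)
(* to the kernel of H there is a curve t -> (z0 + t v, xi0 e^(b t)) on which    *)
(* |xi|^2 e^(-pi H(z,z)) is bounded, i.e. which stays over a compact part of X. *)
Lemma base_conorm_levi0 (x z0 v : V) (xi0 b : C) : 0 < hnorm v ->
  let w := row_mx v 0 + (b * xi0) *: ex in
  wder w (wbar w (conorm g (row_mx x 0))) (point z0 xi0) = 0.
Proof.
move=> vpos w; pose f := conorm g (row_mx x 0).
have fS : csm f := csm_conorm gK _.
have fR p : f p = ofR (Re (f p)) := conorm_real gK _ p.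
have pi0 := @pi_gt0 R.
have [l [B [lP lB]]] := hnorm_cell_bound.
pose e (j : 'I_3) : pt := nth 0 [:: row_mx z0 0; row_mx v 0; xi0 *: ex] j.
pose chi (j : 'I_3) : C -> C := nth (fun=> 0) [:: (fun=> 1); id; (fun t => cexp (b * t))] j.
have chiS j : csm (chi j).
  by case: j => [[|[|[|//]]]] jP; [exact: csm_cst|exact: csm_id|exact: csm_cexpl].
have chiH j u y : wbar u (chi j) y = 0.
  by case: j => [[|[|[|//]]]] jP; [exact: wbar_cst|exact: wbar_id|exact: wbar_cexpl].
have cE t : \sum_j chi j t *: e j = point (z0 + t *: v) (xi0 * cexp (b * t)).
  rewrite !big_ord_recl big_ord0 addr0 /chi /e /= scale1r [RHS]point_sum.
  by rewrite scale_row_mx scaler0 addrA add_row_mx addr0 scalerA mulrC.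
have wE : \sum_j wder (1 : C) (chi j) 0 *: e j = w.
  rewrite !big_ord_recl big_ord0 addr0 /chi /e /= wder_cst scale0r add0r.
  by rewrite wder_id wder_cexpl mulr0 cexp0 !mulr1 scale1r scalerA.
pose n0 := Re `|xi0|.
have n0E : `|xi0| = ofR n0 := norm_real xi0.
have n00 : 0 <= n0 by rewrite -le_ofR ofR0 -n0E.
pose A := pi / 2 * hnorm v.
have A0 : 0 < A by rewrite mulr_gt0 // divr_gt0.
pose y := H z0 v.
pose r := Re b - pi * Re y; pose s := - Im b - pi * Im y.
pose E0 := (r * r + s * s) / (4 * A) - pi / 2 * hnorm z0.
have E0P t : Re (b * t) - pi / 2 * hnorm (z0 + t *: v) <= E0.
  rewrite (hnormD LB) hnormZ (formZr LB) -/y !ReM Re_conj Im_conj.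
  apply: le_trans (_ : (Re t * r + Im t * s - A * (Re t * Re t + Im t * Im t)) - pi / 2 * hnorm z0 <= _).
    by rewrite /r /s /A le_eqVlt; apply/orP; left; apply/eqP; field.
  by rewrite lerD2r; exact: quadratic_bound.
pose k := n0 * expR (E0 + pi / 2 * B).
have [M MP] := bounded_cell l k (smooth_continuous (csm_Re fS)).
have fM t : Re (f (\sum_j chi j t *: e j)) <= M.
  rewrite cE; have [c [gam [cc gG ez]]] := lP (z0 + t *: v).
  pose xi' := xi0 * cexp (b * t) / mult H alpha gam (cell l c).
  have -> : point (z0 + t *: v) (xi0 * cexp (b * t)) = deck H alpha gam (point (cell l c) xi').
    rewrite deck_point -ez; congr point; rewrite /xi' [RHS]mulrC divfK //.
    exact: (mult_neq0 LB).
  rewrite /f (conorm_deck_base LB gX) //.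
  have xk : `|xi'| <= ofR k.
    rewrite normf_div normrM n0E norm_cexp (norm_mult LB _ gG) -ez -ofRM -fmorphV -ofRM le_ofR.
    rewrite /k -expRN -mulrA ler_wpM2l // -expRD ler_expR.
    have := E0P t; have := lB _ cc; rewrite ler_norml => /andP[_ h1] h2.
    have h3 : pi / 2 * hnorm (cell l c) <= pi / 2 * B by rewrite ler_wpM2l // divr_ge0 // ltW.
    by move: h2 h3; rewrite mulrBr; move: (_ * hnorm _) (_ * hnorm _) (Re _) => a1 a2 a3; lra.
  by apply: MP => //; [exact: Re_le_norm|exact: Im_le_norm].
have := @psh_bounded_curve_levi R pt 'I_3 e chi chiS chiH f M fS fR
  (fun w p => conorm_levi_ge0 gK BI (row_mx x 0) w p) fM 0.
by rewrite /= wE cE scale0r addr0 mulr0 cexp0 mulr1.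
Qed.

End Positivity.

Section Vanishing.
Context {R : realType} {m : nat}.
Local Notation C := (Cplx R).
Local Notation Re := complex.Re.
Local Notation Im := complex.Im.
Local Notation V := 'rV[C]_m.
Local Notation pt := 'rV[C]_(m + 1).
Context (Gam : set V) (H : V -> V -> C) (alpha : V -> C) (g : pt -> 'M[C]_(m + 1)).
Hypothesis GamL : lattice Gam.
Hypothesis LB : line_bundle_data Gam H alpha.
Hypothesis gX : kaehler_on_total_space Gam H alpha g.
Hypothesis BI : BI_ge0 g.
Let gK : kaehler_metric g. Proof. by case: gX. Qed.
Local Notation h := (fun p => invmx (g p)).
Local Notation hnorm := (hnorm H).
Local Notation ex := (point 0 1 : pt).

Lemma mwbar_addv n k (A : pt -> 'M[C]_(n, k)) u v p : mcsm A ->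
  mwbar (u + v) A p = mwbar u A p + mwbar v A p.
Proof. by move=> AS; apply/matrixP => i j; rewrite !mxE (wbar_addv _ _ _ (AS i j)). Qed.

Lemma mwbar_scalev n k (A : pt -> 'M[C]_(n, k)) a v p : mcsm A ->
  mwbar (a *: v) A p = a^* *: mwbar v A p.
Proof. by move=> AS; apply/matrixP => i j; rewrite !mxE (wbar_scalev _ _ _ (AS i j)). Qed.

Lemma continuous_vanish (f : R -> C) : continuous f -> (forall s, s != 0 -> f s = 0) -> f 0 = 0.
Proof.
move=> fc f0; have c1 : f s @[s --> (0 : R)^'] --> f 0.
  by apply: cvg_trans (fc 0); apply: cvg_app; exact: nbhs_dnbhs.
have c2 : f s @[s --> (0 : R)^'] --> (0 : C).
  apply/cvgrPdist_lt => e e0; near=> s; rewrite f0 ?subrr ?normr0 //.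
  by near: s; exact: near0_neq0.
exact: (cvg_unique _ c1 c2).
Unshelve. all: by end_near. Qed.

Variable v0 : V.
Hypothesis v0pos : 0 < hnorm v0.

Lemma base_conorm_antiholo (x : V) w p : row_mx x 0 *m mwbar w h p = 0.
Proof.
have hS := inv_metric_csm gK.
pose Z u q := row_mx x 0 *m mwbar u h q.
have ZD u u' q : Z (u + u') q = Z u q + Z u' q by rewrite /Z mwbar_addv // mulmxDr.
have ZN u q : Z (- u) q = - Z u q.
  by rewrite /Z -scaleN1r mwbar_scalev // rmorphN1 -scalemxAr scaleN1r.
have off z xi u : xi != 0 -> Z u (point z xi) = 0.
  move=> xi0.
  have pos v eta : 0 < hnorm v -> Z (row_mx v 0 + eta *: ex) (point z xi) = 0.
    move=> vp; apply: (conorm_levi_eq0 gK BI).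
    rewrite -[eta](divfK xi0).
    exact: (base_conorm_levi0 GamL LB gX BI x z xi (eta / xi) vp).
  have pos0 v : 0 < hnorm v -> Z (row_mx v 0) (point z xi) = 0.
    by move=> vp; have := pos _ 0 vp; rewrite scale0r addr0.
  have fib eta : Z (eta *: ex) (point z xi) = 0.
    by have := pos _ eta v0pos; rewrite ZD pos0 // add0r.
  have rowD v v' : row_mx (v + v') 0 = row_mx v 0 + row_mx v' 0 :> pt.
    by rewrite add_row_mx addr0.
  have rowN v : row_mx (- v) 0 = - row_mx v 0 :> pt by rewrite opp_row_mx oppr0.
  have base v : Z (row_mx v 0) (point z xi) = 0.
    have hN : hnorm (- v) = hnorm v.
      by rewrite -scaleN1r (hnormZ LB) ReN ImN /=; ring.
    have par : 0 < hnorm (v0 + v) + hnorm (v0 - v).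
      rewrite !(hnormD LB) hN.
      have -> : H v0 (- v) = - H v0 v by rewrite -scaleN1r (formZr LB) rmorphN1 mulN1r.
      rewrite ReN; have := hermitian_form_ge0 GamL LB gX BI v; have := v0pos.
      by move: (hnorm v0) (hnorm v) (Re _) => a b c; lra.
    have [p1|p1] := ltP 0 (hnorm (v0 + v)).
      by have := pos0 _ p1; rewrite rowD ZD pos0 // add0r.
    have p2 : 0 < hnorm (v0 - v) by move: par p1; move: (hnorm _) (hnorm _) => a b; lra.
    have := pos0 _ p2; rewrite rowD ZD pos0 // add0r rowN ZN => /eqP.
    by rewrite oppr_eq0 => /eqP.
  have -> : u = row_mx (lsubmx u) 0 + fiber_coord u *: ex.
    by rewrite {1}(pointE u) point_sum.
  by rewrite ZD base fib addr0.
rewrite (pointE p); set z := lsubmx p; set xi := fiber_coord p.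
have [->|xi0] := eqVneq xi 0; last exact: off.
apply/rowP => k; rewrite [RHS]mxE.
pose f (s : R) := Z w (point z (ofR s)) 0 k.
have ZS : csm (fun q => Z w q 0 k).
  exact: (mcsmM (mcsm_cst (row_mx x 0)) (mcsm_mwbar w hS) 0 k).
apply: (@continuous_vanish f); last first.
  by move=> s s0; rewrite /f off ?mxE // fmorph_eq0.
move=> s; apply: (@continuous_comp _ _ _ (fun s : R => point z (ofR s) : pt) (fun q => Z w q 0 k)).
  rewrite (_ : (fun s : R => _) = (fun s => row_mx z 0 + ofR s *: ex)).
    apply: (@cvgD _ _ _ (nbhs s)); first exact: cvg_cst.
    by apply: (@cvgZr_tmp _ _ _ (nbhs s)); exact: continuous_ofR.
  by apply/funext => y; rewrite point_sum.
exact: csm_continuous.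
Qed.

Local Notation bi := (fun i : 'I_m => lshift 1 i).
Local Notation fi := (rshift m (0 : 'I_1)).
Let hS := inv_metric_csm gK.

Lemma base_row_antiholo j k w p : wbar w (fun q => h q (lshift 1 j) k) p = 0.
Proof.
have := base_conorm_antiholo (delta_mx 0 j) w p.
move=> /matrixP/(_ 0 k); rewrite mxE [RHS]mxE (bigD1 (lshift 1 j)) //= big1 ?addr0.
  by rewrite row_mxEl !mxE !eqxx mul1r.
move=> i ij; case: (split_ordP i) ij => i' -> ij; last by rewrite row_mxEr mxE mul0r.
by rewrite (inj_eq (@lshift_inj _ _)) in ij; rewrite row_mxEl mxE eqxx /= (negbTE ij) mul0r.
Qed.

Lemma base_block_const j k p q : h p (lshift 1 j) (lshift 1 k) = h q (lshift 1 j) (lshift 1 k).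
Proof.
apply: (cder0_const (hS _ _)) => x.
rewrite cder_wder base_row_antiholo addr0.
rewrite (_ : (fun y => _) = (fun y => (h y (lshift 1 k) (lshift 1 j))^*)).
  by rewrite (wder_conj _ _ (hS _ _)) base_row_antiholo conjC0.
by apply/funext => y; rewrite -{1}(inv_metric_herm gK) adjmxE.
Qed.

Let c j k : C := h 0 (lshift 1 j) (lshift 1 k).
Let r j p : C := h p (lshift 1 j) fi.

Let rS j : csm (r j). Proof. exact: hS. Qed.

Lemma block_conj_ur (k : 'M[C]_(m + 1)) q1 q2 (q3 : 'cV[C]_m) q4 j :
  (block_mx 1%:M 0 q1 q2 *m k *m block_mx 1%:M q3 0 q4) (lshift 1 j) fi =
  (ulsubmx k *m q3 + ursubmx k *m q4) j 0.
Proof.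
rewrite -[in LHS](submxK k) !mulmx_block !mul1mx !mul0mx !addr0 !mulmx1 !mulmx0.
by rewrite block_mxEur.
Qed.

Lemma fiber_row_deck j gam z xi : Gam gam ->
  r j (point (z + gam) (mult H alpha gam z * xi)) =
  mult H alpha gam z * (\sum_i c j i * (ofR pi * H (delta_mx 0 i) gam)) * xi +
  mult H alpha gam z * r j (point z xi).
Proof.
move=> gG; rewrite -deck_point /r.
rewrite (congr1 (fun A : 'M[C]_(m + 1) => A _ _) (inv_metric_deck LB gX (point z xi) gG)).
rewrite adj_deck_jac /deck_jac block_conj_ur mxE; congr (_ + _).
  rewrite mxE mulr_sumr mulr_suml; apply: eq_bigr => i _; rewrite !mxE.
  by rewrite (base_block_const _ _ _ 0) -/(c _ _) /point row_mxKl /fiber_coord row_mxKr mxE; ring.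
by rewrite !mxE big_ord1 !mxE /point row_mxKl mulrC.
Qed.

Let rho j (z : V) : C := cder ex (r j) (point z 0).

Lemma cder_congr_line (f g' : pt -> C) p q v w :
  (forall t : R, f (p + ofR t *: v) = g' (q + ofR t *: w)) -> cder v f p = cder w g' q.
Proof.
move=> fg; rewrite !cderE; apply: cplxP; rewrite /= /dline.
  by congr (derive1 _ 0); apply/funext => t; rewrite fg.
by congr (derive1 _ 0); apply/funext => t; rewrite fg.
Qed.

Lemma is_cder_fiber p v : is_cder (fun q : pt => fiber_coord q) p v (fiber_coord v).
Proof.
split.
  apply: (is_dline_linear (L := fun q : pt => Re (fiber_coord q))) => x t w.
  by rewrite /fiber_coord !mxE Re_affine.
apply: (is_dline_linear (L := fun q : pt => Im (fiber_coord q))) => x t w.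
by rewrite /fiber_coord !mxE Im_affine.
Qed.

(* Differentiates the equivariance of r_j along the fiber, at the zero section. *)
Lemma rho_deck j gam z : Gam gam ->
  rho j (z + gam) = rho j z + \sum_i c j i * (ofR pi * H (delta_mx 0 i) gam).
Proof.
move=> gG; set K := \sum_i _; set e := mult H alpha gam z.
have e0 : e != 0 by exact: (mult_neq0 LB).
apply: (mulfI e0); rewrite mulrDr.
have <- : cder (e *: ex) (r j) (point (z + gam) 0) = e * rho j (z + gam).
  rewrite !cder_wder (wder_scalev _ _ _ (rS j)) (wbar_scalev _ _ _ (rS j)) /rho cder_wder.
  by rewrite !base_row_antiholo mulr0 !addr0.
have psiD : is_cder (fun q : pt => e * K * fiber_coord q + e * r j q) (point z 0) ex
    (e * rho j z + e * K).
  have := is_cderD (is_cderM (is_cder_cst (e * K) (point z 0) ex) (is_cder_fiber (point z 0) ex))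
    (is_cderM (is_cder_cst e (point z 0) ex) (csm_is_cder (point z 0) ex (rS j))).
  move/is_cder_ext; apply => //.
  by rewrite !mul0r !addr0 addrC /fiber_coord /point row_mxKr mxE mulr1.
rewrite -(is_cderP psiD); apply: cder_congr_line => t.
have l1 : point (z + gam) 0 + ofR t *: (e *: ex) = point (z + gam) (e * ofR t) :> pt.
  by rewrite [RHS]point_sum scalerA mulrC (point_sum _ 0) scale0r addr0.
have l2 : point z 0 + ofR t *: ex = point z (ofR t) :> pt.
  by rewrite [RHS]point_sum (point_sum _ 0) scale0r addr0.
rewrite l1 l2 fiber_row_deck // -/e -/K.
by rewrite /fiber_coord /point row_mxKr mxE.
Qed.

Let K j (z : V) : C := \sum_i c j i * (ofR pi * H (delta_mx 0 i) z).

Lemma conjugate_part_continuous j : continuous (K j).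
Proof.
move=> z; apply: (@cvg_big _ _ _ _ _ add_continuous _ (nbhs z)) => i _.
apply: (@cvgM _ _ (nbhs z)); first exact: cvg_cst.
apply: (@cvgM _ _ (nbhs z)); first exact: cvg_cst.
rewrite (_ : H (delta_mx 0 i) = (fun x => (H x (delta_mx 0 i))^*)).
  have fc : continuous (H ^~ (delta_mx 0 i)) by exact: (form_continuous LB).
  exact: (cvg_comp _ _ (fc z) (@continuous_conj R _)).
by apply/funext => x; rewrite (lb_hermitian LB).
Qed.

Lemma row0_point (z : V) : row_mx z 0 = point z 0 :> pt.
Proof. by rewrite point_sum scale0r addr0. Qed.

Lemma rho_continuous j : continuous (rho j).
Proof.
move=> z; apply: (@continuous_comp _ _ _ (fun z : V => point z 0 : pt) (cder ex (r j))); last first.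
  exact: (csm_continuous (csm_cder _ (rS j))).
rewrite (_ : (fun z : V => _) = (fun z => \sum_i z 0 i *: (row_mx (delta_mx 0 i) 0 : pt))).
  apply: (@cvg_big _ _ _ _ _ add_continuous _ (nbhs z)) => i _.
  by apply: (@cvgZr_tmp _ _ _ (nbhs z)); exact: coord_continuous.
apply/funext => y; rewrite -row0_point {1}(row_sum_delta y).
elim/big_rec2: _ => [|i a b _ <-]; first by rewrite row_mx0.
by rewrite scale_row_mx scaler0 add_row_mx addr0.
Qed.

Lemma periodic_bounded (F : V -> R) : continuous F ->
  (forall gam z, Gam gam -> F (z + gam) = F z) -> exists M, forall z, F z <= M.
Proof.
move=> Fc Fp; have [l lP] := lattice_cell GamL.
have Gc : continuous (fun p : pt => F (lsubmx p)).
  move=> p; apply: (@continuous_comp _ _ _ (fun p : pt => lsubmx p) F); last exact: Fc.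
  exact/differentiable_continuous/differentiable_lsubmx.
have [M MP] := bounded_cell l 0 Gc.
exists M => z; have [x [gam [xc gG ->]]] := lP z.
by rewrite Fp //; have := MP x 0 xc; rewrite /= normr0 /point row_mxKl; apply.
Qed.

Lemma harmonic_bounded (F : C -> C) (M : R) : csm F ->
  (forall t, wder (1 : C) (wbar (1 : C) F) t = 0) -> (forall t, Re (F t) <= M) ->
  forall s t, Re (F s) = Re (F t).
Proof.
move=> FS F0 FM; apply: (liouville (csm_Re FS) FM) => t.
have e : wder (1 : C) (wbar (1 : C) (fun x => ofR (Re (F x)))) t = 0.
  rewrite (_ : (fun x => ofR (Re (F x))) = (fun x => 2^-1 * (F x + (F x)^*))); last first.
    apply/funext => x; have -> : F x + (F x)^* = 2 * ofR (Re (F x)).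
      apply: cplxP; rewrite ?(ReD, ImD) ?(Re_conj, Im_conj).
        by rewrite mulr_natl mulr2n ReD.
      by rewrite mulr_natl mulr2n ImD /= subrr addr0.
    by rewrite mulKf ?pnatr_eq0.
  have cF := csm_conj FS; have wF := csm_wder (1 : C) FS; have bF := csm_wbar (1 : C) FS.
  rewrite (_ : wbar (1 : C) _ = fun x => 2^-1 * (wbar (1 : C) F x + (wder (1 : C) F x)^*)).
    rewrite (wderZ _ _ _ (csmD bF (csm_conj wF))) (wderD _ _ bF (csm_conj wF)) F0.
    by rewrite (wder_conj _ _ wF) -(wder_wbarC _ _ _ FS) F0 conjC0 addr0 mulr0.
  apply/funext => x; rewrite (wbarZ _ _ _ (csmD FS cF)) (wbarD _ _ FS cF).
  by rewrite (wbar_conj _ _ FS).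
have := levi_real (1 : C) t (csm_Re FS); rewrite e imag_scale1 => /esym/eqP.
rewrite fmorph_eq0 mulf_eq0 invr_eq0 pnatr_eq0 orbF => /eqP.
by rewrite /laplacian => ->.
Qed.

(* On a complex line, rho_j is holomorphic, K_j is antiholomorphic, and their   *)
(* difference is bounded because it is Gamma-periodic.                         *)
Lemma conjugate_part0 j z : K j z = 0.
Proof.
set kap := K j z.
have Kper gam y : Gam gam -> K j (y + gam) = K j y + K j gam.
  move=> _; rewrite /K -big_split; apply: eq_bigr => i _ /=.
  by rewrite (formDr LB); ring.
have Dper gam y : Gam gam -> rho j (y + gam) - K j (y + gam) = rho j y - K j y.
  by move=> gG; rewrite rho_deck // Kper // -/(K j gam); ring.
have Dc : continuous (fun y => rho j y - K j y).
  by move=> y; apply: (@cvgB _ _ _ (nbhs y)); [exact: rho_continuous|exact: conjugate_part_continuous].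
have [M1 M1P] : exists M, forall y, Re (rho j y - K j y) <= M.
  apply: periodic_bounded => [y|gam y gG]; last by rewrite Dper.
  by apply: (@cvg_Re _ _ (nbhs y) _ _ _ (Dc y)).
have [M2 M2P] : exists M, forall y, Im (rho j y - K j y) <= M.
  apply: periodic_bounded => [y|gam y gG]; last by rewrite Dper.
  by apply: (@cvg_Im _ _ (nbhs y) _ _ _ (Dc y)).
pose G := cder ex (r j).
have GS : csm G := csm_cder ex (rS j).
have GH w p : wbar w G p = 0.
  rewrite /G -(cder_wbarC _ _ _ (rS j)).
  rewrite (_ : wbar w (r j) = fun=> 0) ?cder_cst //.
  by apply/funext => q; exact: base_row_antiholo.
pose F1 (t : C) := G (\sum_(i < 1) t *: (row_mx z 0 : pt)).
have idS (i : 'I_1) : csm (fun t : C => t) := csm_id.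
have idH (i : 'I_1) (v x : C) : wbar v (fun t : C => t) x = 0 := wbar_id v x.
have F1S : csm F1 := csm_ccompose (fun=> row_mx z 0) idS GS.
have F1H t : wbar (1 : C) F1 t = 0.
  by rewrite (wbar_holo (fun=> row_mx z 0) idS idH _ _ GS) GH.
have cS := csm_conj (@csm_id R).
pose F (t : C) := F1 t + - kap * t^*.
have FS : csm F := csmD F1S (csmZ (- kap) cS).
have FE t : F t = rho j (t *: z) - K j (t *: z).
  rewrite /F /F1 big_ord1 /rho -row0_point scale_row_mx scaler0; congr (_ + _).
  rewrite /K /kap /K mulNr mulr_suml; congr (- _); apply: eq_bigr => i _.
  by rewrite (formZr LB); ring.
have Fb t : wbar (1 : C) F t = - kap.
  rewrite (wbarD _ _ F1S (csmZ (- kap) cS)) F1H (wbarZ _ _ _ cS).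
  by rewrite (wbar_conj _ _ csm_id) wder_id conjC1 mulr1 add0r.
have Fl t : wder (1 : C) (wbar (1 : C) F) t = 0.
  by rewrite (_ : wbar (1 : C) F = fun=> - kap) ?wder_cst //; exact/funext.
have iFl t : wder (1 : C) (wbar (1 : C) (fun x => - 'i * F x)) t = 0.
  rewrite (_ : wbar (1 : C) (fun x => - 'i * F x) = fun=> - 'i * - kap) ?wder_cst //.
  by apply/funext => x; rewrite (wbarZ _ _ _ FS) Fb.
have c1 : forall s t, Re (F s) = Re (F t).
  by apply: (harmonic_bounded (M := M1) FS Fl) => t; rewrite FE.
have c2 : forall s t, Im (F s) = Im (F t).
  have Re_mi (x : C) : Re (- 'i * x) = Im x by rewrite mulNr ReN Re_imul opprK.
  move=> s t; rewrite -!Re_mi.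
  apply: (harmonic_bounded (M := M2) (csmZ (- 'i) FS) iFl) => u.
  by rewrite Re_mi FE.
have := Fb 0; rewrite (_ : F = fun=> F 0); first by rewrite wbar_cst => /esym/eqP; rewrite oppr_eq0 => /eqP.
by apply/funext => t; apply: cplxP; [exact: c1|exact: c2].
Qed.

Lemma form_eq0_of_pos z w : H z w = 0.
Proof.
pose eta i := H (delta_mx 0 i) w.
suff e0 i : eta i = 0 by rewrite (form_sum LB) big1 // => i _; rewrite -/(eta i) e0 mulr0.
have ceta j : \sum_k c j k * eta k = 0.
  have := conjugate_part0 j w; rewrite /K => /eqP.
  rewrite (eq_bigr (fun k => ofR pi * (c j k * eta k))); last by move=> k _; rewrite /eta; ring.
  by rewrite -mulr_sumr mulf_eq0 fmorph_eq0 gt_eqF ?pi_gt0 //= => /eqP.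
pose x : pt := row_mx (\row_k (eta k)^*) 0.
have xl k : x 0 (lshift 1 k) = (eta k)^* by rewrite /x row_mxEl mxE.
have xr k : x 0 (rshift m k) = 0 by rewrite /x row_mxEr mxE.
have hx j : (h 0 *m adjmx x) (lshift 1 j) 0 = 0.
  rewrite mxE big_split_ord /= big_ord1 !adjmxE xr conjC0 mulr0 addr0 -[RHS](ceta j).
  by apply: eq_bigr => k _; rewrite adjmxE xl conjCK.
have x0 : x = 0.
  apply/eqP/negPn/negP => /(inv_metric_posdef gK 0).
  rewrite -mulmxA mxE big_split_ord /= big_ord1 xr mul0r addr0 big1 ?ltxx // => k _.
  by rewrite hx mulr0.
by have := xl i; rewrite x0 mxE => /esym/eqP; rewrite conjC_eq0 => /eqP.
Qed.

End Vanishing.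

Theorem form_vanishes (R : realType) (m : nat) (Gam : set 'rV[Cplx R]_m)
    (H : 'rV[Cplx R]_m -> 'rV[Cplx R]_m -> Cplx R) (alpha : 'rV[Cplx R]_m -> Cplx R)
    (g : 'rV[Cplx R]_(m + 1) -> 'M[Cplx R]_(m + 1)) :
  lattice Gam -> line_bundle_data Gam H alpha ->
  kaehler_on_total_space Gam H alpha g -> BI_ge0 g -> forall z w, H z w = 0.
Proof.
move=> GamL LB gX BI z w.
have [[v0 v0pos]|npos] := pselect (exists v, 0 < hnorm H v).
  exact: (form_eq0_of_pos GamL LB gX BI v0pos).
have h0 v : hnorm H v = 0.
  apply/le_anti; rewrite (hermitian_form_ge0 GamL LB gX BI) andbT leNgt.
  by apply/negP => vp; apply: npos; exists v.
have re u v : complex.Re (H u v) = 0.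
  have := hnormD LB u v; rewrite !h0 add0r addr0 => /esym/eqP.
  by rewrite mulf_eq0 pnatr_eq0 /= => /eqP.
apply: cplxP; first exact: re.
have := re z ('i *: w); rewrite (formZr LB) conj_imag mulNr ReN Re_imul opprK.
exact.
Qed.

(** * Bundles with vanishing Hermitian form *)

Section Coordinates.
Context {R : realType} {m : nat}.
Local Notation C := (Cplx R).
Local Notation pt := 'rV[C]_(m + 1).

Lemma point_base (z : 'rV[C]_m) xi j : point z xi 0 (lshift 1 j) = z 0 j.
Proof. by rewrite /point row_mxEl. Qed.

Lemma point_fiber (z : 'rV[C]_m) xi j : point z xi 0 (rshift m j) = xi.
Proof. by rewrite /point row_mxEr mxE. Qed.

Lemma delta_fiber : delta_mx 0 (rshift m 0) = point 0 1 :> pt.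
Proof.
apply/rowP => i; rewrite mxE eqxx /=; case: (split_ordP i) => k ->.
  by rewrite point_base mxE eq_lrshift.
by rewrite point_fiber (ord1 k) eqxx.
Qed.

Lemma fiber_coordE (p : pt) : fiber_coord p = p 0 (rshift m 0).
Proof. by rewrite /fiber_coord mxE. Qed.

End Coordinates.

Section Trivial_form.
Context {R : realType} {m : nat}.
Local Notation C := (Cplx R).
Local Notation Re := complex.Re.
Local Notation Im := complex.Im.
Local Notation V := 'rV[C]_m.
Local Notation pt := 'rV[C]_(m + 1).
Context (Gam : set V) (H : V -> V -> C) (alpha : V -> C) (g : pt -> 'M[C]_(m + 1)).
Hypothesis GamL : lattice Gam.
Hypothesis LB : line_bundle_data Gam H alpha.
Hypothesis gX : kaehler_on_total_space Gam H alpha g.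
Hypothesis BI : BI_ge0 g.
Hypothesis H0 : forall z w, H z w = 0.
Let gK : kaehler_metric g. Proof. by case: gX. Qed.
Local Notation h := (fun p => invmx (g p)).
Local Notation ex := (point 0 1 : pt).

Lemma mult_trivial gam z : mult H alpha gam z = alpha gam.
Proof. by rewrite /mult !H0 !mulr0 addr0 cexp0 mulr1. Qed.

Lemma deck_jac_trivial gam z xi :
  deck_jac H alpha gam (point z xi) = block_mx 1%:M 0 0 (alpha gam)%:M.
Proof.
rewrite /deck_jac; congr block_mx.
  by apply/matrixP => i j; rewrite !mxE H0 !mulr0 mul0r.
by apply/matrixP => i j; rewrite !mxE mult_trivial !ord1 eqxx mulr1n.
Qed.

Lemma conorm_levi_flat x v p :
  (forall gam q, Gam gam -> conorm g x (deck H alpha gam q) = conorm g x q) ->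
  wder (row_mx v 0) (wbar (row_mx v 0) (conorm g x)) p = 0.
Proof.
move=> xinv; pose f := conorm g x.
have fS : csm f := csm_conorm gK _.
have fR q : f q = ofR (Re (f q)) := conorm_real gK _ q.
have [l lP] := lattice_cell GamL.
set z := lsubmx p; set xi := fiber_coord p.
pose e (j : bool) : pt := if j then row_mx v 0 else p.
pose chi (j : bool) : C -> C := if j then id else (fun=> 1).
have chiS j : csm (chi j) by case: j; [exact: csm_id|exact: csm_cst].
have chiH j u y : wbar u (chi j) y = 0 by case: j; [exact: wbar_id|exact: wbar_cst].
have cE t : \sum_j chi j t *: e j = point (z + t *: v) xi.
  rewrite big_bool /chi /e /= scale1r [p in LHS](pointE p) [RHS]point_sum [point (lsubmx p) _]point_sum.
  by rewrite scale_row_mx scaler0 addrA add_row_mx addr0 [z + _]addrC.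
have wE : \sum_j wder (1 : C) (chi j) 0 *: e j = row_mx v 0.
  by rewrite big_bool /chi /e /= wder_cst scale0r addr0 wder_id scale1r.
pose k := Re `|xi|.
have kE : `|xi| = ofR k := norm_real xi.
have [M MP] := bounded_cell l k (smooth_continuous (csm_Re fS)).
have fM t : Re (f (\sum_j chi j t *: e j)) <= M.
  rewrite cE; have [c [gam [cc gG ->]]] := lP (z + t *: v).
  have a1 := lb_unitary LB gG.
  have a0 : alpha gam != 0 by rewrite -normr_eq0 a1 oner_eq0.
  have -> : point (cell l c + gam) xi = deck H alpha gam (point (cell l c) (xi / alpha gam)).
    by rewrite deck_point mult_trivial mulrC divfK.
  rewrite /f xinv //.
  have xk : `|xi / alpha gam| <= ofR k by rewrite normf_div a1 divr1 kE.
  by apply: MP => //; [exact: Re_le_norm|exact: Im_le_norm].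
have := @psh_bounded_curve_levi R pt bool e chi chiS chiH f M fS fR
  (fun w p => conorm_levi_ge0 gK BI x w p) fM 0.
by rewrite /= wE cE scale0r addr0 -pointE.
Qed.

Lemma inv_metric_base_antiholo v p : mwbar (row_mx v 0) h p = 0.
Proof.
have base (x : V) : row_mx x 0 *m mwbar (row_mx v 0) h p = 0.
  apply: (conorm_levi_eq0 gK BI); apply: conorm_levi_flat => gam q gG.
  exact: (conorm_deck_base LB gX).
have fib : ex *m mwbar (row_mx v 0) h p = 0.
  apply: (conorm_levi_eq0 gK BI); apply: conorm_levi_flat => gam q gG.
  rewrite [in LHS](pointE q) deck_point (conorm_deck_fiber LB gX) //; last by move=> i; rewrite H0 mul0r.
  by rewrite mult_trivial (lb_unitary LB gG) expr1n mul1r -pointE.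
apply/row_matrixP => i; rewrite row0 rowE.
by rewrite (pointE (delta_mx 0 i)) point_sum mulmxDl -scalemxAl base fib scaler0 addr0.
Qed.

Lemma metric_base_const z xi : g (point z xi) = g (point 0 xi).
Proof.
have gS := metric_csm gK; have hS := inv_metric_csm gK.
have hU q : h q \in unitmx by rewrite unitmx_inv; exact: metric_unit.
have gE : (fun q => invmx (h q)) = g by apply/funext => q; exact: invmxK.
have bar0 v p : mwbar (row_mx v 0) g p = 0.
  rewrite -[X in mwbar _ X _]gE (mwbar_inv _ _ hS hU) inv_metric_base_antiholo.
  by rewrite mulmx0 mul0mx oppr0.
have der0 v p : mwder (row_mx v 0) g p = 0.
  rewrite (_ : g = fun q => adjmx (g q)); last by apply/funext => q; rewrite (kaehler_hermitian gK).
  by rewrite -(adjmx_mwbar _ _ gS) bar0; apply/matrixP => i j; rewrite adjmxE !mxE conjC0.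
apply/matrixP => i j; apply/esym/(cder0_const (f := fun q => g q i j)); first exact: gS.
move=> p; rewrite [point z xi]point_sum [point 0 xi]point_sum row_mx0 add0r addrK cder_wder.
have := congr1 (fun M : 'M[C]_(m + 1) => M i j) (der0 z p).
have := congr1 (fun M : 'M[C]_(m + 1) => M i j) (bar0 z p).
by rewrite !mxE => -> ->; rewrite addr0.
Qed.

Lemma metric_equivariance gam z xi : Gam gam ->
  let J := block_mx 1%:M 0 0 (alpha gam)%:M in
  g (point z xi) = J *m g (point (z + gam) (alpha gam * xi)) *m adjmx J.
Proof.
move=> gG J; have [_ /(_ _ gG (point z xi)) <-] := gX.
by rewrite /pullback (deck_jacobian LB) deck_point mult_trivial deck_jac_trivial.
Qed.

End Trivial_form.

Section Log_superharmonic.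
Context {R : realType}.
Local Notation C := (Cplx R).
Local Notation Re := complex.Re.
Local Notation Im := complex.Im.

Lemma dline_ln (V : normedModType C) (u : V -> R) v p : smooth u -> (forall x, 0 < u x) ->
  dline v (fun x => ln (u x)) p = dline v u p * (u p)^-1.
Proof.
move=> uS u0; apply: is_dlineP.
have := is_dline_comp (smooth_is_dline p v uS) (is_derive1_ln (u0 p)).
by move/is_derive_ext; apply => //; rewrite mulrC.
Qed.

Lemma dline2_ln (V : normedModType C) (u : V -> R) v p : smooth u -> (forall x, 0 < u x) ->
  dline v (dline v (fun x => ln (u x))) p =
  (u p * dline v (dline v u) p - dline v u p ^+ 2) / u p ^+ 2.
Proof.
move=> uS u0; have un0 x : u x != 0 by rewrite gt_eqF.
rewrite (_ : dline v (fun x => ln (u x)) = fun x => dline v u x * (u x)^-1); last first.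
  by apply/funext => x; rewrite dline_ln.
apply: is_dlineP.
have := is_dlineM (smooth_is_dline p v (smooth_dline v uS)) (is_dlineV (un0 p) (smooth_is_dline p v uS)).
by move/is_derive_ext; apply => //; field.
Qed.

Lemma ln_superharmonic (u : C -> R) : smooth u -> (forall x, 0 < u x) ->
  (forall x, 0 <= - wder (1 : C) (wbar (1 : C) (fun y => ofR (u y))) x +
     wder (1 : C) (fun y => ofR (u y)) x * (wder (1 : C) (fun y => ofR (u y)) x)^* * ofR (u x)^-1) ->
  superharmonic (fun x => ln (u x)).
Proof.
move=> uS u0 uL x; rewrite /laplacian !dline2_ln // -mulrDl.
rewrite pmulr_lle0 ?invr_gt0 ?exprn_gt0 //.
have := uL x; rewrite (levi_real (1 : C) x uS) imag_scale1 wderE !cder_ofR imag_scale1.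
set a := dline (1 : C) u x; set b := dline 'i u x.
set aa := dline (1 : C) (dline (1 : C) u) x; set bb := dline 'i (dline 'i u) x.
have -> : (ofR a - 'i * ofR b) / 2 * ((ofR a - 'i * ofR b) / 2)^* = ofR ((a ^+ 2 + b ^+ 2) / 4).
  rewrite rmorphM rmorphB rmorphM /= !conj_ofR conjV2 conj_imag.
  rewrite ofRM ofRD !ofRM fmorphV rmorph_nat.
  have alg (s t i : C) : i * i = -1 ->
      (s - i * t) / 2 * ((s - - i * t) / 2) = (s * s + t * t) / 4%:R.
    move=> ii; have -> : t * t = - (i * i) * (t * t) by rewrite ii opprK mul1r.
    by field.
  exact: (alg _ _ _ mul_imag).
rewrite -ofRM -ofRN -ofRD -ofR0 le_ofR -(pmulr_rge0 _ (u0 x)) => ineq.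
have -> : u x * aa - a ^+ 2 + (u x * bb - b ^+ 2) =
  - (4 * (u x * (- ((aa + bb) / 4) + (a ^+ 2 + b ^+ 2) / 4 * (u x)^-1))).
  by field; rewrite gt_eqF.
by rewrite oppr_le0 mulr_ge0.
Qed.

End Log_superharmonic.

Section Elliptic_structure.
Context {R : realType}.
Local Notation C := (Cplx R).
Local Notation Re := complex.Re.
Local Notation Im := complex.Im.
Local Notation V := 'rV[C]_1.
Local Notation pt := 'rV[C]_(1 + 1).
Context (Gam : set V) (H : V -> V -> C) (alpha : V -> C) (g : pt -> 'M[C]_(1 + 1)).
Hypothesis GamL : lattice Gam.
Hypothesis LB : line_bundle_data Gam H alpha.
Hypothesis gX : kaehler_on_total_space Gam H alpha g.
Hypothesis BI : BI_ge0 g.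
Hypothesis H0 : forall z w, H z w = 0.
Let gK : kaehler_metric g. Proof. by case: gX. Qed.
Local Notation ex := (point 0 1 : pt).
Local Notation i0 := (lshift 1 0 : 'I_(1 + 1)).
Local Notation i1 := (rshift 1 0 : 'I_(1 + 1)).

Lemma ord2_cases (P : 'I_(1 + 1) -> Prop) : P i0 -> P i1 -> forall i, P i.
Proof. by move=> P0 P1 i; case: (split_ordP i) => k ->; rewrite (ord1 k). Qed.

Lemma fiber_row k (M : 'M[C]_(1 + 1, k)) j : (ex *m M) 0 j = M i1 j.
Proof. by rewrite -delta_fiber -rowE mxE. Qed.

Lemma fiber_entry (M : 'M[C]_(1 + 1)) : (ex *m M *m adjmx ex) 0 0 = M i1 i1.
Proof.
rewrite -delta_fiber -rowE mxE big_split_ord !big_ord1 !adjmxE delta_fiber /=.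
by rewrite point_base point_fiber !mxE conjC0 conjC1 mulr0 add0r mulr1.
Qed.

Lemma rank_one_sumE (a b : C) (v w : pt) i j :
  (a *: (\matrix_(i, j) (v 0 i * (v 0 j)^*)) + b *: (\matrix_(i, j) (w 0 i * (w 0 j)^*))) i j =
  a * (v 0 i * (v 0 j)^*) + b * (w 0 i * (w 0 j)^*).
Proof. by rewrite !mxE. Qed.

Let G i j (x : C) : C := g (point 0 x) i j.

Lemma metric_slice p i j : g p i j = G i j (fiber_coord p).
Proof. by rewrite {1}(pointE p) (metric_base_const GamL LB gX BI H0). Qed.

Lemma fiber_line (x : C) : point 0 x = \sum_(j < 1) x *: ex :> pt.
Proof. by rewrite big_ord1 [LHS]point_sum row_mx0 add0r. Qed.

Let idS (i : 'I_1) : csm (fun t : C => t) := csm_id.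
Let idH (i : 'I_1) (v x : C) : wbar v (fun t : C => t) x = 0 := wbar_id v x.

Lemma slice_csm f : csm f -> csm (fun x => f (point 0 x : pt)).
Proof.
move=> fS; apply: (csm_ext (csm_ccompose (fun=> ex) idS fS)) => x.
by rewrite -fiber_line.
Qed.

Lemma wder_slice f (x : C) : csm f ->
  wder (1 : C) (fun x => f (point 0 x : pt)) x = wder ex f (point 0 x).
Proof.
move=> fS; have := wder_holo (fun=> ex) idS idH (1 : C) x fS.
rewrite /= -(fiber_line x) big_ord1 wder_id scale1r => <-.
by congr wder; apply/funext => y; rewrite fiber_line.
Qed.

Lemma wbar_slice f (x : C) : csm f ->
  wbar (1 : C) (fun x => f (point 0 x : pt)) x = wbar ex f (point 0 x).
Proof.
move=> fS; have := wbar_holo (fun=> ex) idS idH (1 : C) x fS.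
rewrite /= -(fiber_line x) big_ord1 wder_id scale1r => <-.
by congr wbar; apply/funext => y; rewrite fiber_line.
Qed.

Let gS := metric_csm gK.

Let GS i j : csm (G i j). Proof. exact: (slice_csm (gS i j)). Qed.

Let Gherm i j x : G i j x = (G j i x)^*.
Proof. by rewrite /G -{1}(kaehler_hermitian gK) adjmxE. Qed.

Lemma wder_base p i j : wder (delta_mx 0 i0) (fun q => g q i j) p = 0.
Proof.
rewrite (_ : (fun q => _) = fun q => G i j (fiber_coord q)); last first.
  by apply/funext => q; rewrite metric_slice.
have inv (t : C) : fiber_coord (p + t *: delta_mx 0 i0) = fiber_coord p.
  by rewrite !fiber_coordE !mxE eq_rlshift andbF mulr0 addr0.
have c0 (a : C) : cder (a *: delta_mx 0 i0) (fun q : pt => G i j (fiber_coord q)) p = 0.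
  rewrite -(cder_cst (G i j (fiber_coord p)) (0 : pt) p); apply: cder_congr_line => t.
  by rewrite scalerA inv.
by rewrite wderE c0 -[X in cder X _ _]scale1r c0 mulr0 subr0 mul0r.
Qed.

Lemma wder_row0 j x : wder (1 : C) (G i0 j) x = 0.
Proof.
rewrite (wder_slice _ (gS i0 j)) -delta_fiber -wirtE (kaehler_closed gK) wirtE.
exact: wder_base.
Qed.

Lemma wbar_col0 j x : wbar (1 : C) (G j i0) x = 0.
Proof.
rewrite (_ : G j i0 = fun y => (G i0 j y)^*); last by apply/funext => y; exact: Gherm.
by rewrite (wbar_conj _ _ (GS i0 j)) wder_row0 conjC0.
Qed.

Let K : R := Re (G i0 i0 0).

Let G00 x : G i0 i0 x = ofR K.
Proof.
have -> : G i0 i0 x = G i0 i0 0.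
  by apply: (cder0_const (GS _ _)) => y; rewrite cder_wder (wder1 _ _ (GS _ _)) (wbar1 _ _ (GS _ _))
    wder_row0 wbar_col0 !mulr0 addr0.
by apply: conj_real; rewrite -Gherm.
Qed.

Let phi x : C := (ofR K)^-1 * G i1 i0 x.
Let u x : R := Re (G i1 i1 x - ofR K * (phi x * (phi x)^*)).

Lemma hermitian_value x (a b : C) :
  (point (const_mx a) b *m g (point 0 x) *m adjmx (point (const_mx a) b)) 0 0 =
  a * G i0 i0 x * a^* + a * G i0 i1 x * b^* + b * G i1 i0 x * a^* + b * G i1 i1 x * b^*.
Proof.
rewrite mxE big_split_ord !big_ord1 !adjmxE point_base point_fiber.
rewrite !mxE !big_split_ord !big_ord1 point_base point_fiber !mxE.
by rewrite /G /=; ring.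
Qed.

Let K0 : 0 < K.
Proof.
have n0 : point (const_mx 1) 0 != 0 :> pt.
  by apply/negP => /eqP/rowP/(_ i0); rewrite point_base !mxE => /eqP; rewrite oner_eq0.
have := kaehler_posdef gK (point 0 0) n0.
by rewrite hermitian_value G00 conjC0 conjC1 !mul0r !mulr0 !addr0 mul1r mulr1 -ofR0 lt_ofR.
Qed.

Let Kc : ofR K != 0 :> C. Proof. by rewrite fmorph_eq0 gt_eqF. Qed.

Let G10 x : G i1 i0 x = ofR K * phi x. Proof. by rewrite /phi mulVKf. Qed.
Let G01 x : G i0 i1 x = ofR K * (phi x)^*.
Proof. by rewrite Gherm G10 rmorphM /= conj_ofR. Qed.

Let G11 x : G i1 i1 x = ofR K * (phi x * (phi x)^*) + ofR (u x).
Proof.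
rewrite /u -conj_real; first by rewrite addrCA subrr addr0.
rewrite rmorphB rmorphM /= conj_ofR -[(G _ _ _)^*]Gherm; congr (_ - _ * _).
by rewrite rmorphM /= conjCK mulrC.
Qed.

Let phiS : csm phi. Proof. exact: (csmZ _ (GS i1 i0)). Qed.
Let phiH x : wbar (1 : C) phi x = 0.
Proof. by rewrite (wbarZ _ _ _ (GS i1 i0)) wbar_col0 mulr0. Qed.

Let uS : smooth u.
Proof.
exact: (csm_Re (csmB (GS i1 i1) (csmZ (ofR K) (csmM phiS (csm_conj phiS))))).
Qed.

Let u0 x : 0 < u x.
Proof.
have n0 : point (const_mx (- phi x)) 1 != 0 :> pt.
  by apply/negP => /eqP/rowP/(_ i1); rewrite point_fiber !mxE => /eqP; rewrite oner_eq0.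
have := kaehler_posdef gK (point 0 x) n0.
rewrite hermitian_value G00 G01 G10 G11 conjC1 rmorphN -lt_ofR ofR0; congr (_ < _).
by move: (phi x) (phi x)^* (ofR K) (ofR (u x)) => a b k l; ring.
Qed.

Let uc : csm (fun x => ofR (u x)) := csm_ofR uS.

Lemma fiber_curvature x : bisectional g (point 0 x) ex ex =
  - wder (1 : C) (wbar (1 : C) (fun y => ofR (u y))) x +
     wder (1 : C) (fun y => ofR (u y)) x * (wder (1 : C) (fun y => ofR (u y)) x)^* * ofR (u x)^-1.
Proof.
set p := point 0 x.
have pcS := csm_conj phiS.
have wd j : wder (1 : C) (G i1 j) x = if j == i0 then ofR K * wder (1 : C) phi x else
  ofR K * (wder (1 : C) phi x * (phi x)^*) + wder (1 : C) (fun y => ofR (u y)) x.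
  move: j; apply: ord2_cases => /=.
    rewrite (_ : G i1 i0 = fun y => ofR K * phi y); last exact/funext.
    by rewrite (wderZ _ _ _ phiS).
  rewrite (_ : G i1 i1 = fun y => ofR K * (phi y * (phi y)^*) + ofR (u y)); last exact/funext.
  rewrite (wderD _ _ (csmZ _ (csmM phiS pcS)) uc) (wderZ _ _ _ (csmM phiS pcS)).
  by rewrite (wderM _ _ phiS pcS) (wder_conj _ _ phiS) phiH conjC0 mulr0 add0r.
have lev : wder (1 : C) (wbar (1 : C) (G i1 i1)) x = ofR K * (wder (1 : C) phi x * (wder (1 : C) phi x)^*)
    + wder (1 : C) (wbar (1 : C) (fun y => ofR (u y))) x.
  have wpS := csm_wder (1 : C) phiS.
  rewrite (_ : wbar (1 : C) (G i1 i1) =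
     fun y => ofR K * (phi y * (wder (1 : C) phi y)^*) + wbar (1 : C) (fun y => ofR (u y)) y).
    rewrite (wderD _ _ (csmZ _ (csmM phiS (csm_conj wpS))) (csm_wbar _ uc)).
    rewrite (wderZ _ _ _ (csmM phiS (csm_conj wpS))) (wderM _ _ phiS (csm_conj wpS)).
    rewrite (wder_conj _ _ wpS) -(wder_wbarC _ _ _ phiS).
    by rewrite (_ : wbar (1 : C) phi = fun=> 0) ?wder_cst ?conjC0 ?mulr0 ?add0r //; exact/funext.
  apply/funext => y; rewrite (_ : G i1 i1 = fun y => ofR K * (phi y * (phi y)^*) + ofR (u y)); last exact/funext.
  rewrite (wbarD _ _ (csmZ _ (csmM phiS pcS)) uc) (wbarZ _ _ _ (csmM phiS pcS)).
  by rewrite (wbarM _ _ phiS pcS) (wbar_conj _ _ phiS) phiH mul0r addr0.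
have wg i j : mwder ex g p i j = wder (1 : C) (G i j) x.
  by rewrite mxE (wder_slice _ (gS i j)).
have T1 : (ex *m mwder ex (mwbar ex g) p *m adjmx ex) 0 0 = wder (1 : C) (wbar (1 : C) (G i1 i1)) x.
  rewrite fiber_entry mxE -(wder_slice _ (mcsm_mwbar ex gS i1 i1)).
  by congr wder; apply/funext => z; rewrite mxE (wbar_slice _ (gS i1 i1)).
have Dxe (A B : 'M[C]_(1 + 1)) : (ex *m (- A + B) *m adjmx ex) 0 0 =
    - (ex *m A *m adjmx ex) 0 0 + (ex *m B *m adjmx ex) 0 0.
  by rewrite mulmxDr mulmxDl mulmxN mulNmx !mxE.
rewrite (bisectionalE gK) /curv Dxe T1 lev.
set y := ex *m mwder ex g p.
set d := wder (1 : C) (fun y => ofR (u y)) x; set f := wder (1 : C) phi x.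
pose X : pt := point (const_mx (f - phi x * d / ofR (u x))) (d / ofR (u x)).
have un : ofR (u x) != 0 :> C by rewrite fmorph_eq0 gt_eqF.
have y0 : y 0 i0 = ofR K * f by rewrite /y fiber_row wg wd.
have y1 : y 0 i1 = ofR K * (f * (phi x)^*) + d.
  by rewrite /y fiber_row wg wd eq_rlshift.
have alg1 (s b t c k : C) : c != 0 -> k * s = (s - b * t / c) * k + t / c * (k * b).
  by move=> c0; field.
have alg2 (s b b' t c k : C) : c != 0 ->
    k * (s * b') + t = (s - b * t / c) * (k * b') + t / c * (k * (b * b') + c).
  by move=> c0; field.
have alg3 (s s' b t t' c k : C) : c != 0 ->
    (s - b * t / c) * (k * s') + t / c * (k * (s' * b) + t') = k * (s * s') + t * t' * c^-1.
  by move=> c0; field.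
have yX : y = X *m g p.
  have e j : (X *m g p) 0 j =
      (f - phi x * d / ofR (u x)) * G i0 j x + d / ofR (u x) * G i1 j x.
    by rewrite mxE big_split_ord !big_ord1 /X point_base point_fiber mxE.
  apply/rowP; apply: ord2_cases; rewrite e ?y0 ?y1 ?G00 ?G10 ?G01 ?G11.
    exact: (alg1 _ _ _ _ _ un).
  exact: (alg2 _ _ _ _ _ _ un).
have bar : mwbar ex g p *m adjmx ex = adjmx y.
  rewrite /y adjmxM -(adjmxK (mwbar ex g p)) (adjmx_mwbar _ _ gS).
  by congr (adjmx (mwder ex _ p) *m _); apply/funext => q; rewrite (kaehler_hermitian gK).
have -> : ex *m (mwder ex g p *m invmx (g p) *m mwbar ex g p) *m adjmx ex = X *m adjmx y.
  have gen (A k B : 'M[C]_(1 + 1)) : ex *m (A *m k *m B) *m adjmx ex = (ex *m A) *m k *m (B *m adjmx ex).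
    by rewrite !mulmxA.
  by rewrite gen bar -/y {1}yX mulmxK //; exact: metric_unit.
rewrite mxE big_split_ord !big_ord1 !adjmxE y0 y1 /X point_base point_fiber mxE.
have conj_sum (k : R) (s b t : C) : (ofR k * (s * b^*) + t)^* = ofR k * (s^* * b) + t^*.
  by rewrite rmorphD !rmorphM /= conjCK conj_ofR.
have conj_prod (k : R) (s : C) : (ofR k * s)^* = ofR k * s^* by rewrite rmorphM /= conj_ofR.
rewrite conj_sum conj_prod /=.
rewrite (alg3 _ _ _ _ _ _ _ un) fmorphV.
by move: (wder _ _ _) (d * d^* / _) (ofR K * _) => r1 r2 r3; ring.
Qed.

Lemma elliptic_structure : exists (K : R) (phi : C -> C) (u : C -> R),
  [/\ 0 < K, csm phi /\ (forall x, wbar (1 : C) phi x = 0),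
      smooth u /\ (forall x, 0 < u x), superharmonic (fun x => ln (u x)) &
      (forall gam x, Gam gam -> phi (alpha gam * x) * alpha gam = phi x /\ u (alpha gam * x) = u x) /\
      forall p, let a := point (const_mx 1) (phi (fiber_coord p)) in
        g p = ofR K *: (\matrix_(i, j) (a 0 i * (a 0 j)^*)) +
              ofR (u (fiber_coord p)) *: (\matrix_(i, j) (ex 0 i * (ex 0 j)^*))].
Proof.
exists K, phi, u; split; [exact: K0|by split|by split| |split].
- apply: ln_superharmonic => // x.
  by have := BI (point 0 x) ex ex; rewrite fiber_curvature.
- move=> gam x gG.
  have a1 := lb_unitary LB gG; set a := alpha gam.
  have aa : a * a^* = 1 by rewrite -normCK a1 expr1n.
  have := metric_equivariance LB gX H0 0 x gG; rewrite -/a /= add0r.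
  set J := block_mx _ _ _ _; rewrite (pointE (point gam _)) (metric_base_const GamL LB gX BI H0).
  rewrite /fiber_coord /point row_mxKr mxE -/(point _ _) -/(point _ _) => e.
  have J00 : J i0 i0 = 1 by rewrite block_mxEul mxE.
  have J01 : J i0 i1 = 0 by rewrite block_mxEur mxE.
  have J10 : J i1 i0 = 0 by rewrite block_mxEdl mxE.
  have J11 : J i1 i1 = a by rewrite block_mxEdr mxE.
  have ent (A : 'M[C]_(1 + 1)) j : (J *m A *m adjmx J) i1 j = a * (A i1 i0 * (J j i0)^* + A i1 i1 * (J j i1)^*).
    rewrite mxE big_split_ord !big_ord1 !adjmxE.
    rewrite !mxE !big_split_ord !big_ord1 J10 J11 /=; ring.
  have E j := congr1 (fun A : 'M[C]_(1 + 1) => A i1 j) e.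
  have phiE : phi (a * x) * a = phi x.
    apply: (mulfI Kc); have := E i0; rewrite ent J00 J01 conjC0 conjC1 mulr0 mulr1 addr0.
    by rewrite -!/(G _ _ _) !G10 => ->; ring.
  split=> //; have := E i1; rewrite ent J10 J11 conjC0 mulr0 add0r -!/(G _ _ _) !G11 -phiE.
  move: (phi _) (u _) (u _) aa => b c d aa'; rewrite !rmorphM /= => f.
  apply: (fmorph_inj (@ofR R)); apply: (addrI (ofR K * (b * a * (b^* * a^*)))).
  rewrite /= [RHS]f.
  have -> : a * ((ofR K * (b * b^*) + ofR c) * a^*) =
    ofR K * (b * a * (b^* * a^*)) + a * a^* * ofR c by ring.
  by rewrite aa' mul1r.
- move=> p a; apply/matrixP; apply: ord2_cases; apply: ord2_cases.
  all: rewrite rank_one_sumE [LHS]metric_slice ?G00 ?G01 ?G10 ?G11 /a ?point_base ?point_fiber ?mxE.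
  all: rewrite ?conjC0 ?conjC1; ring.
Qed.
End Elliptic_structure.

(** * Primitives and roots *)

Section Homothety.
Context {R : realType}.
Local Notation C := (Cplx R).
Variables (f : C -> C) (a : C).
Hypothesis fS : csm f.

Let compE (z : C) : f (z * a) = f (\sum_(j < 1) z *: a).
Proof. by rewrite big_ord1. Qed.

Let idS (i : 'I_1) : csm (fun t : C => t) := csm_id.
Let idH (i : 'I_1) (v x : C) : wbar v (fun t : C => t) x = 0 := wbar_id v x.

Lemma csm_mulr : csm (fun z : C => f (z * a)).
Proof. by apply: (csm_ext (csm_ccompose (fun=> a) idS fS)) => z; rewrite compE. Qed.

Lemma wder_mulr (z : C) : wder (1 : C) (fun z : C => f (z * a)) z = a * wder (1 : C) f (z * a).
Proof.
rewrite (_ : (fun z : C => f (z * a)) = (fun z => f (\sum_(j < 1) z *: a))); last exact/funext.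
rewrite (wder_holo (fun=> a) idS idH _ _ fS) !big_ord1 wder_id.
by rewrite [(1 : C) *: a]mul1r (wder1 _ _ fS).
Qed.

Lemma wbar_mulr (z : C) : (forall x, wbar (1 : C) f x = 0) ->
  wbar (1 : C) (fun z : C => f (z * a)) z = 0.
Proof.
move=> fH; rewrite (_ : (fun z : C => f (z * a)) = (fun z => f (\sum_(j < 1) z *: a))); last exact/funext.
by rewrite (wbar_holo (fun=> a) idS idH _ _ fS) !big_ord1 (wbar1 _ _ fS) fH mulr0.
Qed.
End Homothety.

Section Primitive.
Context {R : realType}.
Local Notation C := (Cplx R).
Local Notation Re := complex.Re.
Local Notation Im := complex.Im.
Variable phi : C -> C.
Hypothesis phiS : csm phi.
Hypothesis phiH : forall x, wbar (1 : C) phi x = 0.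
Let psi (y : C) : C := phi y + y * wder (1 : C) phi y.

Let psiS : csm psi. Proof. exact: (csmD phiS (csmM csm_id (csm_wder _ phiS))). Qed.

Let P (c a z : C) : C := c * (z * phi (z * a)).

Let phiaS (a : C) : csm (fun z : C => phi (z * a)) := csm_mulr a phiS.

Let PS c a : csm (P c a).
Proof. exact: (csmZ c (csmM csm_id (phiaS a))). Qed.

Let P_cder c a z v : is_cder (P c a) z v (v * (c * psi (z * a))).
Proof.
have := csm_is_cder z v (PS c a); move/is_cder_ext; apply => //.
have da : cder v (fun z : C => phi (z * a)) z = v * (a * wder (1 : C) phi (z * a)).
  by rewrite (holo_cder _ _ (phiaS a)) ?(wder_mulr a phiS) // => y; exact: wbar_mulr.
rewrite (cderZ _ _ _ (csmM csm_id (phiaS a))) (cderM _ _ csm_id (phiaS a)) cder_id da /psi.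
by move: (phi _) (wder _ _ _) => s t; ring.
Qed.

Let part (c x : C) : R := \int[lebesgue_measure]_(t in `[0%R, 1%R]) Re (P c (ofR t) x).

(* Differentiating t |-> Re (c x phi(t x)) in x along v gives the derivative of *)
(* t |-> Re (c v t phi(t x)), so that the integral over [0, 1] is explicit.     *)
Let part_derive (c x v : C) : is_dline (part c) x v (Re (c * (v * phi x))).
Proof.
pose f (s t : R) : R := Re (P c (ofR t) (x + ofR s *: v)).
have fD (s t : R) : is_derive s 1 (fun s : R => f s t) (Re (v * (c * psi ((x + ofR s *: v) * ofR t)))).
  have := is_derive_line v x s (smooth_line_derivable (csm_Re (PS c (ofR t)))).
  move/is_derive_ext; apply => //; apply: is_dlineP.
  by case: (P_cder c (ofR t) (x + ofR s *: v) v).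
have f1 s t : partial1of2 f s t = Re (v * (c * psi ((x + ofR s *: v) * ofR t))).
  by rewrite partial1of2E; have [_ ->] := fD s t.
have fint s : lebesgue_measure.-integrable `[0%R, 1%R] (EFin \o f s).
  apply: (@continuous_compact_integrable R (f s)); first exact: segment_compact.
  apply: continuous_subspaceT => t; apply: (@cvg_Re _ _ (nbhs t)); set z := x + _.
  apply: (@cvgM _ _ (nbhs t)); first exact: cvg_cst.
  apply: (@cvgM _ _ (nbhs t)); first exact: cvg_cst.
  apply: (@continuous_comp _ _ _ (fun t : R => z * ofR t) phi); last exact: (csm_continuous phiS).
  by apply: (@cvgM _ _ (nbhs t)); [exact: cvg_cst|exact: continuous_ofR].
pose k := Re `|x| + Re `|v|.
have k0 : 0 <= k by rewrite -le_ofR ofRD -!norm_real addr_ge0.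
have [M MP] : exists M, forall y : C, `|y| <= ofR k -> `|Re (v * (c * psi y))| <= M.
  pose D := [set y : C | `|Re y| <= k /\ `|Im y| <= k].
  have D0 : D !=set0 by exists 0; split; rewrite /= normr0.
  pose N (y : C) : R := `|Re (v * (c * psi y))|.
  have NS : csm (fun y => v * (c * psi y)) := csmZ v (csmZ c psiS).
  have Nc : {within D, continuous N}.
    apply: continuous_subspaceT => y; apply: (@cvg_norm _ _ _ (nbhs y)).
    by apply: (@cvg_Re _ _ (nbhs y)); exact: (csm_continuous NS).
  have [y _ yP] := compact_EVT_max D0 (@compact_box R k) Nc.
  exists (N y) => z zk; apply: yP; rewrite inE; split; [exact: Re_le_norm|exact: Im_le_norm].
have M0 : 0 <= M by apply: le_trans (MP 0 _) => //; rewrite normr0 -ofR0 le_ofR.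
have bnd s t : `]-1, 1[%classic s -> `[0, 1]%classic t -> `|partial1of2 f s t| <= M.
  move=> s1 t1; rewrite f1; apply: MP.
  move: s1 t1; rewrite /= !in_itv /= => /andP[s1 s2] /andP[t1 t2].
  rewrite ofRD -!norm_real normrM normc_ofR (ger0_norm t1).
  apply: (@le_trans _ _ `|x + ofR s *: v|); first by rewrite ler_piMr // -ofR1 le_ofR.
  rewrite (le_trans (ler_normD _ _)) // lerD2l normrM normc_ofR ler_piMl // -ofR1 le_ofR.
  by rewrite ler_norml (ltW s1) (ltW s2).
have I0 : `]-1, 1[%classic (0 : R) by rewrite /= in_itv /= ltrN10 ltr01.
have iM : lebesgue_measure.-integrable `[0%R, 1%R]%classic (EFin \o cst M).
  apply: (@continuous_compact_integrable R (cst M)); first exact: segment_compact.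
  by apply: continuous_subspaceT => t; exact: cvg_cst.
have := @cvg_differentiation_under_integral R _ _ lebesgue_measure f `[0%R, 1%R]%classic
  (measurable_itv _) 0 (-1) 1 I0 (fun s _ => fint s) (fun s t _ _ => @ex_derive _ _ _ _ _ _ _ (fD s t))
  (cst M) (fun=> M0) iM bnd.
have -> : \int[lebesgue_measure]_(t in `[0%R, 1%R]) partial1of2 f 0 t = Re (c * (v * phi x)).
  pose F (t : R) : R := Re (P (c * v) x (0 + ofR t *: (1 : C))).
  have FD (t : R) : is_derive t 1 F (partial1of2 f 0 t).
    have := is_derive_line (1 : C) 0 t (smooth_line_derivable (csm_Re (PS (c * v) x))).
    move/is_derive_ext; apply => //; apply: is_dlineP.
    have [h _] := P_cder (c * v) x (0 + ofR t *: (1 : C)) 1.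
    move/is_derive_ext: h; apply => //.
    rewrite f1 ofR0 scale0r addr0 add0r [_ *: 1]mulr1 [x * _]mulrC mul1r.
    by congr (Re _); ring.
  have Fc : continuous F.
    by move=> t; apply/differentiable_continuous/derivable1_diffP; case: (FD t).
  have dc : continuous (partial1of2 f 0).
    rewrite (_ : partial1of2 f 0 = fun t => Re (v * (c * psi ((x + ofR 0 *: v) * ofR t)))); last first.
      by apply/funext => t; rewrite f1.
    move=> t; apply: (@cvg_Re _ _ (nbhs t)).
    apply: (@cvgM _ _ (nbhs t)); first exact: cvg_cst.
    apply: (@cvgM _ _ (nbhs t)); first exact: cvg_cst.
    apply: (@continuous_comp _ _ _ (fun t : R => (x + ofR 0 *: v) * ofR t) psi); last exact: (csm_continuous psiS).
    by apply: (@cvgM _ _ (nbhs t)); [exact: cvg_cst|exact: continuous_ofR].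
  rewrite /Rintegral (continuous_FTC2 (F := F) ltr01); first last.
  - by move=> t _; rewrite derive1E; case: (FD t).
  - split; [by move=> t _; case: (FD t)|exact: cvg_at_right_filter (Fc 0)|exact: cvg_at_left_filter (Fc 1)].
  - exact: continuous_subspaceT.
  rewrite /= /F /P ofR0 ofR1 scale0r scale1r !add0r mul1r mul0r mulr0 subr0 mul1r.
  by rewrite mulrA.
move=> H; apply: cvg_is_derive.
have E (s : R) : s^-1 * (part c (x + ofR s *: v) - part c (x + ofR 0 *: v)) =
    s^-1 *: (\int[lebesgue_measure]_(y in `[0%R, 1%R]) f (s + 0) y -
      \int[lebesgue_measure]_(y in `[0%R, 1%R]) f 0 y) by rewrite addr0.
by rewrite (funext E).
Qed.

Definition primitive (x : C) : C := ofR (part 1 x) + 'i * ofR (part (- 'i) x).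

Lemma is_cder_primitive x v : is_cder primitive x v (v * phi x).
Proof.
have E y : Re (primitive y) = part 1 y.
  by rewrite ReD Re_imul /= oppr0 addr0.
have F y : Im (primitive y) = part (- 'i) y.
  by rewrite ImD Im_imul /= add0r.
split.
  rewrite (_ : (fun y => _) = part 1); last exact/funext.
  by have := part_derive 1 x v; rewrite mul1r.
rewrite (_ : (fun y => _) = part (- 'i)); last exact/funext.
by have := part_derive (- 'i) x v; rewrite mulNr ReN Re_imul opprK.
Qed.

Lemma primitive_invariant (a x : C) : (forall y, phi (a * y) * a = phi y) ->
  primitive (a * x) = primitive x.
Proof.
move=> aP; have e c : part c (a * x) = part c x.
  rewrite /part; congr Rintegral; apply/funext => t; congr (Re (_ * _)).
  have -> : a * x * ofR t = a * (x * ofR t) by ring.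
  by rewrite -(aP (x * ofR t)); move: (phi _) => b; ring.
by rewrite /primitive !e.
Qed.

End Primitive.

Lemma prod_unity_root (F : fieldType) k (z r : F) : k.-primitive_root z ->
  \prod_(0 <= i < k) (1 - r * z ^+ i) = 1 - r ^+ k.
Proof.
move=> P; have [->|r0] := eqVneq r 0.
  by rewrite expr0n gtn_eqF ?(prim_order_gt0 P) // subr0 big1 // => i _; rewrite mul0r subr0.
have := congr1 (fun p : {poly F} => p.[r^-1]) (factor_Xn_sub_1 P).
rewrite horner_prod !hornerE => e.
have -> : 1 - r ^+ k = r ^+ k * (r^-1 ^+ k - 1).
  by rewrite mulrBr mulr1 exprVn divff // expf_eq0 (negbTE r0) andbF.
rewrite -e -[k in r ^+ k](subn0 k) -prodr_const_nat -big_split /=.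
by apply: eq_bigr => i _; rewrite !hornerE mulrBr divff.
Qed.

Section Roots.
Context {R : realType}.
Local Notation C := (Cplx R).
Local Notation Re := complex.Re.
Local Notation Im := complex.Im.

Lemma expi_natmul (t : R) n : expi t ^+ n = expi (t *+ n) :> C.
Proof.
elim: n => [|n IH]; first by rewrite mulr0n expi0.
by rewrite exprS IH mulrS expiD.
Qed.

Lemma expi_neq1 (t : R) : 0 < t < 2 * pi -> expi t != 1 :> C.
Proof.
move=> /andP[t0 t1]; apply/negP => /eqP/(congr1 (fun x : C => Re x)) /= e.
have s0 : 0 < sin (t / 2).
  by apply: sin_gt0_pi; rewrite divr_gt0 //= ltr_pdivrMr // mulrC.
have := cos_mulr2n (t / 2); rewrite -[_ *+ 2 in X in cos X]mulr_natr divfK ?pnatr_eq0 // e cos2sin2.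
have : 0 < sin (t / 2) ^+ 2 by rewrite exprn_gt0.
by move: (_ ^+ 2) => s; lra.
Qed.

Lemma expi_prim_root k : (0 < k)%N -> k.-primitive_root (expi (2 * pi / k%:R) : C).
Proof.
move=> k0; have kn : k%:R != 0 :> R by rewrite pnatr_eq0 -lt0n.
set z := expi _.
have zk : z ^+ k = 1.
  rewrite expi_natmul -[_ *+ k]mulr_natr divfK // /expi mulr_natl cos2pi sin2pi.
  by apply: cplxP.
have [j jP jk] := prim_order_exists k0 zk.
suff -> : k = j by [].
apply/eqP; rewrite eqn_leq (dvdn_leq k0 jk) andbT leqNgt; apply/negP => jlt; have := prim_expr_order jP.
rewrite expi_natmul => /eqP; apply/negP/expi_neq1.
have j0 : 0 < j%:R :> R by rewrite ltr0n (prim_order_gt0 jP).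
have kp : 0 < k%:R :> R by rewrite ltr0n.
have tp : 0 < 2 * pi :> R by rewrite mulr_gt0 // pi_gt0.
rewrite -[_ *+ j]mulr_natr; apply/andP; split; first by rewrite mulr_gt0 // divr_gt0.
by rewrite mulrAC ltr_pdivrMr // ltr_pM2l // ltr_nat.
Qed.

(* With r^k = w / x0^k, the product over the k-th roots of unity of the         *)
(* |1 - r zeta^i| is |1 - r^k|; take the smallest factor.                       *)
Lemma near_root k (w0 : C) x0 : (0 < k)%N -> x0 ^+ k = w0 ->
  forall w, exists x, x ^+ k = w /\ `|x - x0| ^+ k <= `|w - w0|.
Proof.
move=> k0 <- w; have [x00|x00] := eqVneq x0 0.
  exists (k.-root w); rewrite rootCK // x00 expr0n gtn_eqF // !subr0 -normrX rootCK //.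
have P := expi_prim_root k0; set z := expi _ in P.
pose r := k.-root (w / x0 ^+ k).
have rk : r ^+ k = w / x0 ^+ k by rewrite rootCK.
have zk := prim_expr_order P.
have x0k : x0 ^+ k != 0 by rewrite expf_eq0 (negbTE x00) andbF.
have xk i : (x0 * (r * z ^+ i)) ^+ k = w.
  by rewrite !exprMn rk -exprM mulnC exprM zk expr1n mulr1 mulrC divfK.
have prod := prod_unity_root r P.
have [[i /andP[ik iP]]|no] := pselect (exists i, (i < k)%N && (`|1 - r * z ^+ i| ^+ k <= `|1 - r ^+ k|)).
  exists (x0 * (r * z ^+ i)); split; first exact: xk.
  rewrite -[X in _ - X]mulr1 -mulrBr normrM exprMn distrC.
  have -> : w - x0 ^+ k = x0 ^+ k * (r ^+ k - 1) by rewrite rk mulrBr mulr1 mulrC divfK.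
  by rewrite normrM -normrX ler_pM2l ?normr_gt0 // [X in _ <= X]distrC.
exfalso; have lt i : (i < k)%N -> `|1 - r ^+ k| < `|1 - r * z ^+ i| ^+ k.
  move=> ik; rewrite real_ltNge ?realX ?normr_real //.
  by apply/negP => le; apply: no; exists i; rewrite ik.
have : `|1 - r ^+ k| ^+ k < \prod_(0 <= i < k) `|1 - r * z ^+ i| ^+ k.
  rewrite -[X in _ ^+ X](subn0 k) -prodr_const_nat.
  apply: ltr_prod_nat => // i /andP[_ ik]; rewrite normr_ge0; exact: lt.
by rewrite prodrXl -normr_prod prod ltxx.
Qed.

Section Angles.
Variables (P : R -> Prop).
Hypothesis P0 : P 0.
Hypothesis PB : forall s t, P s -> P t -> P (s - t).

Lemma angle_opp t : P t -> P (- t).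
Proof. by move=> Pt; rewrite -sub0r; exact: PB. Qed.

Lemma angle_add s t : P s -> P t -> P (s + t).
Proof. by move=> Ps Pt; rewrite -[t]opprK; exact/PB/angle_opp. Qed.

Lemma angle_mulz (n : int) t : P t -> P (n%:~R * t).
Proof.
move=> Pt; have nat (j : nat) : P (j%:R * t).
  elim: j => [|j IH]; first by rewrite mul0r.
  by rewrite mulrSr mulrDl mul1r; exact: angle_add.
case: n => j; first exact: nat.
by rewrite NegzE mulrNz mulNr; apply/angle_opp/nat.
Qed.

Lemma angle_bezout (k : nat) (p q : int) : (0 < k)%N ->
  (forall j, [/\ (0 < j)%N, j%:R * (p%:~R / k%:R) \is a @Num.int R & j%:R * (q%:~R / k%:R) \is a @Num.int R] -> (k <= j)%N) ->
  P 1 -> P (p%:~R / k%:R) -> P (q%:~R / k%:R) -> P (k%:R^-1).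
Proof.
move=> k0 kmin P1 Pp Pq.
have kn : k%:R != 0 :> R by rewrite pnatr_eq0 -lt0n.
pose d := gcdz (gcdz p q) k.
have d1 : d = 1.
  have /dvdzP[c ck] : (d %| k%:Z)%Z by exact: dvdz_gcdr.
  have /dvdzP[p' pd] : (d %| p)%Z by exact: dvdz_trans (dvdz_gcdl _ _) (dvdz_gcdl _ _).
  have /dvdzP[q' qd] : (d %| q)%Z by exact: dvdz_trans (dvdz_gcdl _ _) (dvdz_gcdr _ _).
  have [d' dE] : exists d' : nat, d = d' by exists (gcdn `|gcdz p q| `|k|).
  have d0 : (0 < d')%N.
    by rewrite lt0n; apply/eqP => d0; move: ck; rewrite dE d0 mulr0 => -[k00]; rewrite k00 in k0.
  have c0 : 0 < c by rewrite -(pmulr_lgt0 (x := d)) ?dE // -dE -ck.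
  have [c' cE] : exists c' : nat, c = c' by exists `|c|%N; rewrite gtz0_abs.
  have kE : k = (c' * d')%N by move: ck; rewrite cE dE -PoszM => -[].
  have kc : (k <= c')%N.
    have kR : k%:R = c'%:R * d'%:R :> R by rewrite kE natrM.
    have cn : c'%:R != 0 :> R by apply: contra kn => /eqP c00; rewrite kR c00 mul0r.
    have dn : d'%:R != 0 :> R by rewrite pnatr_eq0 -lt0n.
    apply: kmin; split.
    - by move: c0; rewrite cE.
    - apply/intrP; exists p'; rewrite pd dE rmorphM /= kR -[(Posz d')%:~R]/(d'%:R).
      by field; rewrite ?cn ?dn.
    - apply/intrP; exists q'; rewrite qd dE rmorphM /= kR -[(Posz d')%:~R]/(d'%:R).
      by field; rewrite ?cn ?dn.
  rewrite dE; congr Posz; apply/eqP; rewrite eqn_leq d0 andbT.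
  by move: kc; rewrite kE -{2}(muln1 c') leq_pmul2l //; move: c0; rewrite cE.
have [a [b e1]] := Bezoutz (gcdz p q) k; have [a' [b' e2]] := Bezoutz p q.
have -> : k%:R^-1 = a%:~R * (a'%:~R * (p%:~R / k%:R) + b'%:~R * (q%:~R / k%:R)) + b%:~R * 1 :> R.
  apply: (mulfI kn); rewrite divff //.
  have : ((a * (a' * p + b' * q) + b * k)%:~R : R) = 1 by rewrite e2 e1 -/d d1.
  rewrite !(rmorphD, rmorphM) /= => e3; rewrite -[LHS]e3.
  by field.
by apply: angle_add; apply: angle_mulz => //; apply: angle_add; exact: angle_mulz.
Qed.

Lemma angle_dense t0 : irrational t0 -> P 1 -> P t0 ->
  forall t e : R, 0 < e -> exists2 s, P s & `|t - s| < e.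
Proof.
move=> t0irr P1 Pt0.
pose n (s t : R) : R := (Num.floor (t / s))%:~R.
have nP s t : P s -> P t -> P (t - n s t * s) by move=> Ps Pt; apply: PB => //; exact: angle_mulz.
have nb s t : 0 < s -> 0 <= t - n s t * s < s.
  move=> s0; have := floor_itv (t / s); rewrite rmorphD /= -/(n s t).
  move: (n s t) => m /andP[h1 h2].
  by rewrite subr_ge0 -ler_pdivlMr // h1 ltrBlDr -[X in X + _]mul1r -mulrDl -ltr_pdivrMr // addrC.
suff small (e : R) : 0 < e -> exists2 s, P s & 0 < s < e.
  move=> t e /small[s Ps /andP[s0 se]]; exists (n s t * s); first exact: angle_mulz.
  by have /andP[h1 h2] := nb s t s0; rewrite ger0_norm // (lt_trans h2).
move=> e0; apply: contrapT => no.
pose E : set R := [set s | P s /\ 0 < s].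
have Ee s : E s -> e <= s.
  by move=> [Ps s0]; rewrite leNgt; apply/negP => se; apply: no; exists s; rewrite ?s0.
have Ei : has_inf E by split; [exists 1; split|exists e; exact: Ee].
have [s [Ps s0] sa] := inf_adherent e0 Ei.
have smin s' : E s' -> s <= s'.
  move=> [Ps' s'0]; rewrite leNgt; apply/negP => ss'.
  have h1 : e <= s - s' by apply: Ee; split; [exact: PB|rewrite subr_gt0].
  have h2 : inf E <= s' by apply: ge_inf; [exact: Ei.2|split].
  by move: h1 h2 sa; move: (inf E) => i; lra.
have mult t : P t -> t = n s t * s.
  move=> Pt; apply/eqP; rewrite -subr_eq0; apply/eqP.
  have /andP[h1 h2] := nb s t s0.
  apply: contrapT => /eqP h3; have : E (t - n s t * s).
    by split; [exact: nP|rewrite lt_neqAle eq_sym h3].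
  by move=> /smin; rewrite leNgt h2.
apply: t0irr; exists ((Num.floor (t0 / s))%:~R / (Num.floor (1 / s))%:~R : rat) => //.
rewrite fmorph_div /= !ratr_int -/(n s t0) -/(n s 1).
have n1 : n s 1 != 0.
  by apply/negP => /eqP n1; have := mult _ P1; rewrite n1 mul0r => /eqP; rewrite oner_eq0.
have sE : (n s 1)^-1 = s by apply: (mulfI n1); rewrite divff //; exact: mult.
by rewrite sE -(mult _ Pt0).
Qed.

End Angles.

Lemma continuous_expi : continuous (fun t : R => expi t : C).
Proof.
move=> t; apply: (@cvg_cplx _ _ (nbhs t)); [exact: continuous_cos|exact: continuous_sin].
Qed.

Lemma polar (x : C) : exists t, x = `|x| * expi t.
Proof.
have [->|x0] := eqVneq x 0; first by exists 0; rewrite normr0 mul0r.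
have n0 : `|x| != 0 by rewrite normr_eq0.
pose y := x / `|x|; have y1 : `|y| = 1 by rewrite normf_div normr_id divff.
have [t yt] : exists t, y = expi t.
  have sq : Re y ^+ 2 + Im y ^+ 2 = 1.
    have := congr1 (fun x : C => Re (x ^+ 2)) y1.
    rewrite normCK expr1n ReM Re_conj Im_conj /= => <-; ring.
  have b : -1 <= Re y <= 1.
    by rewrite -ler_norml; apply: Re_le_norm; rewrite y1.
  have s : Num.sqrt (1 - Re y ^+ 2) = `|Im y| by rewrite -sq addrAC subrr add0r sqrtr_sqr.
  have [i0|i0] := leP 0 (Im y).
    exists (acos (Re y)); apply: cplxP => /=; first by rewrite acosK // in_itv.
    by rewrite sin_acos // s ger0_norm.
  exists (- acos (Re y)); apply: cplxP => /=; first by rewrite cosN acosK // in_itv.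
  by rewrite sinN sin_acos // s ltr0_norm // opprK.
by exists t; rewrite -yt /y mulrC divfK.
Qed.

Lemma closed_property (F G : R -> C) (P : R -> Prop) : continuous F -> continuous G ->
  (forall t e : R, 0 < e -> exists2 s, P s & `|t - s| < e) ->
  (forall s, P s -> F s = G s) -> forall t, F t = G t.
Proof.
move=> Fc Gc dens FG t; have [//|] := eqVneq (F t) (G t); rewrite -subr_eq0 => D0.
have dc : (fun t => F t - G t) @ t --> F t - G t.
  by apply: (@cvgB _ _ _ (nbhs t)); [exact: Fc|exact: Gc].
have /cvgrPdist_lt/(_ `|F t - G t|) := dc; rewrite normr_gt0 => /(_ D0)/nbhs_ballP[e /= e0 eP]; exfalso.
have [s Ps ts] := dens t e e0.
by have := eP s ts; rewrite /= (FG s Ps) subrr subr0 ltxx.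
Qed.

End Roots.

Section Descent.
Context {R : realType}.
Local Notation C := (Cplx R).
Local Notation Re := complex.Re.
Local Notation Im := complex.Im.

Lemma is_cder_exp n (x v : C) : is_cder (fun y : C => y ^+ n.+1) x v (v * (n.+1%:R * x ^+ n)).
Proof.
elim: n => [|n IH]; first by rewrite expr0 !mulr1; exact: is_cder_id.
have := is_cderM (is_cder_id x v) IH; move/is_cder_ext; apply => [y|]; first by rewrite [RHS]exprS.
by rewrite [x ^+ n.+1]exprS; move: (x ^+ n) => z; ring.
Qed.

Lemma csm_exp n : csm (fun y : C => y ^+ n).
Proof.
elim: n => [|n IH]; first exact: csm_cst.
by apply: (csm_ext (csmM csm_id IH)) => y; rewrite exprS.
Qed.

Definition asymptotic (f : C -> C) m c := forall e : R, 0 < e -> exists2 r : R, 0 < r &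
  forall x, `|x| < ofR r -> `|f x - c * x ^+ m| <= ofR e * `|x| ^+ m.

Lemma asymptotic_primitive (f f' : C -> C) m c : (forall x v, is_cder f x v (v * f' x)) ->
  f 0 = 0 -> asymptotic f' m c -> asymptotic f m.+1 (c / m.+1%:R).
Proof.
move=> fD f0 fc e e0; have e2 : 0 < e / 2 by rewrite divr_gt0.
have [r r0 rP] := fc _ e2; exists r => // x xr.
have mn : m.+1%:R != 0 :> C by rewrite pnatr_eq0.
have GD y v : is_cder (fun y => f y + - (c / m.+1%:R) * y ^+ m.+1) y v (v * (f' y - c * y ^+ m)).
  have := is_cderD (fD y v) (is_cderM (is_cder_cst (- (c / m.+1%:R)) y v) (is_cder_exp m y v)).
  move/is_cder_ext; apply => //; move: (y ^+ m) mn => z mn'; field.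
  by [].
have nx := norm_real x; set N := Re `|x| in nx.
have close (t : R) : `|t| <= 1 -> `|f' (0 + ofR t * x) - c * (0 + ofR t * x) ^+ m| <= ofR (e / 2 * N ^+ m).
  move=> t1; rewrite add0r.
  have tx : `|ofR t * x| <= `|x| by rewrite normrM normc_ofR ler_piMl // -ofR1 le_ofR.
  rewrite (le_trans (rP _ (le_lt_trans tx xr))) // [in leRHS]ofRM ofRX -nx.
  by rewrite ler_wpM2l ?lerXn2r ?nnegrE ?normr_ge0 // -ofR0 le_ofR ltW.
have := mean_value GD close; rewrite add0r f0 expr0n mulr0 addr0 subr0 mulNr => h.
rewrite (le_trans h) // mulrA [2 * _]mulrC divfK ?pnatr_eq0 // ofRM ofRX -nx.
by rewrite exprSr mulrA.
Qed.

Variables (phi h : C -> C) (k : nat).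
Hypothesis k0 : (0 < k)%N.
Hypothesis phiS : csm phi.
Hypothesis phiH : forall x, wbar (1 : C) phi x = 0.
Hypothesis hD : forall x v, is_cder h x v (v * phi x).
Let zeta : C := expi (2 * pi / k%:R).
Hypothesis phiZ : forall x, phi (zeta * x) * zeta = phi x.
Hypothesis hZ : forall x, h (zeta * x) = h x.

Let d j : C -> C := iter j (wder (1 : C)) phi.

Let dS j : csm (d j).
Proof. by elim: j => [|j IH] //=; exact: csm_wder. Qed.

Let dH j x : wbar (1 : C) (d j) x = 0.
Proof.
elim: j x => [|j IH] x /=; first exact: phiH.
rewrite -(wder_wbarC _ _ _ (dS j)) (_ : wbar _ _ = fun=> 0) ?wder_cst //.
exact/funext.
Qed.

Let dZ j x : d j (x * zeta) * zeta ^+ j.+1 = d j x.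
Proof.
elim: j x => [|j IH] x; first by rewrite /= mulrC -[RHS]phiZ [zeta * x]mulrC mulrC.
have e : d j = fun y => zeta ^+ j.+1 * d j (y * zeta) by apply/funext => y; rewrite mulrC IH.
rewrite [RHS]/= -/(d j) [in RHS]e (wderZ _ _ _ (csm_mulr zeta (dS j))) (wder_mulr zeta (dS j)).
by rewrite -[d j.+1]/(wder (1 : C) (d j)) [zeta ^+ j.+2]exprS; move: (wder _ _ _) (zeta ^+ _) => a b; ring.
Qed.

Let dP j x v : is_cder (d j) x v (v * d j.+1 x).
Proof. by rewrite -(holo_cder _ _ (dS j) (dH j)); exact: csm_is_cder. Qed.

Let d0 j : (j.+1 < k)%N -> d j 0 = 0.
Proof.
move=> jk; have := dZ j 0; rewrite mul0r => /eqP; rewrite -subr_eq0 -[X in _ - X]mulr1 -mulrBr mulf_eq0.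
rewrite subr_eq0 -(prim_order_dvd (expi_prim_root k0)) => /orP[/eqP //|].
by move=> /dvdn_leq -/(_ isT); rewrite leqNgt jk.
Qed.

Let phi_asymptotic : exists c, asymptotic phi k.-1 c.
Proof.
suff H i : (i < k)%N -> exists c, asymptotic (d (k.-1 - i)) i c.
  by have := H k.-1; rewrite subnn prednK //; apply.
elim: i => [|i IH] ik.
  exists (d k.-1 0) => e e0; rewrite subn0.
  have e1 : 0 < ofR e :> C by rewrite -ofR0 lt_ofR.
  have dc := csm_continuous (dS k.-1).
  have /cvgrPdist_lt/(_ _ e1)/nbhs_ballP[_ /= /posC[r r0 ->] rP] := dc 0.
  exists r => // x xr; rewrite !expr0 !mulr1 distrC; apply/ltW/rP.
  by rewrite /ball /= sub0r normrN.
have [c cP] := IH (ltnW ik); exists (c / i.+1%:R); apply: (asymptotic_primitive (f' := d (k.-1 - i))) => //.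
- have -> : (k.-1 - i = (k.-1 - i.+1).+1)%N by rewrite subnS prednK // subn_gt0 -ltnS prednK.
  exact: dP.
- apply: d0; rewrite -[ltnRHS](prednK k0) ltnS ltn_subrL /= -ltnS (prednK k0).
  exact: leq_ltn_trans ik.
Qed.

(* At the origin this holds because the derivatives of phi of order less than  *)
(* k - 1 vanish there.                                                         *)
Let h_expansion x0 : exists L, forall e : R, 0 < e -> exists2 r : R, 0 < r &
  forall x, `|x - x0| < ofR r -> `|h x - h x0 - L * (x ^+ k - x0 ^+ k)| <= ofR e * `|x ^+ k - x0 ^+ k|.
Proof.
have [->|x00] := eqVneq x0 0.
  have [c cP] := phi_asymptotic.
  have hD' x v : is_cder (fun x => h x - h 0) x v (v * phi x).
    have := is_cderD (hD x v) (is_cder_cst (- h 0) x v).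
    by move/is_cder_ext; apply => //; rewrite addr0.
  exists (c / k%:R) => e e0.
  have := asymptotic_primitive hD' (subrr _) cP; rewrite prednK // => /(_ e e0)[r r0 rP].
  by exists r => // x; rewrite expr0n gtn_eqF // !subr0 normrX => /rP.
have kE := prednK k0; set b := k%:R * x0 ^+ k.-1.
have b0 : b != 0 by rewrite mulf_neq0 ?pnatr_eq0 -?lt0n // expf_eq0 (negbTE x00) andbF.
pose L := phi x0 / b; exists L => e e0.
have kD y v : is_cder (fun y : C => y ^+ k) y v (v * (k%:R * y ^+ k.-1)).
  by rewrite -kE; exact: is_cder_exp.
have kc : continuous (fun y : C => k%:R * y ^+ k.-1).
  move=> y; apply: (@cvgM _ _ (nbhs y)); [exact: cvg_cst|exact: (csm_continuous (csm_exp _))].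
have bn := norm_real b; set B := Re `|b| in bn.
have B0 : 0 < B by rewrite -lt_ofR ofR0 -bn normr_gt0.
have Gder y v : is_cder (fun y => h y + - L * y ^+ k) y v (v * (phi y + - L * (k%:R * y ^+ k.-1))).
  have := is_cderD (hD y v) (is_cderM (is_cder_cst (- L) y v) (kD y v)).
  move/is_cder_ext; apply => //; move: (_ * y ^+ k.-1) (y ^+ k) (phi y) => s t u; ring.
have Gc : continuous (fun y : C => phi y + - L * (k%:R * y ^+ k.-1)).
  move=> y; apply: (@cvgD _ _ _ (nbhs y)); first exact: (csm_continuous phiS).
  by apply: (@cvgM _ _ (nbhs y)); [exact: cvg_cst|exact: kc].
have e1 : 0 < e * B / 2 by rewrite divr_gt0 // mulr_gt0.
have e2 : 0 < B / 2 by rewrite divr_gt0.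
have [r1 r10 P1] := cder_expansion Gder Gc x0 e1.
have [r2 r20 P2] := cder_expansion kD kc x0 e2.
exists (Num.min r1 r2); first by rewrite lt_min r10.
move=> x xr; have xr1 : `|x - x0| < ofR r1 by rewrite (lt_le_trans xr) // le_ofR ge_min lexx.
have xr2 : `|x - x0| < ofR r2 by rewrite (lt_le_trans xr) // le_ofR ge_min lexx orbT.
have Lb : phi x0 + - L * b = 0 by rewrite mulNr /L divfK // subrr.
have := P1 _ xr1; rewrite -/b Lb mul0r subr0.
have -> : h x + - L * x ^+ k - (h x0 + - L * x0 ^+ k) = h x - h x0 - L * (x ^+ k - x0 ^+ k) by ring.
move/le_trans; apply.
have low : ofR (B / 2) * `|x - x0| <= `|x ^+ k - x0 ^+ k|.
  have := P2 _ xr2; rewrite -/b => h2.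
  have h3 := ler_normB (x ^+ k - x0 ^+ k) (x ^+ k - x0 ^+ k - b * (x - x0)).
  rewrite subKr normrM bn in h3.
  have h4 := le_trans h3 (lerD (lexx _) h2).
  by rewrite -lerBlDr -mulrBl -ofRN -ofRD in h4; move: h4; congr (ofR _ * _ <= _); lra.
rewrite -mulrA [in X in X <= _]ofRM -mulrA ler_wpM2l // -ofR0 le_ofR; exact: ltW.
Qed.

Lemma root_invariance x y : x ^+ k = y ^+ k -> h x = h y.
Proof.
move=> xy; have [y0|y0] := eqVneq y 0.
  have : x ^+ k == 0 by rewrite xy y0 expr0n gtn_eqF.
  by rewrite expf_eq0 k0 /= y0 => /eqP ->.
have [|i yi] := prim_rootP (expi_prim_root k0) (x := x / y).
  by rewrite exprMn xy exprVn divff // expf_eq0 (negbTE y0) andbF.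
rewrite -(divfK y0 x) yi -/zeta; elim: (val i) => [|j IH]; first by rewrite mul1r.
by rewrite exprS -mulrA hZ.
Qed.

Lemma descend : exists hhat, entire hhat /\ forall x, h x = hhat (x ^+ k).
Proof.
exists (fun w => h (k.-root w)); split=> [w0|x]; last by apply: root_invariance; rewrite rootCK.
set x0 := k.-root w0; have x0k : x0 ^+ k = w0 by rewrite /x0 rootCK.
have [L LP] := h_expansion x0.
suff H : expansion (fun w => h (k.-root w)) w0 L by have [] := expansion_is_derive H.
move=> e /LP[r r0 rP]; exists (r ^+ k); first by rewrite exprn_gt0.
move=> w wr; have [x [xk xx]] := near_root k0 x0k w.
have -> : h (k.-root w) = h x by apply: root_invariance; rewrite rootCK.
rewrite -/x0 -xk -x0k; apply: rP.
rewrite -(ltr_pXn2r k0) ?nnegrE ?normr_ge0 -?ofR0 ?le_ofR ?(ltW r0) //.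
by rewrite (le_lt_trans xx) // (lt_le_trans wr) // ofRX.
Qed.

End Descent.

Section Elliptic_classification.
Context {R : realType}.
Local Notation C := (Cplx R).
Local Notation Re := complex.Re.
Local Notation Im := complex.Im.
Local Notation pt := 'rV[C]_(1 + 1).
Local Notation i0 := (lshift 1 0 : 'I_(1 + 1)).
Local Notation i1 := (rshift 1 0 : 'I_(1 + 1)).

Lemma lattice_elliptic (tau : C) : 0 < Im tau -> lattice (elliptic_lattice tau).
Proof.
move=> tau0; pose b (i : 'I_(1 + 1)) : 'rV[C]_1 := if i == i0 then const_mx 1 else const_mx tau.
have b1 : b i1 = const_mx tau by rewrite /b eq_rlshift.
exists b; split.
  move=> x; rewrite big_split_ord !big_ord1 /= b1 /b eqxx => /rowP/(_ 0); rewrite !mxE mulr1 => e.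
  have x1 : x i1 = 0.
    have /eqP := congr1 (fun y : C => Im y) e.
    by rewrite ImD ImM /= mul0r addr0 add0r mulf_eq0 (gt_eqF tau0) orbF => /eqP.
  have x0 : x i0 = 0.
    by have := congr1 (fun y : C => Re y) e; rewrite x1 ofR0 mul0r addr0.
  exact: ord2_cases.
apply/seteqP; split=> gam.
  move=> [k1 [k2 ->]]; exists (fun i => if i == i0 then k1 else k2).
  rewrite big_split_ord !big_ord1 /= b1 /b eqxx ?eq_rlshift.
  by apply/rowP => i; rewrite !mxE mulr1.
move=> [k ->]; exists (k i0), (k i1).
rewrite big_split_ord !big_ord1 /= b1 /b eqxx.
by apply/rowP => i; rewrite !mxE mulr1.
Qed.

Lemma dwedge_graph (h phi : C -> C) (p : pt) : (forall x v, is_cder h x v (v * phi x)) ->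
  continuous phi -> let a := point (const_mx 1) (phi (fiber_coord p)) in
  dwedge (fun q : pt => base_coord q + h (fiber_coord q)) p = \matrix_(i, j) (a 0 i * (a 0 j)^*).
Proof.
move=> hD phic a.
suff D (v : pt) : is_derive p v (fun q : pt => base_coord q + h (fiber_coord q))
    (v 0 i0 + v 0 i1 * phi (fiber_coord p)).
  have e i : 'D_(delta_mx 0 i) (fun q : pt => base_coord q + h (fiber_coord q)) p = a 0 i.
    have [_ ->] := D (delta_mx 0 i); move: i; apply: ord2_cases; rewrite /a ?point_base ?point_fiber !mxE.
      by rewrite eqxx eq_rlshift andbF mul0r addr0.
    by rewrite eqxx eq_lrshift andbF mul1r add0r.
  by apply/matrixP => i j; rewrite [LHS]mxE [RHS]mxE !e.
apply: is_derive_affine_line.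
set v0 := v 0 i0; set v1 := v 0 i1; set p0 := p 0 i0; set p1 := p 0 i1.
have E (t : C) : base_coord (t *: v + p) + h (fiber_coord (t *: v + p)) =
    (v0 * t + p0) + h (p1 + t * v1).
  by rewrite /base_coord !fiber_coordE !mxE -/v0 -/v1 -/p0 -/p1 [t * v0]mulrC [p1 + _]addrC.
rewrite (funext E).
have kD (t w : C) : is_cder (fun t : C => (v0 * t + p0) + h (p1 + t * v1)) t w
    (w * (v0 + v1 * phi (p1 + t * v1))).
  have h1 : is_cder (fun t : C => h (p1 + t * v1)) t w (w * v1 * phi (p1 + t * v1)).
    have [hr hi] := hD (p1 + t * v1) (w * v1).
    have e (s : R) : p1 + (t + ofR s *: w) * v1 = p1 + t * v1 + ofR s *: (w * v1).
      by rewrite mulrDl addrA -scalerAl.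
    split; rewrite /is_dline.
      by rewrite (_ : (fun s : R => _) = (fun s => Re (h (p1 + t * v1 + ofR s *: (w * v1))))) //;
        apply/funext => s; rewrite e.
    by rewrite (_ : (fun s : R => _) = (fun s => Im (h (p1 + t * v1 + ofR s *: (w * v1))))) //;
      apply/funext => s; rewrite e.
  have := is_cderD (is_cderD (is_cder_linear v0 t w) (is_cder_cst p0 t w)) h1.
  move/is_cder_ext; apply => //; move: (phi _) => y; rewrite addr0; ring.
have kc : continuous (fun t : C => v0 + v1 * phi (p1 + t * v1)).
  move=> t; apply: (@cvgD _ _ _ (nbhs t)); first exact: cvg_cst.
  apply: (@cvgM _ _ (nbhs t)); first exact: cvg_cst.
  apply: (@continuous_comp _ _ _ (fun t : C => p1 + t * v1) phi); last exact: phic.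
  apply: (@cvgD _ _ _ (nbhs t)); first exact: cvg_cst.
  by apply: (@cvgM _ _ (nbhs t)); [exact: cvg_id|exact: cvg_cst].
have := expansion_is_derive (cder_expansion kD kc 0).
by rewrite mul0r addr0 fiber_coordE.
Qed.

Lemma dwedge_fiber (p : pt) : dwedge fiber_coord p =
  \matrix_(i, j) ((point 0 1 : pt) 0 i * ((point 0 1 : pt) 0 j)^*).
Proof.
have e i : 'D_(delta_mx 0 i) (@fiber_coord R 1) p = (point 0 1 : pt) 0 i.
  rewrite (_ : @fiber_coord R 1 = fun q : pt => q 0 i1); last first.
    by apply/funext => q; rewrite fiber_coordE.
  have [_ ->] := is_derive_coord p (delta_mx 0 i) i1.
  move: i; apply: ord2_cases; rewrite ?point_base ?point_fiber !mxE.
    by rewrite eq_rlshift andbF.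
  by rewrite !eqxx.
by apply/matrixP => i j; rewrite [LHS]mxE [RHS]mxE !e.
Qed.

Lemma rotation_invariant_const (f : C -> C) : csm f -> (forall x, wbar (1 : C) f x = 0) ->
  (forall (s : R) x, f (expi s * x) = f x) -> forall x y, f x = f y.
Proof.
move=> fS fH inv.
have real (F : C -> R) : smooth F -> (forall (s : R) x, F (expi s * x) = F x) ->
    forall x : C, dline ('i * x) F x = 0.
  move=> FS Finv x.
  pose c (j : bool) : R -> R := if j then cos else sin.
  pose e (j : bool) : C := if j then x else 'i * x.
  have cD (j : bool) : is_derive (0 : R) 1 (c j) (if j then 0 else 1).
    case: j; first by have := is_derive_cos (0 : R); rewrite sin0 oppr0.
    by have := is_derive_sin (0 : R); rewrite cos0.
  have := chain_rule e FS cD; rewrite big_bool /= mul0r add0r mul1r.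
  have E (s : R) : \sum_j ofR (c j s) *: e j = expi s * x.
    rewrite big_bool /c /e /= [expi s]cplxE mulrDl /=.
    have sc (a y : C) : a *: y = a * y by [].
    by rewrite !sc mulrA [ofR (sin s) * _]mulrC.
  rewrite E expi0 mul1r => H.
  have : is_derive (0 : R) 1 (fun s : R => F (\sum_j ofR (c j s) *: e j)) 0.
    rewrite (_ : (fun s : R => _) = fun=> F x); first exact: is_derive_cst.
    by apply/funext => s; rewrite E Finv.
  case: H => _ e1; case=> _ e2; exact: (etrans (esym e1) e2).
have D0 (x : C) : x * wder (1 : C) f x = 0.
  have : cder ('i * x) f x = 0.
    rewrite cderE /cdline (real _ (csm_Re fS)) ?(real _ (csm_Im fS)) //.
    - by move=> s y; rewrite inv.
    - by move=> s y; rewrite inv.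
  rewrite (holo_cder _ _ fS fH) -mulrA => /eqP.
  by rewrite mulf_eq0 (negbTE imag_neq0) => /eqP.
have w0 x : wder (1 : C) f x = 0.
  have [->|x0] := eqVneq x 0; last first.
    by have /eqP := D0 x; rewrite mulf_eq0 (negbTE x0) => /eqP.
  apply: (@continuous_vanish R (fun s : R => wder (1 : C) f (ofR s))).
    move=> s; apply: (@continuous_comp _ _ _ (@ofR R) (wder (1 : C) f)); first exact: continuous_ofR.
    exact: (csm_continuous (csm_wder _ fS)).
  by move=> s s0; have /eqP := D0 (ofR s); rewrite mulf_eq0 fmorph_eq0 (negbTE s0) => /eqP.
by move=> x y; apply: (cder0_const fS) => z; rewrite (holo_cder _ _ fS fH) w0 mulr0.
Qed.

Variables (phi : C -> C) (u : C -> R).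
Hypothesis phiS : csm phi.
Hypothesis phiH : forall x, wbar (1 : C) phi x = 0.
Hypothesis uS : smooth u.

Definition symmetry_angle (t : R) : Prop := forall x,
  phi (expi (2 * pi * t) * x) * expi (2 * pi * t) = phi x /\ u (expi (2 * pi * t) * x) = u x.

Lemma symmetry_angle0 : symmetry_angle 0.
Proof. by move=> x; rewrite mulr0 expi0 mul1r mulr1. Qed.

Lemma symmetry_angleB s t : symmetry_angle s -> symmetry_angle t -> symmetry_angle (s - t).
Proof.
move=> Ps Pt x; set z := expi _.
have zt : expi (2 * pi * s) = z * expi (2 * pi * t) :> C.
  by rewrite -expiD -mulrDr subrK.
have tn : expi (2 * pi * t) * expi (- (2 * pi * t)) = 1 :> C by rewrite -expiD subrr expi0.
pose y := expi (- (2 * pi * t)) * x.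
have zx : z * x = expi (2 * pi * s) * y by rewrite zt /y mulrA -[z * _ * _]mulrA tn mulr1.
have xy : expi (2 * pi * t) * y = x by rewrite /y mulrA tn mul1r.
have [p1 u1] := Ps y; have [p2 u2] := Pt y; rewrite xy in p2 u2.
split; last by rewrite zx u1 u2.
have t0 : expi (2 * pi * t) != 0 :> C by rewrite -normr_eq0 norm_expi oner_eq0.
by apply: (mulIf t0); rewrite -[_ * z * _]mulrA -zt zx p1 p2.
Qed.

Lemma symmetry_angle1 : symmetry_angle 1.
Proof.
move=> x; have -> : expi (2 * pi * 1) = 1 :> C; last by rewrite mul1r mulr1.
by rewrite /expi mulr1 mulr_natl cos2pi sin2pi; apply: cplxP.
Qed.

Lemma irrational_symmetry t0 : irrational t0 -> symmetry_angle t0 ->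
  (forall x, phi x = 0) /\ (forall x, u x = u `|x|).
Proof.
move=> irr t0P; have dens := angle_dense symmetry_angle0 symmetry_angleB irr symmetry_angle1 t0P.
have ec (x : C) : continuous (fun t : R => expi (2 * pi * t) * x).
  move=> t; apply: (@cvgM _ _ (nbhs t)); last exact: cvg_cst.
  apply: (@continuous_comp _ _ _ (fun t : R => 2 * pi * t) (fun t : R => expi t : C)); last exact: continuous_expi.
  by apply: (@cvgM _ _ (nbhs t)); [exact: cvg_cst|exact: cvg_id].
have phiP t x : phi (expi (2 * pi * t) * x) * (expi (2 * pi * t) * x) = phi x * x.
  apply: (closed_property (F := fun t => phi (expi (2 * pi * t) * x) * (expi (2 * pi * t) * x))
    (G := fun=> phi x * x) _ _ dens).
  - move=> s; apply: (@cvgM _ _ (nbhs s)); last exact: ec.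
    apply: (@continuous_comp _ _ _ (fun t : R => expi (2 * pi * t) * x) phi); first exact: ec.
    exact: (csm_continuous phiS).
  - by move=> s; exact: cvg_cst.
  - by move=> s /(_ x)[e _]; rewrite mulrA e.
have uP t x : u (expi (2 * pi * t) * x) = u x.
  apply: (fmorph_inj (@ofR R)).
  apply: (closed_property (F := fun t => ofR (u (expi (2 * pi * t) * x)))
    (G := fun=> ofR (u x)) _ _ dens).
  - move=> s.
    apply: (@continuous_comp _ _ _ (fun t : R => expi (2 * pi * t) * x) (fun y => ofR (u y))); first exact: ec.
    exact: (csm_continuous (csm_ofR uS)).
  - by move=> s; exact: cvg_cst.
  - by move=> s /(_ x)[_ ->].
have pi2 : 2 * pi != 0 :> R by rewrite mulf_neq0 ?pnatr_eq0 // gt_eqF // pi_gt0.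
have ang (s : R) : s = 2 * pi * (s / (2 * pi)) by rewrite mulrC divfK.
split; last first.
  move=> x; have [s {1}->] := polar x.
  by rewrite mulrC (ang s) uP.
pose f x := x * phi x.
have fS : csm f := csmM csm_id phiS.
have fH x : wbar (1 : C) f x = 0.
  by rewrite (wbarM _ _ csm_id phiS) wbar_id phiH mulr0 mul0r addr0.
have f0 x : f x = 0.
  rewrite (rotation_invariant_const fS fH _ x 0) /f ?mul0r //.
  by move=> s y; rewrite (ang s) mulrC phiP mulrC.
move=> x; have [->|x0] := eqVneq x 0; last first.
  by have /eqP := f0 x; rewrite mulf_eq0 (negbTE x0) => /eqP.
apply: (@continuous_vanish R (fun s : R => phi (ofR s))).
  move=> s; apply: (@continuous_comp _ _ _ (@ofR R) phi); first exact: continuous_ofR.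
  exact: (csm_continuous phiS).
by move=> s s0; have /eqP := f0 (ofR s); rewrite mulf_eq0 fmorph_eq0 (negbTE s0) => /eqP.
Qed.

Lemma rational_symmetry (k : nat) (t1 t2 : R) :
  let clears (j : nat) := [/\ (0 < j)%N, j%:R * t1 \is a Num.int & j%:R * t2 \is a Num.int] in
  clears k -> (forall j, clears j -> (k <= j)%N) ->
  symmetry_angle t1 -> symmetry_angle t2 -> symmetry_angle (k%:R^-1).
Proof.
move=> clears [k0 /intrP[p pE] /intrP[q qE]] kmin P1 P2.
have kn : k%:R != 0 :> R by rewrite pnatr_eq0 -lt0n.
have e1 : t1 = p%:~R / k%:R by rewrite -pE mulrC mulKf.
have e2 : t2 = q%:~R / k%:R by rewrite -qE mulrC mulKf.
apply: (angle_bezout symmetry_angle0 symmetry_angleB (p := p) (q := q) k0) => //.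
- by move=> j; rewrite -e1 -e2; exact: kmin.
- exact: symmetry_angle1.
- by rewrite -e1.
- by rewrite -e2.
Qed.

End Elliptic_classification.

(** * Completeness of the flat metric *)

Section Flat_distance.
Context {R : realType} {n : nat}.
Local Notation C := (Cplx R).
Local Notation Re := complex.Re.
Local Notation Im := complex.Im.
Local Notation pt := 'rV[C]_n.
Local Notation flat_metric := (fun _ : pt => 1%:M : 'M[C]_n).

Lemma Re_hermitian_square (v : pt) : Re ((v *m 1%:M *m adjmx v) 0 0) =
  \sum_j (Re (v 0 j) ^+ 2 + Im (v 0 j) ^+ 2).
Proof.
rewrite mulmx1 mxE (big_morph (fun x : C => Re x) (@ReD R) (erefl _)).
by apply: eq_bigr => j _; rewrite adjmxE ReM Re_conj Im_conj; ring.
Qed.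

Lemma flat_speed (c : R -> pt) t : speed flat_metric c t =
  Num.sqrt (\sum_j (derive1 (fun s : R => Re (c s 0 j)) t ^+ 2 +
                    derive1 (fun s : R => Im (c s 0 j)) t ^+ 2)).
Proof.
by rewrite /speed Re_hermitian_square; congr Num.sqrt; apply: eq_bigr => j _; rewrite !mxE.
Qed.

Lemma flat_speed_continuous (c : R -> pt) : C1_curve c -> continuous (speed flat_metric c).
Proof.
move=> cC t; rewrite (funext (flat_speed c)).
apply: (@continuous_comp _ _ _ _ (@Num.sqrt R)); last exact: sqrt_continuous.
apply: (@cvg_big _ _ _ _ _ add_continuous _ (nbhs t)) => j _.
have [[_ c1] [_ c2]] := cC j.
by apply: (@cvgD _ _ _ (nbhs t)); apply: (@cvgM _ _ (nbhs t)); [exact: c1|exact: c1|exact: c2|exact: c2].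
Qed.

Lemma displacement_le (f s : R -> R) : C1_real f -> continuous s ->
  (forall t, `|derive1 f t| <= s t) ->
  ((`|f 1 - f 0|)%:E <= \int[lebesgue_measure]_(t in `[0%R, 1%R]) (s t)%:E)%E.
Proof.
move=> [fD fc] sc fs.
have FC : continuous f by move=> t; apply/differentiable_continuous/derivable1_diffP; exact: fD.
have lr : derivable_oo_LRcontinuous f 0 1.
  split; [by move=> t _; exact: fD|exact: cvg_at_right_filter (FC 0)|exact: cvg_at_left_filter (FC 1)].
have e := continuous_FTC2 ltr01 (continuous_subspaceT fc) lr (fun t _ => erefl).
rewrite -abse_EFin EFinB -e.
have cm := @measurable_realfun.continuous_measurable_fun R.
apply: (@le_trans _ _ (\int[lebesgue_measure]_(t in `[0%R, 1%R]) `|(derive1 f t)%:E|)%E).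
  apply: le_abse_integral; first exact: measurable_itv.
  by apply/measurable_realfun.measurable_EFinP/measurable_funTS; exact: cm.
apply: ge0_le_integral; [exact: measurable_itv|by []| | | ].
- apply/measurable_realfun.measurable_EFinP/measurable_funTS; apply: (cm (fun t => `|derive1 f t|)) => t.
  by apply: (@cvg_norm _ _ _ (nbhs t)); exact: fc.
- by apply/measurable_realfun.measurable_EFinP/measurable_funTS; exact: cm.
- by move=> t _; rewrite lee_fin.
Qed.

Definition close (a b : pt) (d : R) := forall j, `|a 0 j - b 0 j| <= ofR d.

Lemma close_of_dist (A B : set pt) (d : R) : (riem_dist flat_metric A B < d%:E)%E ->
  exists a b, [/\ A a, B b & close a b (2 * d)].
Proof.
move=> /ereal_inf_lt[L [c [cC c0 c1 ->]] Ld].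
exists (c 0), (c 1); split=> // j.
have sc := flat_speed_continuous cC.
have le_s (x y : R) (t : R) : x ^+ 2 + y ^+ 2 <= \sum_j (derive1 (fun s : R => Re (c s 0 j)) t ^+ 2 +
                    derive1 (fun s : R => Im (c s 0 j)) t ^+ 2) -> `|x| <= speed flat_metric c t.
  move=> xy; rewrite flat_speed -sqrtr_sqr; apply: ler_wsqrtr; apply: le_trans xy.
  by rewrite lerDl sqr_ge0.
have term t : derive1 (fun s : R => Re (c s 0 j)) t ^+ 2 + derive1 (fun s : R => Im (c s 0 j)) t ^+ 2 <=
    \sum_j (derive1 (fun s : R => Re (c s 0 j)) t ^+ 2 + derive1 (fun s : R => Im (c s 0 j)) t ^+ 2).
  by rewrite (bigD1 j) //= lerDl sumr_ge0 // => i _; rewrite addr_ge0 ?sqr_ge0.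
have [C1 C2] := cC j.
have b1 := displacement_le C1 sc (fun t => le_s _ _ t (term t)).
have b2 : ((`|Im (c 1 0 j) - Im (c 0 0 j)|)%:E <= curve_length flat_metric c)%E.
  apply: (displacement_le C2 sc) => t; apply: (le_s _ (derive1 (fun s : R => Re (c s 0 j)) t)).
  by rewrite addrC; exact: term.
have {}b1 := ltW (le_lt_trans b1 Ld); have {}b2 := ltW (le_lt_trans b2 Ld).
rewrite lee_fin in b1; rewrite lee_fin in b2.
rewrite distrC; apply: le_trans (normc_le _) _; rewrite le_ofR ReB ImB.
by rewrite mulr_natl mulr2n lerD.
Qed.

Lemma dist_of_close (A B : set pt) a b (d : R) : A a -> B b -> close a b d ->
  (riem_dist flat_metric A B <= (n%:R * d)%:E)%E.
Proof.
move=> Aa Bb ab; pose c (t : R) : pt := a + ofR t *: (b - a).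
have cre j (t : R) : is_derive t 1 (fun s : R => Re (c s 0 j)) (Re (b 0 j - a 0 j)).
  rewrite (_ : (fun s => _) = fun s : R => Re (a 0 j) + Re (b 0 j - a 0 j) * s).
    have := is_deriveD (is_derive_cst (Re (a 0 j)) t (1 : R)) (is_deriveZ (Re (b 0 j - a 0 j)) (is_derive_id t (1 : R))).
    by move/is_derive_ext; apply => //; rewrite add0r [_ *: _]mulr1.
  by apply/funext => s; rewrite !mxE Re_affine mulrC.
have cim j (t : R) : is_derive t 1 (fun s : R => Im (c s 0 j)) (Im (b 0 j - a 0 j)).
  rewrite (_ : (fun s => _) = fun s : R => Im (a 0 j) + Im (b 0 j - a 0 j) * s).
    have := is_deriveD (is_derive_cst (Im (a 0 j)) t (1 : R)) (is_deriveZ (Im (b 0 j - a 0 j)) (is_derive_id t (1 : R))).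
    by move/is_derive_ext; apply => //; rewrite add0r [_ *: _]mulr1.
  by apply/funext => s; rewrite !mxE Im_affine mulrC.
have dre j (t : R) : derive1 (fun s : R => Re (c s 0 j)) t = Re (b 0 j - a 0 j).
  by rewrite derive1E; case: (cre j t).
have dim j (t : R) : derive1 (fun s : R => Im (c s 0 j)) t = Im (b 0 j - a 0 j).
  by rewrite derive1E; case: (cim j t).
have cC : C1_curve c.
  move=> j; split; split.
  - by move=> t; case: (cre j t).
  - by rewrite (funext (dre j)) => t; exact: cvg_cst.
  - by move=> t; case: (cim j t).
  - by rewrite (funext (dim j)) => t; exact: cvg_cst.
apply: ge_ereal_inf; exists (curve_length flat_metric c).
  by exists c; split=> //; rewrite /c ?ofR0 ?scale0r ?addr0 // ofR1 scale1r addrC subrK.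
pose S := \sum_j (Re (b 0 j - a 0 j) ^+ 2 + Im (b 0 j - a 0 j) ^+ 2).
have sE t : speed flat_metric c t = Num.sqrt S.
  by rewrite flat_speed; congr Num.sqrt; apply: eq_bigr => j _; rewrite dre dim.
rewrite /curve_length (eq_integral (cst (Num.sqrt S)%:E)); last by move=> t _; rewrite sE.
rewrite integral_cst ?measurable_itv //= lebesgue_measure_itv /= lte_fin ltr01 oppr0 adde0 mule1 lee_fin.
have sq j : Re (b 0 j - a 0 j) ^+ 2 + Im (b 0 j - a 0 j) ^+ 2 <= d ^+ 2.
  rewrite -le_ofR ofRX; apply: (@le_trans _ _ (`|b 0 j - a 0 j| ^+ 2)).
    rewrite normCK le_eqVlt; apply/orP; left; apply/eqP; apply: cplxP; rewrite ?ReM ?ImM ?Re_conj ?Im_conj /=; ring.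
  have := ab j; rewrite distrC => h; rewrite lerXn2r // nnegrE //; exact: le_trans h.
have S0 : S <= n%:R * d ^+ 2.
  by rewrite mulr_natl -[n in leRHS]card_ord -sumr_const; apply: ler_sum => j _; exact: sq.
have [n0|n0] := posnP n.
  by rewrite ler0_sqrtr ?n0 ?mul0r //; move: S0; rewrite n0 mul0r.
have d0 : 0 <= d.
  by rewrite -le_ofR; apply: le_trans (ab (Ordinal n0)); rewrite ofR0.
rewrite -[leRHS]ger0_norm ?mulr_ge0 // -sqrtr_sqr; apply: ler_wsqrtr.
apply: le_trans S0 _; rewrite exprMn ler_wpM2r ?sqr_ge0 // expr2.
by rewrite ler_peMl ?ler1n // ler0n.
Qed.

End Flat_distance.

Section Flat_total_space.
Context {R : realType} {m : nat}.
Local Notation C := (Cplx R).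
Local Notation Re := complex.Re.
Local Notation Im := complex.Im.
Local Notation V := 'rV[C]_m.
Local Notation pt := 'rV[C]_(m + 1).
Local Notation flat_metric := (fun _ : pt => 1%:M : 'M[C]_(m + 1)).
Context (Gam : set V) (H : V -> V -> C) (alpha : V -> C).
Hypothesis GamL : lattice Gam.
Hypothesis LB : line_bundle_data Gam H alpha.
Hypothesis H0 : forall z w, H z w = 0.
Local Notation dk := (deck H alpha).

Lemma lattice_addr x y : Gam x -> Gam y -> Gam (x + y).
Proof.
have [b [_ ->]] := GamL => -[k ->] [l ->]; exists (fun i => k i + l i).
by rewrite -big_split; apply: eq_bigr => i _; rewrite /= rmorphD scalerDl.
Qed.

Lemma lattice_oppr x : Gam x -> Gam (- x).
Proof.
have [b [_ ->]] := GamL => -[k ->]; exists (fun i => - k i).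
by rewrite -sumrN; apply: eq_bigr => i _; rewrite rmorphN scaleNr.
Qed.

Lemma semicharacterD x y : Gam x -> Gam y -> alpha (x + y) = alpha x * alpha y.
Proof. by move=> xG yG; rewrite (lb_semicharacter LB xG yG) H0 mulr0 expi0 mul1r. Qed.

Lemma deck_trivial gam z xi : dk gam (point z xi) = point (z + gam) (alpha gam * xi).
Proof. by rewrite deck_point mult_trivial. Qed.

Lemma deck_deck x y p : Gam x -> Gam y -> dk x (dk y p) = dk (y + x) p.
Proof.
move=> xG yG; rewrite [p]pointE !deck_trivial -addrA semicharacterD //.
by rewrite mulrA [alpha x * _]mulrC.
Qed.

Lemma lattice0 : Gam 0.
Proof.
by have [b [_ ->]] := GamL; exists (fun=> 0); rewrite big1 // => i _; rewrite scale0r.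
Qed.

Lemma deck0 p : dk 0 p = p.
Proof.
have a0 : alpha 0 != 0 by rewrite -normr_eq0 (lb_unitary LB lattice0) oner_eq0.
have a1 : alpha 0 = 1.
  by apply: (mulfI a0); rewrite mulr1 -(semicharacterD lattice0 lattice0) addr0.
by rewrite [p]pointE deck_trivial addr0 a1 mul1r.
Qed.

Lemma deck_close gam a b (d : R) : Gam gam -> close a b d -> close (dk gam a) (dk gam b) d.
Proof.
move=> gG ab j; have := ab j; rewrite [a]pointE [b]pointE !deck_trivial.
case: (split_ordP j) => k ->.
  by rewrite !point_base !mxE opprD addrACA subrr addr0.
by rewrite !point_fiber -mulrBr normrM (lb_unitary LB gG) mul1r.
Qed.

Definition orbit (p : pt) : set pt := [set dk gam p | gam in Gam].

Lemma deck_orbit gam a p : Gam gam -> orbit p a -> orbit p (dk gam a).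
Proof. by move=> gG [x xG <-]; exists (x + gam); [exact: lattice_addr|rewrite deck_deck]. Qed.

Lemma orbit_sym a b p : orbit p a -> orbit p b -> exists2 gam, Gam gam & dk gam a = b.
Proof.
move=> [x xG <-] [y yG <-]; exists (- x + y); first exact/lattice_addr/yG/lattice_oppr.
rewrite deck_deck ?addNKr //; last exact/lattice_addr/yG/lattice_oppr.
Qed.

Lemma orbit_translate a b q p p' : orbit p a -> orbit p q -> orbit p' b -> forall d, close a b d ->
  exists2 b', orbit p' b' & close q b' d.
Proof.
move=> aO qO bO d ab; have [gam gG <-] := orbit_sym aO qO.
by exists (dk gam b); [exact: deck_orbit|exact: deck_close].
Qed.

(* |xi| is invariant under the deck transformations, so a Cauchy sequence of    *)
(* orbits has representatives in a compact set; any cluster point of them is    *)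
(* the limit.                                                                  *)
Lemma flat_complete : complete_metric flat_metric (total_space Gam H alpha).
Proof.
move=> x xQ xC.
have /choice[P PE] : forall k, exists p, orbit p = x k by move=> k; have [p _ pE] := xQ k; exists p.
have [l lP] := lattice_cell GamL.
have [N NP] := xC 1 ltr01.
have PN : x N (P N) by rewrite -PE; exists 0; [exact: lattice0|exact: deck0].
pose r := Re `|fiber_coord (P N)| + 2.
have near_rep (e : R) k i : (riem_dist flat_metric (x k) (x i) < e%:E)%E ->
    forall q, x k q -> exists2 b, x i b & close q b (2 * e).
  move=> /close_of_dist[a [b [ax bx ab]]] q qx.
  by rewrite -PE in ax qx bx *; rewrite -PE in bx *; exact: (orbit_translate ax qx bx ab).
have rep k : exists q, x (N + k)%N q /\ cell_box l r q.
  have [|b bx cb] := near_rep 1 N (N + k)%N _ (P N) PN; first by apply: NP; rewrite ?leq_addr.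
  set xi := fiber_coord b; have [c [gam [cc gG bz]]] := lP (lsubmx b).
  have nG := lattice_oppr gG; exists (dk (- gam) b); split.
    by rewrite -PE in bx *; exact: deck_orbit.
  have xr : `|alpha (- gam) * xi| <= ofR r.
    rewrite normrM (lb_unitary LB nG) mul1r /r ofRD -norm_real -lerBlDl.
    apply: le_trans (lerB_dist _ _) _; rewrite distrC.
    by have := cb (rshift m 0); rewrite -!fiber_coordE mulr1 rmorph_nat.
  exists (c, alpha (- gam) * xi); first by split=> //; split; [exact: Re_le_norm|exact: Im_le_norm].
  by rewrite [b in RHS]pointE deck_trivial bz addrK.
have /choice[q qP] := rep.
have [p [_ pcl]] : (cell_box l r `&` cluster (q @ \oo) !=set0)%classic.
  apply: compact_cell_box.
  by exists 0 => // k _; case: (qP k).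
exists (orbit p); first by exists p.
move=> e e0; pose e1 := e / (4 * (m + 1)%:R).
have m0 : 0 < (m + 1)%:R :> R by rewrite ltr0n addn1.
have e10 : 0 < e1 by rewrite divr_gt0 // mulr_gt0.
have [N' N'P] := xC e1 e10; exists N' => k kN.
have [_ [[i iN <-] qp]] : ([set q i | i in [set i | (N' <= i)%N]] `&`
    [set y : pt | forall j, `|y 0 j - p 0 j| < ofR e1])%classic !=set0.
  apply: pcl; first by exists N' => // i /= iN; exists i.
  apply: (@filter_forall _ _ (fun j (y : pt) => `|y 0 j - p 0 j| < ofR e1) (nbhs p)) => j; have e1C : 0 < ofR e1 :> C by rewrite -ofR0 lt_ofR.
  have cj := @coord_continuous C 1 (m + 1) 0 j.
  have /cvgrPdist_lt/(_ _ e1C) := cj p.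
  by apply: filterS => y; rewrite distrC.
have [qx _] := qP i.
have [|b bx qb] := near_rep e1 (N + i)%N k _ (q i) qx.
  by apply: N'P => //; rewrite (leq_trans iN) // leq_addl.
have bp : close b p (3 * e1).
  move=> j; have -> : b 0 j - p 0 j = (q i 0 j - p 0 j) - (q i 0 j - b 0 j) by ring.
  apply: le_trans (ler_normB _ _) _; have -> : 3 * e1 = e1 + 2 * e1 by ring.
  by rewrite ofRD lerD // ltW.
apply: le_lt_trans (dist_of_close bx _ bp) _; first by exists 0; [exact: lattice0|exact: deck0].
rewrite lte_fin /e1; have -> : (m + 1)%:R * (3 * (e / (4 * (m + 1)%:R))) = 3 / 4 * e.
  by field; rewrite gt_eqF.
by rewrite gtr_pMl //; lra.
Qed.

Lemma flat_kaehler : kaehler_metric flat_metric.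
Proof.
split.
- by move=> i j; apply/csmP; exact: csm_cst.
- by move=> p; exact: adjmx1.
- move=> p v v0; rewrite mulmx1 mxE (eq_bigr (fun j => `|v 0 j| ^+ 2)); last first.
    by move=> j _; rewrite adjmxE normCK.
  rewrite lt_def sumr_ge0 ?andbT; last by move=> j _; exact: exprn_ge0.
  apply/negP => /eqP s0; case/eqP: v0; apply/rowP => j; rewrite [RHS]mxE.
  have := psumr_eq0P (fun j _ => exprn_ge0 2 (normr_ge0 (v 0 j))) s0 => /(_ j isT)/eqP.
  by rewrite expf_eq0 normr_eq0 => /eqP.
- by move=> p i j k; rewrite wirtE !wder_cst.
Qed.

Lemma flat_on_total_space : kaehler_on_total_space Gam H alpha flat_metric.
Proof.
split; first exact: flat_kaehler.
move=> gam gG p; rewrite /pullback (deck_jacobian LB) [p]pointE deck_jac_trivial // mulmx1.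
rewrite /adjmx map_block_mx tr_block_mx !map_mx0 !trmx0 map_mx1 trmx1 map_scalar_mx tr_scalar_mx.
rewrite mulmx_block !mulmx0 !mul0mx !addr0 !add0r mulmx1 -scalar_mxM -normCK (lb_unitary LB gG).
by rewrite expr1n -scalar_mx_block.
Qed.

Lemma flat_BI_ge0 : BI_ge0 flat_metric.
Proof.
move=> p v w; rewrite /bisectional big1 // => i _; rewrite big1 // => j _; rewrite big1 // => k _.
rewrite big1 // => l _; suff -> : curvature flat_metric i j k l p = 0 by rewrite !mul0r.
rewrite /curvature wirtE wirtbarE (_ : wbar _ _ = fun=> 0); last first.
  by apply/funext => q; rewrite wbar_cst.
rewrite wder_cst oppr0 add0r big1 // => a _; rewrite big1 // => b _.
by rewrite wder_cst mulr0 mul0r.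
Qed.

End Flat_total_space.

Theorem theorem1p7 (R : realType) :
  (forall (tau : Cplx R) (H : R) (alpha : 'rV[Cplx R]_1 -> Cplx R),
     0 < complex.Im tau ->
     line_bundle_data (elliptic_lattice tau) (elliptic_form H) alpha ->
     let good_metric :=
       complete_kaehler_BI_ge0 (elliptic_lattice tau) (elliptic_form H) alpha in
     ((exists omega, good_metric omega) <-> H = 0) /\
     (forall (omega : 'rV[Cplx R]_(1 + 1) -> 'M[Cplx R]_(1 + 1))
        (theta1 theta2 : R),
        good_metric omega -> ~ flat omega ->
        0 <= theta1 < 1 -> 0 <= theta2 < 1 ->
        alpha (const_mx 1) = expi (2 * pi * theta1) ->
        alpha (const_mx tau) = expi (2 * pi * theta2) ->
        (irrational theta1 \/ irrational theta2 ->
           exists (K : R) (u : Cplx R -> R),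
             [/\ 0 < K,
                 smooth u /\ (forall xi, 0 < u xi),
                 superharmonic (fun xi => ln (u xi)),
                 (forall xi, u xi = u `|xi|) &
                 forall p, omega p =
                   ofR K *: dwedge base_coord p +
                   ofR (u `|fiber_coord p|) *: dwedge fiber_coord p]) /\
        (rational theta1 -> rational theta2 ->
           forall k : nat,
             let clears (j : nat) :=
               [/\ (0 < j)%N, j%:R * theta1 \is a Num.int
                            & j%:R * theta2 \is a Num.int] in
             clears k -> (forall j, clears j -> (k <= j)%N) ->
             exists (K : R) (h hhat : Cplx R -> Cplx R) (u : Cplx R -> R),
               [/\ 0 < K,
                   entire hhat /\ (forall xi, h xi = hhat (xi ^+ k)),
                   smooth u /\ (forall xi, 0 < u xi),
                   superharmonic (fun xi => ln (u xi)) &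
                   (forall xi, u xi = u (expi (2 * pi / k%:R) * xi)) /\
                   (forall p, omega p =
                      ofR K *:
                        dwedge (fun q => base_coord q + h (fiber_coord q)) p +
                      ofR (u (fiber_coord p)) *: dwedge fiber_coord p)])))
  /\
  (forall (n : nat) (Gam : set 'rV[Cplx R]_n.-1)
     (H : 'rV[Cplx R]_n.-1 -> 'rV[Cplx R]_n.-1 -> Cplx R)
     (alpha : 'rV[Cplx R]_n.-1 -> Cplx R)
     (g : 'rV[Cplx R]_(n.-1 + 1) -> 'M[Cplx R]_(n.-1 + 1))
     (g0 : 'rV[Cplx R]_1 -> 'M[Cplx R]_1)
     (Phi : 'rV[Cplx R]_(n.-1 + 1) -> 'rV[Cplx R]_(n.-1 + 1)),
     (3 <= n)%N ->
     lattice Gam -> line_bundle_data Gam H alpha ->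
     complete_kaehler_BI_ge0 Gam H alpha g ->
     kaehler_metric g0 -> complete_metric g0 points ->
     (forall x, 0 <= gauss_curvature g0 x) ->
     biholomorphic Phi ->
     (forall p, g p = pullback Phi (euclidean_product g0) p) ->
     forall z w, H z w = 0).
Proof.
split; last first.
  move=> n Gam H alpha g g0 Phi _ GamL LB [gX _ BI] _ _ _ _ _.
  exact: (form_vanishes GamL LB gX BI).
move=> tau H alpha tau0 LB good_metric.
have GamL := lattice_elliptic tau0.
have H0 omega : good_metric omega -> H = 0.
  case=> gX _ BI; have := form_vanishes GamL LB gX BI (const_mx 1) (const_mx 1).
  by rewrite /elliptic_form !mxE conjC1 !mulr1 => /eqP; rewrite fmorph_eq0 => /eqP.
have form0 : H = 0 -> forall z w, elliptic_form H z w = 0.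
  by move=> -> z w; rewrite /elliptic_form ofR0 !mul0r.
split.
  split=> [[omega] /H0 //|/form0 f0]; exists (fun=> 1%:M); split.
  - exact: flat_on_total_space.
  - exact: flat_complete.
  - exact: flat_BI_ge0.
move=> omega theta1 theta2 good _ _ _ a1 a2; have f0 := form0 (H0 _ good).
have [gX _ BI] := good.
have [K [phi [u [K0 [phiS phiH] [uS u0] uL [inv omegaE]]]]] := elliptic_structure GamL LB gX BI f0.
have P1 : symmetry_angle phi u theta1.
  by move=> x; rewrite -a1; apply: inv; exists 1, 0; rewrite mul0r addr0.
have P2 : symmetry_angle phi u theta2.
  by move=> x; rewrite -a2; apply: inv; exists 0, 1; rewrite mul1r add0r.
split=> [irr|_ _ k clears kP kmin].
  have [phi0 ur] : (forall x, phi x = 0) /\ (forall x, u x = u `|x|).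
    by case: irr => irr; exact: (irrational_symmetry phiS phiH uS irr).
  exists K, u; split; [exact: K0|exact: (conj uS u0)|exact: uL|exact: ur|move=> p].
  rewrite omegaE -ur dwedge_fiber; congr (_ *: _ + _).
  have zD (x v : Cplx R) : is_cder (fun=> 0 : Cplx R) x v (v * phi x).
    by rewrite phi0 mulr0; exact: is_cder_cst.
  have := dwedge_graph p zD (csm_continuous phiS).
  by rewrite /= (funext (fun q => addr0 (base_coord q))).
have Pk := rational_symmetry kP kmin P1 P2.
have [k0 _ _] := kP.
have phiZ x : phi (expi (2 * pi / k%:R) * x) * expi (2 * pi / k%:R) = phi x by case: (Pk x).
have hD := is_cder_primitive phiS phiH.
have [hhat [hE hP]] := descend k0 phiS phiH hD phiZ (fun x => primitive_invariant x phiZ).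
exists K, (primitive phi), hhat, u; split; [exact: K0|exact: (conj hE hP)|exact: (conj uS u0)|exact: uL|].
split=> [x|p]; first by case: (Pk x).
by rewrite omegaE dwedge_fiber (dwedge_graph p hD (csm_continuous phiS)).
Qed.
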